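(* Let $\Sigma$ be a finite alphabet. For every unary query $\phi$ of (Extended Regular) XPath over data trees with labels in $\Sigma$, there is a class automaton over the input alphabet $\Sigma\times\{0,1\}$ which accepts exactly the data trees in $$L_\phi=\{(t\otimes X,\sim) : (t,\sim)\text{ is a data tree over }\Sigma,\ X=\phi(t,\sim)\}.$$
   Context: Trees are finite, unranked, sibling-ordered, with nodes labeled by a finite alphabet. A data tree over $\Sigma$ is a pair $(t,\sim)$ where $t$ is a tree labeled by $\Sigma$ and $\sim$ is an equivalence relation on the nodes of $t$; a class is an equivalence class of $\sim$. If $t,s$ are trees over $\Sigma,\Gamma$ with the same nodes, $t\otimes s$ is the tree over $\Sigma\times\Gamma$ with the same nodes, where each node carries its pair of labels. If $X$ is a set of nodes of $t$, then $t\otimes X$ is the tree over $\Sigma\times\{0,1\}$ obtained by adding the characteristic function of $X$ as second coordinate. An $n$-ary query $\phi$ over data trees maps each data tree $(t,\sim)$ to a set $\phi(t,\sim)$ of $n$-tuples of its nodes. Extended Regular XPath (called XPath for short) is defined inductively. (i) Let $\Gamma$ be a finite set of already defined unary XPath queries (empty in the induction base), and let $\varphi[x_1,\dots,x_m]$ be a formula of monadic second-order logic (MSO; with quantification over nodes and sets of nodes) that uses the queries of $\Gamma$ as unary predicates, unary predicates for the letters of the alphabet, and the binary child and next-sibling predicates, but does not use $\sim$ (other than inside the queries of $\Gamma$). Then $\varphi$ is an $m$-ary XPath query. (ii) If $\varphi[x,y_1,y_2]$ is a ternary XPath query, then $\exists y_1\exists y_2\ (y_1\sim y_2\wedge\varphi[x,y_1,y_2])$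 and $\exists y_1\exists y_2\ (y_1\not\sim y_2\wedge\varphi[x,y_1,y_2])$ are unary XPath queries (with free variable $x$). A nondeterministic letter-to-letter transducer $f$ from $\Sigma$ to $\Gamma$ is a regular language of trees over $\Sigma\times\Gamma$; one writes $s\in f(t)$ when $t,s$ have the same nodes and $t\otimes s$ belongs to this language. A class automaton consists of an input alphabet $\Sigma$, a finite work alphabet $\Gamma$, a nondeterministic letter-to-letter transducer $f$ from $\Sigma$ to $\Gamma$, and a regular language of trees over $\Gamma\times\{0,1\}$ called the class condition. It accepts a data tree $(t,\sim)$ over $\Sigma$ if there is some $s\in f(t)$ such that for every class $X$ of $\sim$ the tree $s\otimes X$ belongs to the class condition. *)

(* Defs.v *)
From HB Require Import structures.
From mathcomp Require Import all_boot.

Set Implicit Arguments.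
Unset Strict Implicit.
Unset Printing Implicit Defensive.

(** ** Trees *)

(* The nodes and edges of a finite, unranked, sibling-ordered tree. *)
Inductive shape := Shape of seq shape.

(* Nodes are addresses: [[::]] is the root, and [rcons p i] is the [i]-th child
   (from the left, starting with 0) of the node [p]. *)
Fixpoint nodes (T : shape) : seq (seq nat) :=
  let: Shape ts := T in
  [::] :: flatten [seq [seq ip.1 :: p | p <- ip.2]
                  | ip <- zip (iota 0 (size ts)) [seq nodes u | u <- ts]].

Definition node (T : shape) := seq_sub (nodes T).

HB.instance Definition _ (T : shape) := Finite.copy (node T) (seq_sub (nodes T)).

Lemma root_subproof (T : shape) : [::] \in nodes T.
Proof. by case: T => ts; rewrite inE. Qed.

Definition root (T : shape) : node T := SeqSub (root_subproof T).

(* The last entry of an address; meaningless for the root. *)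
Definition sibling_index (T : shape) (x : node T) : nat := last 0 (val x).

Definition child (T : shape) (x y : node T) : bool :=
  val y == rcons (val x) (sibling_index y).

Definition next_sibling (T : shape) (x y : node T) : bool :=
  [exists z, child z x && child z y]
  && (sibling_index y == (sibling_index x).+1).

Definition children (T : shape) (x : node T) : seq (node T) :=
  sort (fun y z => sibling_index y <= sibling_index z) (enum (child x)).

Record tree (A : Type) := Tree {
  tree_shape :> shape;
  label : {ffun node tree_shape -> A}
}.

(* A tree over [B] with the same nodes as [t] is given by its labelling [s]. *)
Definition tensor (A B : Type) (t : tree A) (s : {ffun node t -> B}) :
    tree (A * B) :=
  Tree [ffun x => (label t x, s x)].

Arguments tensor {A B} t s.

Definition tensor_set (A : Type) (t : tree A) (X : {set node t}) :
    tree (A * bool) :=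
  tensor t [ffun x => x \in X].

Arguments tensor_set {A} t X.

(** ** Regular languages *)

Record nfa (A : Type) := Nfa {
  nfa_state : finType;
  nfa_init : {set nfa_state};
  nfa_step : nfa_state -> A -> {set nfa_state};
  nfa_final : {set nfa_state}
}.

Fixpoint nfa_accepts_from (A : Type) (M : nfa A) (q : nfa_state M) (w : seq A) :
    bool :=
  if w is a :: w' then [exists q' in nfa_step q a, nfa_accepts_from q' w']
  else q \in nfa_final M.

Definition nfa_accepts (A : Type) (M : nfa A) (w : seq A) : bool :=
  [exists q in nfa_init M, nfa_accepts_from q w].

(* Nondeterministic automata on unranked trees: a node labelled [a] may carry
   the state [q] when the word of states of its children, from left to right,
   belongs to the regular language given by [ta_horizontal q a]. *)
Record tree_automaton (A : Type) := TreeAutomaton {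
  ta_state : finType;
  ta_horizontal : ta_state -> A -> nfa ta_state;
  ta_final : {set ta_state}
}.

Definition is_run (A : Type) (M : tree_automaton A) (t : tree A)
    (r : {ffun node t -> ta_state M}) : Prop :=
  forall x : node t,
    nfa_accepts (ta_horizontal (r x) (label t x)) [seq r y | y <- children x].

Definition ta_accepts (A : Type) (M : tree_automaton A) (t : tree A) : Prop :=
  exists2 r : {ffun node t -> ta_state M}, is_run r & r (root t) \in ta_final M.

Definition regular (A : Type) (L : tree A -> Prop) : Prop :=
  exists M : tree_automaton A, forall t : tree A, L t <-> ta_accepts M t.

Record regular_language (A : Type) := RegularLanguage {
  language :> tree A -> Prop;
  language_regular : regular language
}.

(** ** Data trees, queries and class automata *)

Record data_tree (A : Type) := DataTree {
  data_tree_tree :> tree A;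
  sim : rel (node data_tree_tree);
  sim_equiv : equivalence_rel sim
}.

Arguments sim {A} d : rename.
Arguments sim_equiv {A} d : rename.

Definition classes (A : Type) (d : data_tree A) : {set {set node d}} :=
  equivalence_partition (sim d) [set: node d].

Definition data_tensor_set (A : Type) (d : data_tree A) (X : {set node d}) :
    data_tree (A * bool) :=
  @DataTree _ (tensor_set d X) (sim d) (sim_equiv d).

Definition query (A : Type) (n : nat) :=
  forall d : data_tree A, {set n.-tuple (node d)}.

Record class_automaton (A : finType) := ClassAutomaton {
  work_alphabet : finType;
  transducer : regular_language (A * work_alphabet);
  class_condition : regular_language (work_alphabet * bool)
}.

Definition ca_accepts (A : finType) (C : class_automaton A) (d : data_tree A) :
    Prop :=
  exists s : {ffun node d -> work_alphabet C},
    transducer C (tensor d s) /\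
    forall X : {set node d}, X \in classes d ->
      class_condition C (tensor_set (Tree s) X).

(** ** Extended Regular XPath *)

(* Formulas of monadic second-order logic over trees labelled by [A], with [k]
   additional unary predicates, whose free variables are among [n] node
   variables and [m] set variables.  Variables are de Bruijn indices: a
   quantifier binds the variable of index 0 and shifts the others by one. *)
Inductive mso (A : Type) (k : nat) : nat -> nat -> Type :=
| MLabel n m (a : A) (x : 'I_n) : mso A k n m
| MPred n m (i : 'I_k) (x : 'I_n) : mso A k n m
| MChild n m (x y : 'I_n) : mso A k n m
| MNext n m (x y : 'I_n) : mso A k n m
| MEq n m (x y : 'I_n) : mso A k n m
| MIn n m (x : 'I_n) (X : 'I_m) : mso A k n m
| MNot n m (f : mso A k n m) : mso A k n m
| MAnd n m (f g : mso A k n m) : mso A k n m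
| MExNode n m (f : mso A k n.+1 m) : mso A k n m
| MExSet n m (f : mso A k n m.+1) : mso A k n m.

Fixpoint mso_holds (A : eqType) (k : nat) (t : tree A)
    (P : 'I_k -> {set node t}) (n m : nat) (f : mso A k n m) :
    n.-tuple (node t) -> m.-tuple {set node t} -> bool :=
  match f in mso _ _ n m
    return n.-tuple (node t) -> m.-tuple {set node t} -> bool with
  | MLabel _ _ a x => fun v V => label t (tnth v x) == a
  | MPred _ _ i x => fun v V => tnth v x \in P i
  | MChild _ _ x y => fun v V => child (tnth v x) (tnth v y)
  | MNext _ _ x y => fun v V => next_sibling (tnth v x) (tnth v y)
  | MEq _ _ x y => fun v V => tnth v x == tnth v y
  | MIn _ _ x X => fun v V => tnth v x \in tnth V X
  | MNot _ _ f => fun v V => ~~ mso_holds P f v V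
  | MAnd _ _ f g => fun v V => mso_holds P f v V && mso_holds P g v V
  | MExNode _ _ f => fun v V => [exists x, mso_holds P f [tuple of x :: v] V]
  | MExSet _ _ f => fun v V => [exists X, mso_holds P f v [tuple of X :: V]]
  end.

(* [xpath A n] is the type of [n]-ary queries.  In [XMso], the family [G] is the
   finite set of previously defined unary queries used by the formula [f]. *)
Inductive xpath (A : Type) : nat -> Type :=
| XMso k (G : 'I_k -> xpath A 1) n (f : mso A k n 0) : xpath A n
| XSame (f : xpath A 3) : xpath A 1
| XDiff (f : xpath A 3) : xpath A 1.

Definition query_set (A : Type) (q : query A 1) (d : data_tree A) :
    {set node d} :=
  [set x | [tuple x] \in q d].

Fixpoint xpath_query (A : eqType) (n : nat) (f : xpath A n) : query A n :=
  match f in xpath _ n return query A n with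
  | XMso _ G _ f => fun d =>
      [set v | mso_holds (fun i => query_set (xpath_query (G i)) d)
                         f v [tuple]]
  | XSame f => fun d =>
      [set v | [exists y1, [exists y2,
         sim d y1 y2 && ([tuple tnth v ord0; y1; y2] \in xpath_query f d)]]]
  | XDiff f => fun d =>
      [set v | [exists y1, [exists y2,
         ~~ sim d y1 y2 && ([tuple tnth v ord0; y1; y2] \in xpath_query f d)]]]
  end.

Definition query_language (A : Type) (q : query A 1) (d' : data_tree (A * bool)) :
    Prop :=
  exists d : data_tree A, d' = data_tensor_set (query_set q d).

(* Main.v *)
(* By induction on the query, its value is computed from auxiliary labels that a
   class automaton guesses and checks.  MSO steps keep regularity, so the point
   is a step [exists y1 y2, y1 ~ y2 /\ phi x y1 y2] (or with [y1 !~ y2]), with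
   [phi] regular.

   In the first-child next-sibling encoding, [phi x y1 y2] holds iff the median
   [m] of the three nodes satisfies [chi m x /\ alpha m y1 /\ beta m y2] for one
   of finitely many decompositions of [phi].  A negative answer at [x] is checked
   by the class condition, on the class of each [y1].  For a positive one, every
   [m] that has a witnessing pair [(y1, y2)] is given a pointer to one component
   of such a pair, and the class condition, on the class of the target, checks
   that the other component exists.  Pointers fit in finitely many labels as soon
   as boundedly many targets have a pointer crossing any given node: the targets
   are then coloured, and each node stores, for each colour, the direction to the
   target.

   It remains to choose such pointers.  If [y1] and [y2] lie below [m] on
   different sides, every pair goes greedily to the less crowded side.  The hard
   case is [y1] below [m] and [y2] not below [m].  Seen from [m], the node [y1]
   matters through its row, and rows merge upwards; [y2] matters through its
   column, and columns merge downwards.  Nodes [m] are handled top-down and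
   share the [y1] of a node above them when they can.  A node that can neither
   share nor start a pointer, because too many pass through it, has a starter
   above it and above its [y2]: otherwise the rank of its column, a number
   bounded by the number of columns, would drop at each of them.  Such starters
   bound the number of witnessing pairs needed, and these pairs are again
   distributed to the less crowded sides. *)
From Corelib Require Import Setoid.
From mathcomp Require Import all_boot.
Require Import Defs.

Set Implicit Arguments.
Unset Strict Implicit.
Unset Printing Implicit Defensive.

(** * Binary trees and their automata *)

(** A class condition sees one class at a time and must hold on all of them. It can refute pairs,
    but to assert that a pair exists it has to be told in which class to look; this is what a
    pointer does. Passing through the median removes [x]: [chi] says which [m] serves [x], and what
    [m] asks of the pair no longer mentions [x].

    The relation between [y1] and [y2] is arbitrary throughout the construction of pointers, so
    equivalence and its negation are treated alike. The bound on crossings therefore rests only on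
    two finite sets of types. The row of [y1] at [m] is its direction together with the states of
    both child subtrees of [m] when [y1] is marked. The column of [y2] at [m] is the map from the
    state at [m] to the state at the root when [y2] is marked. Ancestors of [m] read [y1] only
    through its row at [m], and descendants of [m] read [y2] only through its column there. The two
    components of a pair thus persist in opposite directions, which is the obstacle in the vertical
    case. *)

Inductive btree (X : Type) := Leaf | Node of X & btree X & btree X.
Arguments Leaf {X}.

Section BinaryTrees.
Variable X : eqType.
Implicit Types (b l r : btree X) (x y z : X).

Fixpoint bnodes b : seq X :=
  if b is Node x l r then x :: bnodes l ++ bnodes r else [::].

Fixpoint subtree b x : btree X :=
  if b is Node z l r then
    if z == x then b else if x \in bnodes l then subtree l x else subtree r x
  else Leaf.

Definition lchild b : btree X := if b is Node _ l _ then l else Leaf.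
Definition rchild b : btree X := if b is Node _ _ r then r else Leaf.

Fixpoint leftof b x y : bool :=
  if b is Node z l r then
    [|| (x == z) && (y \in bnodes l), leftof l x y | leftof r x y]
  else false.

Fixpoint rightof b x y : bool :=
  if b is Node z l r then
    [|| (x == z) && (y \in bnodes r), rightof l x y | rightof r x y]
  else false.

Lemma mem_bnodes z l r x :
  (x \in bnodes (Node z l r)) = [|| x == z, x \in bnodes l | x \in bnodes r].
Proof. by rewrite inE mem_cat. Qed.

Lemma uniq_bnodes z l r :
  uniq (bnodes (Node z l r)) =
  [&& z \notin bnodes l, z \notin bnodes r, uniq (bnodes l), uniq (bnodes r)
    & ~~ has (mem (bnodes l)) (bnodes r)].
Proof.
rewrite /= mem_cat negb_or cat_uniq -!andbA.
by congr (_ && (_ && _)); congr (_ && _); rewrite andbC.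
Qed.

Lemma disjoint_children z l r x :
  uniq (bnodes (Node z l r)) -> x \in bnodes l -> (x \in bnodes r) = false.
Proof.
rewrite uniq_bnodes => /and5P[_ _ _ _ /hasPn h] xl.
by apply/negP => /h /=; rewrite xl.
Qed.

Lemma leftof_mem b x y : leftof b x y -> x \in bnodes b /\ y \in bnodes b.
Proof.
elim: b => //= z l IHl r IHr; rewrite !inE !mem_cat.
by case/or3P => [/andP[-> ->] | /IHl[-> ->] | /IHr[-> ->]]; rewrite ?orbT.
Qed.

Lemma rightof_mem b x y : rightof b x y -> x \in bnodes b /\ y \in bnodes b.
Proof.
elim: b => //= z l IHl r IHr; rewrite !inE !mem_cat.
by case/or3P => [/andP[-> ->] | /IHl[-> ->] | /IHr[-> ->]]; rewrite ?orbT.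
Qed.

Lemma subtree_mem b x : x \in bnodes b ->
  subtree b x = Node x (lchild (subtree b x)) (rchild (subtree b x)).
Proof.
elim: b => //= z l IHl r IHr; rewrite inE mem_cat eq_sym.
case: eqP => [-> // | _] /=.
by case: ifP => [xl _ | _ /= xr]; [apply: IHl | apply: IHr].
Qed.

Lemma subtree_sub b x y : y \in bnodes (subtree b x) -> y \in bnodes b.
Proof.
elim: b => //= z l IHl r IHr; case: eqP => // _.
by rewrite inE mem_cat; case: ifP => _ => [/IHl | /IHr] ->; rewrite ?orbT.
Qed.

Lemma leftofE b x y : uniq (bnodes b) ->
  leftof b x y = (y \in bnodes (lchild (subtree b x))).
Proof.
elim: b => // z l IHl r IHr ub; have := ub; rewrite uniq_bnodes.
case/and5P => zl zr ul ur lr /=; rewrite [z == x]eq_sym.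
have mem0 b' : x \notin bnodes b' -> leftof b' x y = false.
  by move=> nx; apply/negP => /leftof_mem[]; rewrite (negbTE nx).
case: eqP => [xz | xz] /=; first by rewrite !mem0 ?xz // !orbF.
case: ifP => xl; last by rewrite mem0 ?xl //= IHr.
by rewrite [leftof r x y]mem0 ?orbF ?IHl // (disjoint_children ub xl).
Qed.

Lemma rightofE b x y : uniq (bnodes b) ->
  rightof b x y = (y \in bnodes (rchild (subtree b x))).
Proof.
elim: b => // z l IHl r IHr ub; have := ub; rewrite uniq_bnodes.
case/and5P => zl zr ul ur lr /=; rewrite [z == x]eq_sym.
have mem0 b' : x \notin bnodes b' -> rightof b' x y = false.
  by move=> nx; apply/negP => /rightof_mem[]; rewrite (negbTE nx).
case: eqP => [xz | xz] /=; first by rewrite !mem0 ?xz // !orbF.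
case: ifP => xl; last by rewrite mem0 ?xl //= IHr.
by rewrite [rightof r x y]mem0 ?orbF ?IHl // (disjoint_children ub xl).
Qed.

Lemma subtree_uniq b x : uniq (bnodes b) -> uniq (bnodes (subtree b x)).
Proof.
elim: b => // z l IHl r IHr ub; have := ub; rewrite uniq_bnodes.
case/and5P => _ _ ul ur _ /=; case: eqP => // _.
by case: ifP => _; [apply: IHl | apply: IHr].
Qed.

Lemma subtree_trans b x y : uniq (bnodes b) -> y \in bnodes (subtree b x) ->
  subtree b y = subtree (subtree b x) y.
Proof.
elim: b => // z l IHl r IHr ub; have := ub; rewrite uniq_bnodes.
case/and5P => zl zr ul ur lr /=.
have [-> | zx] := eqVneq z x; first by [].
case: (ifP (x \in bnodes l)) => xl hy.
  have yl := subtree_sub hy.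
  have -> : (z == y) = false by apply/eqP => zy; rewrite zy yl in zl.
  by rewrite yl; apply: IHl.
have yr := subtree_sub hy.
have -> : (z == y) = false by apply/eqP => zy; rewrite zy yr in zr.
case: ifP => yl; last exact: IHr.
by rewrite (disjoint_children ub yl) in yr.
Qed.

End BinaryTrees.

(** Deterministic and bottom-up, so that boolean combinations are products; nondeterminism enters
    only through [subset_automaton]. *)
Record automaton (A : Type) := Automaton {
  state : finType;
  leaf_state : state;
  step : A -> state -> state -> state;
  final : pred state
}.

Section Runs.
Variables (A : Type) (M : automaton A) (X : eqType).
Implicit Types (f g : X -> A) (b l r : btree X).

Fixpoint run f b : state M :=
  if b is Node x l r then step (f x) (run f l) (run f r) else leaf_state M.

Definition accepts f b : bool := final (run f b).

Lemma eq_run f g b : {in bnodes b, f =1 g} -> run f b = run g b.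
Proof.
elim: b => //= z l IHl r IHr fg.
rewrite fg ?inE ?eqxx // IHl ?IHr // => x xb;
  by apply: fg; rewrite inE mem_cat xb ?orbT.
Qed.

Lemma eq_accepts f g b : f =1 g -> accepts f b = accepts g b.
Proof. by move=> fg; rewrite /accepts (eq_run (in1W fg)). Qed.

End Runs.

Definition relabel (A B : Type) (h : B -> A) (M : automaton A) : automaton B :=
  Automaton (leaf_state M) (fun a => @step _ M (h a)) (@final _ M).

Lemma run_relabel (A B : Type) (h : B -> A) (M : automaton A) (X : eqType)
    (f : X -> B) b :
  run (relabel h M) f b = run M (h \o f) b.
Proof. by elim: b => //= x l -> r ->. Qed.

Lemma accepts_relabel (A B : Type) (h : B -> A) (M : automaton A) (X : eqType)
    (f : X -> B) b :
  accepts (relabel h M) f b = accepts M (h \o f) b.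
Proof. by rewrite /accepts run_relabel. Qed.

Definition product (A : Type) (op : bool -> bool -> bool) (M N : automaton A) :=
  @Automaton A (state M * state N)%type (leaf_state M, leaf_state N)
    (fun a p q => (step a p.1 q.1, step a p.2 q.2))
    (fun p => op (final p.1) (final p.2)).

Lemma accepts_product (A : Type) op (M N : automaton A) (X : eqType)
    (f : X -> A) b :
  accepts (product op M N) f b = op (accepts M f b) (accepts N f b).
Proof.
rewrite /accepts; suff -> : run (product op M N) f b = (run M f b, run N f b) by [].
by elim: b => //= x l -> r ->.
Qed.

Definition subset_automaton (A : Type) (B : finType) (M : automaton (A * B)) :=
  @Automaton A {set state M} [set leaf_state M]
    (fun a P Q => [set q | [exists c, [exists p in P, [exists p' in Q,
       q == step (a, c) p p']]]])
    (fun P => [exists q in P, final q]).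

Lemma run_subset (A : Type) (B : finType) (c0 : B) (M : automaton (A * B))
    (X : eqType) (f : X -> A) b q : uniq (bnodes b) ->
  reflect (exists h : X -> B, run M (fun x => (f x, h x)) b = q)
          (q \in run (subset_automaton M) f b).
Proof.
elim: b q => [|z l IHl r IHr] q ub; apply: (iffP idP).
- by rewrite inE => /eqP ->; exists (fun=> c0).
- by case=> h /= <-; rewrite inE.
- move: (ub); rewrite uniq_bnodes => /and5P[zl zr ul ur lr].
  rewrite inE => /existsP[c /exists_inP[p pl /exists_inP[p' pr /eqP ->]]].
  have [h1 <-] := IHl p ul pl; have [h2 <-] := IHr p' ur pr.
  (* The labellings of the two children can be glued because the nodes of [Node z l r] are
     distinct. *)
  exists (fun x => if x == z then c else if x \in bnodes l then h1 x else h2 x).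
  rewrite /= eqxx; congr (step _ _ _); apply: eq_run => x xb.
    have -> : (x == z) = false by apply/eqP => xz; rewrite -xz xb in zl.
    by rewrite xb.
  have -> : (x == z) = false by apply/eqP => xz; rewrite -xz xb in zr.
  by case: ifP => // xl; rewrite (disjoint_children ub xl) in xb.
- move: (ub); rewrite uniq_bnodes => /and5P[zl zr ul ur lr].
  case=> h <- /=; rewrite inE.
  apply/existsP; exists (h z); apply/exists_inP.
  exists (run M (fun x => (f x, h x)) l); first by apply/IHl => //; exists h.
  apply/exists_inP; exists (run M (fun x => (f x, h x)) r) => //.
  by apply/IHr => //; exists h.
Qed.

Lemma accepts_subset (A : Type) (B : finType) (c0 : B) (M : automaton (A * B))
    (X : eqType) (f : X -> A) b : uniq (bnodes b) ->
  reflect (exists h : X -> B, accepts M (fun x => (f x, h x)) b)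
          (accepts (subset_automaton M) f b).
Proof.
move=> ub; apply: (iffP idP) => [/exists_inP[q /(run_subset c0 _ _ ub)[h <-]] fq | [h]].
  by exists h.
move=> ah; apply/exists_inP; exists (run M (fun x => (f x, h x)) b) => //.
by apply/(run_subset c0 _ _ ub); exists h.
Qed.

(* The state counts the marked nodes; [None] stands for two or more. *)
Definition singleton_automaton :=
  @Automaton bool (option bool) (Some false)
    (fun c p q => match c, p, q with
      | true, Some false, Some false => Some true
      | false, Some i, Some j => if i && j then None else Some (i || j)
      | _, _, _ => None end)
    (fun p => p == Some true).

Lemma run_singleton (X : eqType) (h : X -> bool) b : uniq (bnodes b) ->
  run singleton_automaton h b =
  match count h (bnodes b) with 0 => Some false | 1 => Some true | _ => None end.
Proof.
elim: b => // z l IHl r IHr; rewrite uniq_bnodes => /and5P[_ _ ul ur _] /=.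
rewrite IHl // IHr // count_cat.
by case: (h z); case: (count h (bnodes l)) => [|[|i]];
   case: (count h (bnodes r)) => [|[|j]]; rewrite ?addnS ?add0n ?addn0.
Qed.

Lemma accepts_singleton (X : eqType) (h : X -> bool) b : uniq (bnodes b) ->
  reflect (exists2 x, x \in bnodes b & {in bnodes b, forall y, h y = (x == y)})
          (accepts singleton_automaton h b).
Proof.
move=> ub; rewrite /accepts run_singleton //=.
apply: (iffP idP) => [|[x xb hx]]; last first.
  have -> : count h (bnodes b) = count_mem x (bnodes b).
    by apply: eq_in_count => y /hx; rewrite eq_sym.
  by rewrite count_uniq_mem ?xb.
case E: (count h _) => [|[|]] // _.
have : has h (bnodes b) by rewrite has_count E.
case/hasP => x xb hx; exists x => // y yb.
apply/idP/eqP => [hy | <- //]; apply/eqP/negPn/negP => xy.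
have : size [:: x; y] <= count h (bnodes b).
  rewrite -size_filter; apply: uniq_leq_size; first by rewrite /= inE xy.
  by move=> t; rewrite !inE mem_filter => /orP[]/eqP ->; apply/andP.
by rewrite E.
Qed.

(** * The first-child next-sibling encoding *)

Section ShapeInduction.
Variables (P : shape -> Prop) (Q : seq shape -> Prop).
Hypothesis PShape : forall ts, Q ts -> P (Shape ts).
Hypothesis Qnil : Q [::].
Hypothesis Qcons : forall t ts, P t -> Q ts -> Q (t :: ts).

Fixpoint shape_forest_ind (T : shape) : P T :=
  let: Shape ts := T in
  PShape ((fix forest ts : Q ts :=
    if ts is t :: ts' then Qcons (shape_forest_ind t) (forest ts') else Qnil) ts).

End ShapeInduction.

Definition subtrees (T : shape) := let: Shape ts := T in ts.

Fixpoint forest_nodes i (ts : seq shape) : seq (seq nat) :=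
  if ts is t :: ts' then [seq i :: p | p <- nodes t] ++ forest_nodes i.+1 ts'
  else [::].

Lemma nodesE T : nodes T = [::] :: forest_nodes 0 (subtrees T).
Proof.
case: T => ts /=; congr (_ :: _).
by elim: ts 0 => //= t ts IH i; rewrite IH.
Qed.

Fixpoint subshape (T : shape) (p : seq nat) : shape :=
  if p is i :: p' then subshape (nth (Shape [::]) (subtrees T) i) p' else T.

Lemma mem_forest_nodes i ts q :
  (q \in forest_nodes i ts) =
  if q is j :: q' then
    [&& i <= j, j < i + size ts & q' \in nodes (nth (Shape [::]) ts (j - i))]
  else false.
Proof.
elim: ts i q => [|t ts IH] i q /=.
  case: q => // j q; rewrite addn0 in_nil.
  by case: ltngtP.
rewrite mem_cat IH; case: q => [|j q].
  by rewrite orbF; apply/mapP => -[].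
have -> : (j :: q \in [seq i :: p | p <- nodes t]) = (i == j) && (q \in nodes t).
  apply/mapP/andP => [[p pt [-> ->]] | [/eqP <- qt]]; first by rewrite eqxx.
  by exists q.
rewrite addnS addSn; case: (ltngtP i j) => [ij | ij | <-] /=.
- by rewrite subnS -addSn; move: ij; rewrite -subn_gt0; case: (j - i).
- by [].
- by rewrite ltnS leq_addr subnn /= orbF.
Qed.

Lemma mem_nodes T q :
  (q \in nodes T) =
  if q is j :: q' then
    (j < size (subtrees T)) && (q' \in nodes (subshape T [:: j]))
  else true.
Proof.
rewrite nodesE inE mem_forest_nodes; case: q => // j q /=.
by rewrite add0n subn0.
Qed.

Lemma mem_nodes_cons T j q :
  (j :: q \in nodes T) =
  (j < size (subtrees T)) && (q \in nodes (subshape T [:: j])).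
Proof. exact: mem_nodes. Qed.

Lemma uniq_nodes T : uniq (nodes T).
Proof.
move: T; apply: (@shape_forest_ind (fun T => uniq (nodes T))
  (fun ts => forall i, uniq (forest_nodes i ts))) => //.
  by move=> ts uts; rewrite nodesE /= uts mem_forest_nodes.
move=> t ts ut uts i /=; rewrite cat_uniq map_inj_uniq ?ut ?uts; last by move=> ? ? [].
rewrite andbT; apply/hasPn => q; rewrite mem_forest_nodes.
case: q => // j q /and3P[ij _ _]; apply/mapP => -[p _ [ji _]].
by rewrite ji ltnn in ij.
Qed.

Lemma mem_nodes_cat T p q :
  (p ++ q \in nodes T) = (p \in nodes T) && (q \in nodes (subshape T p)).
Proof.
elim: p T => [|i p IH] T /=; first by rewrite [[::] \in _]mem_nodes.
by rewrite mem_nodes [i :: p \in _]mem_nodes IH andbA.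
Qed.

Section Encoding.
Variable X : eqType.

(* First-child next-sibling encoding; [h] names the nodes and [r] encodes the
   right siblings of the root. *)
Fixpoint encode (T : shape) (h : seq nat -> X) (r : btree X) : btree X :=
  let: Shape ts := T in
  Node (h [::])
    ((fix encode_forest i ts :=
        if ts is t :: ts' then
          encode t (fun q => h (i :: q)) (encode_forest i.+1 ts')
        else Leaf) 0 ts) r.

(** The inner recursion of [encode] under a name of its own; [encodeE] identifies the two. *)
Fixpoint encode_forest (h : seq nat -> X) i (ts : seq shape) : btree X :=
  if ts is t :: ts' then
    encode t (fun q => h (i :: q)) (encode_forest h i.+1 ts')
  else Leaf.

Lemma encodeE T h r :
  encode T h r = Node (h [::]) (encode_forest h 0 (subtrees T)) r.
Proof.
by case: T => ts /=; congr (Node _ _ _); elim: ts 0 => //= t ts IH i; rewrite IH.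
Qed.

Lemma bnodes_encode T h r : bnodes (encode T h r) = map h (nodes T) ++ bnodes r.
Proof.
move: T h r; apply: (@shape_forest_ind
  (fun T => forall h r, bnodes (encode T h r) = map h (nodes T) ++ bnodes r)
  (fun ts => forall h i,
     bnodes (encode_forest h i ts) = map h (forest_nodes i ts))) => //.
  by move=> ts IH h r; rewrite encodeE nodesE /= IH.
by move=> t ts IHt IHts h i /=; rewrite IHt IHts map_cat -map_comp.
Qed.

Lemma bnodes_encode_forest h i ts :
  bnodes (encode_forest h i ts) = map h (forest_nodes i ts).
Proof.
elim: ts i => //= t ts IH i.
by rewrite bnodes_encode IH map_cat -map_comp.
Qed.

Lemma subtree_encode_forest h i ts j : j < size ts ->
  uniq (bnodes (encode_forest h i ts)) ->
  subtree (encode_forest h i ts) (h [:: i + j]) =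
  encode (nth (Shape [::]) ts j) (fun q => h (i + j :: q))
         (encode_forest h (i + j).+1 (drop j.+1 ts)).
Proof.
elim: ts i j => // t ts IH i [|j] jts ub.
  by rewrite addn0 /= drop0 encodeE /= eqxx.
move: (ub); rewrite /= encodeE uniq_bnodes => /and5P[hl hr ul ur lr].
have := IH i.+1 j jts ur; rewrite addSnnS => <- /=.
have inr : h [:: i + j.+1] \in bnodes (encode_forest h i.+1 ts).
  rewrite bnodes_encode_forest map_f // mem_forest_nodes addSn addnS !ltnS.
  by rewrite leq_addr ltn_add2l (jts : j < size ts) mem_nodes.
case: eqP => [e | _]; first by rewrite e inr in hr.
by case: ifP => // inl; have := hasPn lr _ inr; rewrite /= inl.
Qed.

(** This is the right subtree at the node [p] of [encode T h r]: the encoded later siblings of [p],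
    or [r] at the root. *)
Fixpoint right_context (h : seq nat -> X) (T : shape) (p : seq nat) r : btree X :=
  if p is i :: p' then
    right_context (fun q => h (i :: q)) (subshape T [:: i]) p'
      (encode_forest h i.+1 (drop i.+1 (subtrees T)))
  else r.

Lemma right_context_rcons h T p i r :
  right_context h T (rcons p i) r =
  encode_forest (fun q => h (p ++ q)) i.+1 (drop i.+1 (subtrees (subshape T p))).
Proof. by elim: p h T r => [|j p IH] h T r //=; rewrite IH. Qed.

Lemma subtree_encode T h r p : uniq (bnodes (encode T h r)) -> p \in nodes T ->
  subtree (encode T h r) (h p) =
  encode (subshape T p) (fun q => h (p ++ q)) (right_context h T p r).
Proof.
elim: p T h r => [|i p IH] T h r ub; first by rewrite encodeE /= eqxx.
rewrite mem_nodes => /andP[iT pT].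
move: (ub); rewrite {1}encodeE uniq_bnodes => /and5P[hl hr ul ur lr].
have := subtree_encode_forest iT ul; rewrite add0n => sub_i.
have il : h [:: i] \in bnodes (encode_forest h 0 (subtrees T)).
  by rewrite bnodes_encode_forest map_f // mem_forest_nodes add0n iT mem_nodes.
have sub_i' : subtree (encode T h r) (h [:: i]) =
    subtree (encode_forest h 0 (subtrees T)) (h [:: i]).
  rewrite encodeE /= il.
  by case: eqP => // e; rewrite e il in hl.
have in_i : h (i :: p) \in bnodes (subtree (encode T h r) (h [:: i])).
  by rewrite sub_i' sub_i bnodes_encode mem_cat (map_f (fun q => h (i :: q)) pT).
rewrite (subtree_trans ub in_i).
have us := subtree_uniq (h [:: i]) ub.
rewrite sub_i' sub_i in us *.
by rewrite (IH _ (fun q => h (i :: q))).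
Qed.

End Encoding.

Section NodeEncoding.
Variable T : shape.

Definition node_at (p : seq nat) : node T := insubd (root T) p.

Definition enc : btree (node T) := encode T node_at Leaf.

Lemma val_node_at p : p \in nodes T -> ssval (node_at p) = p.
Proof. by move=> pT; have := val_insubd (root T) p; rewrite pT. Qed.

Lemma node_atK (x : node T) : node_at (ssval x) = x.
Proof. exact: valKd. Qed.

Lemma enc_uniq : uniq (bnodes enc).
Proof.
rewrite bnodes_encode cats0 map_inj_in_uniq ?uniq_nodes // => p q pT qT e.
by rewrite -(val_node_at pT) e val_node_at.
Qed.

Lemma mem_enc (x : node T) : x \in bnodes enc.
Proof.
rewrite bnodes_encode cats0; apply/mapP; exists (ssval x); first exact: (ssvalP x).
by rewrite node_atK.
Qed.

Lemma subtree_enc (x : node T) : subtree enc x =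
  encode (subshape T (ssval x)) (fun q => node_at (ssval x ++ q))
         (right_context node_at T (ssval x) Leaf).
Proof. by rewrite -{1}(node_atK x) subtree_encode ?enc_uniq //; apply: (ssvalP x). Qed.

(** The left subtree at [x] encodes the forest of its children, hence holds exactly its proper
    descendants. *)
Lemma leftof_enc (x y : node T) :
  leftof enc x y = prefix (ssval x) (ssval y) && (size (ssval x) < size (ssval y)).
Proof.
have xT : ssval x \in nodes T := ssvalP x; have yT : ssval y \in nodes T := ssvalP y.
rewrite leftofE ?enc_uniq // subtree_enc encodeE /= bnodes_encode_forest.
apply/mapP/andP => [[q] | [/prefixP[q e] sxy]].
  rewrite mem_forest_nodes; case: q => // j q; rewrite add0n subn0 leq0n /= => jq ->.
  rewrite val_node_at; first by rewrite prefix_prefix size_cat -[X in X < _]addn0 ltn_add2l.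
  by rewrite mem_nodes_cat xT mem_nodes.
exists q; last by rewrite -e node_atK.
move: yT sxy; rewrite e size_cat mem_nodes_cat => /andP[_].
rewrite -[X in X < _]addn0 ltn_add2l mem_nodes mem_forest_nodes add0n.
by case: q {e} => // j q /=; rewrite subn0.
Qed.

(** The right subtree at [x] encodes its later siblings with all their descendants; [j] is the
    position of the sibling that is [y] or has [y] below it. *)
Lemma rightof_enc (x y : node T) :
  reflect (exists p i j s,
             [/\ ssval x = rcons p i, ssval y = p ++ j :: s & i < j])
          (rightof enc x y).
Proof.
have xT : ssval x \in nodes T := ssvalP x; have yT : ssval y \in nodes T := ssvalP y.
rewrite rightofE ?enc_uniq // subtree_enc encodeE /=.
apply: (iffP idP).
  case/lastP E: (ssval x) => [|p i] //; rewrite right_context_rcons.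
  rewrite bnodes_encode_forest => /mapP[[|j s]]; rewrite mem_forest_nodes //.
  case/and3P => ij jT sT ->; exists p, i, j, s; split => //.
  rewrite val_node_at // mem_nodes_cat; move: xT; rewrite E -cats1 mem_nodes_cat.
  case/andP => -> /=; rewrite !mem_nodes_cons; case/andP => iT _.
  move: jT sT; rewrite size_drop subnKC //.
   rewrite nth_drop subnKC // => jT sT; rewrite jT; apply: sT.
case=> p [i [j [s [ex ey ij]]]]; rewrite ex right_context_rcons.
rewrite bnodes_encode_forest; apply/mapP; exists (j :: s).
  move: yT xT; rewrite ex ey -cats1 !mem_nodes_cat !mem_nodes_cons.
  case/andP => pT /andP[jT sT] /and3P[_ iT _].
  by rewrite mem_forest_nodes ij size_drop subnKC // jT nth_drop subnKC.
by rewrite -ey node_atK.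
Qed.

Lemma child_ssval (x y : node T) :
  child x y = (ssval y == rcons (ssval x) (sibling_index y)).
Proof. by []. Qed.

Lemma sibling_index_ssval (x : node T) : sibling_index x = last 0 (ssval x).
Proof. by []. Qed.

Lemma prefix_node p q : p ++ q \in nodes T -> p \in nodes T.
Proof. by rewrite mem_nodes_cat => /andP[]. Qed.

Lemma sibling_node p i j : i <= j -> rcons p j \in nodes T -> rcons p i \in nodes T.
Proof.
move=> ij; rewrite -!cats1 !mem_nodes_cat => /andP[-> /=].
rewrite !mem_nodes_cons => /andP[jT _]; rewrite (leq_ltn_trans ij jT) /=.
by rewrite mem_nodes.
Qed.

(** A child is a proper descendant with none in between. This form reduces the MSO atom to [leftof],
    which an automaton checks directly. *)
Lemma childE (x y : node T) :
  child x y = leftof enc x y && ~~ [exists z, leftof enc x z && leftof enc z y].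
Proof.
have yT : ssval y \in nodes T := ssvalP y.
rewrite child_ssval; apply/eqP/andP => [e | []].
  split; first by rewrite leftof_enc e prefix_rcons size_rcons leqnn.
  apply/existsP => -[z]; rewrite !leftof_enc => /andP[/andP[_ s1] /andP[_ s2]].
  by move: (leq_ltn_trans s1 s2); rewrite e size_rcons ltnn.
rewrite leftof_enc => /andP[/prefixP[q e] sxy] /existsPn nz.
case: q e sxy => [|j q] e; first by rewrite e cats0 ltnn.
rewrite sibling_index_ssval; case: q e => [|k q] e _.
  by rewrite e cats1 last_rcons.
have zT : ssval x ++ [:: j] \in nodes T.
  by move: yT; rewrite e -cat1s catA => /prefix_node.
have /negP[] := nz (node_at (ssval x ++ [:: j])).
rewrite !leftof_enc val_node_at // e !size_cat.
have pre (a b : seq nat) : prefix a (a ++ b) by exact: prefix_prefix.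
by rewrite pre -[[:: j, k & q]]cat1s catA pre ltn_add2l /= addn1 ltnSn.
Qed.

(** Excluding a [z] with [y] to its left makes [y] a sibling of [x]; excluding one with [y] to its
    right makes that sibling adjacent. *)
Lemma next_siblingE (x y : node T) :
  next_sibling x y =
  rightof enc x y &&
  ~~ [exists z, rightof enc x z && (leftof enc z y || rightof enc z y)].
Proof.
have xT : ssval x \in nodes T := ssvalP x; have yT : ssval y \in nodes T := ssvalP y.
apply/andP/andP => -[].
  case/existsP => z; rewrite !child_ssval => /andP[/eqP ex /eqP ey] /eqP eq_i; rewrite eq_i in ey; split.
    by apply/rightof_enc; exists (ssval z), (sibling_index x), (sibling_index x).+1, [::];
      rewrite cats1 ltnS.
  apply/existsP => -[w /andP[/rightof_enc[p [i [j [s [exr ew ij]]]]]]].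
  have [ep ei] := rcons_inj (etrans (esym exr) ex).
  rewrite {}ep {}ei in ew ij.
  case/orP.
    by rewrite leftof_enc ew ey => /andP[_]; rewrite size_cat size_rcons /= addnS ltnS -addSn ltnNge leq_addr.
  case/rightof_enc => p' [i' [j' [s' [ew' ey' ij']]]].
  have ss : size (rcons p' i') <= size (ssval z) + 1.
    by rewrite addn1 -(size_rcons (ssval z) (sibling_index x).+1) -ey ey' size_cat size_rcons /= addnS ltnS leq_addr.
  have s0 : s = [::].
    apply/nilP; rewrite -ew' ew size_cat /= addnS -addn1 leq_add2r in ss.
    by rewrite /nilp -(eqn_add2l (size (ssval z))) addn0 eqn_leq ss leq_addr.
  rewrite s0 cats1 in ew.
  have [ep ei] := rcons_inj (etrans (esym ew') ew).
  move: ey'; rewrite ey ep -cats1 => /eqP.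
  rewrite eqseq_cat // eqxx /= eqseq_cons => /andP[/eqP ej _].
  by move: ij'; rewrite ei -ej ltnS leqNgt ij.
case/rightof_enc => p [i [j [s [ex ey ij]]]] /existsPn nz.
have pT : p \in nodes T by move: xT; rewrite ex -cats1 => /prefix_node.
have jT : rcons p j \in nodes T.
  by move: yT; rewrite ey -cat1s catA cats1 => /prefix_node.
have s0 : s = [::].
  case: s ey => // k s ey.
  have /negP[] := nz (node_at (rcons p j)).
  apply/andP; split.
    by apply/rightof_enc; exists p, i, j, [::]; rewrite val_node_at // cats1.
  rewrite leftof_enc val_node_at // ey -cat1s catA cats1 prefix_prefix.
  by rewrite size_cat /= addnS ltnS leq_addr.
rewrite s0 cats1 in ey.
have ji : j = i.+1.
  apply/eqP; rewrite eqn_leq ij andbT leqNgt; apply/negP => ij2.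
  have iT := sibling_node (ltnW ij2) jT.
  have /negP[] := nz (node_at (rcons p i.+1)).
  apply/andP; split.
    by apply/rightof_enc; exists p, i, i.+1, [::]; rewrite val_node_at // cats1.
  apply/orP; right; apply/rightof_enc; exists p, i.+1, j, [::].
  by rewrite val_node_at // cats1.
rewrite !sibling_index_ssval ex ey !last_rcons ji eqxx; split => //.
apply/existsP; exists (node_at p).
by rewrite !child_ssval !sibling_index_ssval ex ey !last_rcons val_node_at // !eqxx.
Qed.

End NodeEncoding.

(** * Counting and greedy induction *)

Lemma card_bigcup_leq (I T : finType) (F : I -> {set T}) (P : pred I) k :
  (forall i, P i -> #|F i| <= k) -> #|\bigcup_(i | P i) F i| <= #|P| * k.
Proof.
move=> Fk; rewrite -sum_nat_const.
elim/big_rec2: _ => [|i A n Pi An]; first by rewrite cards0.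
apply: leq_trans (leq_card_setU _ _) _; apply: leq_add => //; exact: Fk.
Qed.

(** Serves to count witnesses by the pairs of a starter and a column that determine them. *)
Lemma card_imset_factor (X T T' : finType) (A : {set X}) (B : {set T'})
    (f : X -> T) (h : X -> T') :
  {in A, forall m, h m \in B} -> {in A &, forall m m', h m = h m' -> f m = f m'} ->
  #|f @: A| <= #|B|.
Proof.
move=> hB hf; have [-> | [m0 _]] := set_0Vmem A; first by rewrite imset0 cards0.
apply: leq_trans (_ : #|h @: A| <= _); last first.
  by apply/subset_leq_card/subsetP => _ /imsetP[m mA ->]; apply: hB.
pose g t := f (odflt m0 [pick m in A | h m == t]).
apply: leq_trans (leq_imset_card g (h @: A)).
apply/subset_leq_card/subsetP => _ /imsetP[m mA ->]; apply/imsetP.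
exists (h m); first exact: imset_f.
rewrite /g; case: pickP => [m' /andP[m'A /eqP e] | /(_ m)]; last by rewrite mA eqxx.
exact: hf.
Qed.

(** The greedy constructions treat elements by nondecreasing [key], with ties in any order; [D]
    holds those already treated. *)
Lemma key_ind (Y : finType) (key : Y -> nat) (P : {set Y} -> Prop) :
  P set0 ->
  (forall (D : {set Y}) y, y \notin D ->
     (forall y', key y' < key y -> y' \in D) ->
     (forall y', y' \in D -> key y' <= key y) -> P D -> P (y |: D)) ->
  P setT.
Proof.
move=> P0 PS.
have IH n (D : {set Y}) : #|~: D| = n ->
    {in D & ~: D, forall y y', key y <= key y'} -> P D -> P setT.
  elim: n D => [|n IH] D cD kD PD.
    by move/cards0_eq: cD => /(congr1 (@setC _)); rewrite setCK setC0 => <-.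
  have /card_gt0P[y0 y0D] : 0 < #|~: D| by rewrite cD.
  case: (arg_minnP key y0D) => y yD ymin.
  have {}yD : y \in ~: D := yD.
  have nyD : y \notin D by rewrite -in_setC.
  have {}ymin y' : y' \notin D -> key y <= key y'.
    by rewrite -in_setC; apply: ymin.
  apply: (IH (y |: D)).
  - apply: succn_inj; rewrite -cD (cardsD1 y (~: D)) yD add1n.
    by congr _.+1; apply: eq_card => z; rewrite !inE negb_or.
  - move=> y1 y2; rewrite !inE negb_or => /orP[/eqP -> | y1D] /andP[_ y2D].
      exact: ymin.
    by apply: kD; rewrite ?in_setC.
  - apply: PS => // y'; last by move=> y'D; apply: kD.
    by rewrite ltnNge => /negP h; apply/negPn/negP => ny'; apply/h/ymin.
apply: (IH _ set0) => // y y'; by rewrite inE.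
Qed.

(** * Pointers with bounded crossing *)

Section TreeOrder.
Variables (X : finType) (anc : rel X) (idx : X -> nat) (rt : X).
Hypothesis anc_refl : reflexive anc.
Hypothesis anc_trans : transitive anc.
Hypothesis anc_chain : forall x y z, anc x z -> anc y z -> anc x y || anc y x.
Hypothesis idx_anc : forall x y, anc x y -> x != y -> idx x < idx y.
Hypothesis anc_root : forall x, anc rt x.

Lemma idx_anc_leq x y : anc x y -> idx x <= idx y.
Proof. by have [-> // | xy a] := eqVneq x y; rewrite ltnW ?idx_anc. Qed.

Lemma anc_anti x y : anc x y -> anc y x -> x = y.
Proof.
move=> xy yx; apply/eqP/negPn/negP => ne.
by move: (idx_anc xy ne); rewrite ltnNge idx_anc_leq.
Qed.

Lemma idx_leq_anc x y z : anc x z -> anc y z -> idx x <= idx y -> anc x y.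
Proof.
move=> xz yz; case/orP: (anc_chain xz yz) => // yx.
by have [-> // | ne] := eqVneq y x; rewrite leqNgt idx_anc.
Qed.

Definition lca u v := [arg max_(w > rt | anc w u && anc w v) idx w].

Lemma lcaP u v :
  [/\ anc (lca u v) u, anc (lca u v) v
    & forall w, anc w u -> anc w v -> anc w (lca u v)].
Proof.
rewrite /lca; case: arg_maxnP => [|a /andP[au av] amax]; first by rewrite !anc_root.
split=> // w wu wv; apply: (idx_leq_anc wu au); apply: amax.
by rewrite wu wv.
Qed.

(** Membership in the undirected path: the second condition says that [z] is not strictly above a
    common ancestor of [x] and [y]. *)
Definition onpath z x y :=
  (anc z x || anc z y) &&
  [forall w, anc z w && anc w x && anc w y ==> (w == z)].

Lemma onpathP z x y :
  reflect ((anc z x \/ anc z y) /\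
           (forall w, anc z w -> anc w x -> anc w y -> w = z))
          (onpath z x y).
Proof.
apply: (iffP andP) => [[/orP h /forallP q]|[/orP h q]]; split=> //.
  by move=> w zw wx wy; apply/eqP; have := q w; rewrite zw wx wy.
by apply/forallP => w; apply/implyP => /andP[/andP[zw wx] wy]; apply/eqP/q.
Qed.

Lemma onpathC z x y : onpath z x y = onpath z y x.
Proof.
by rewrite /onpath orbC; congr (_ && _); apply: eq_forallb => w; rewrite andbAC.
Qed.

Lemma onpath_id z x : onpath z x x = (z == x).
Proof.
apply/onpathP/eqP => [[zx h] | ->]; last first.
  by split; [left | move=> w xw wx _; apply: anc_anti].
by symmetry; apply: h => //; case: zx.
Qed.

Lemma onpath_down z x y : anc x y -> onpath z x y -> anc x z && anc z y.
Proof.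
move=> xy /onpathP[h q]; have zy : anc z y by case: h => // zx; apply: anc_trans xy.
rewrite zy andbT; case/orP: (anc_chain xy zy) => // zx.
by rewrite (q x).
Qed.

(** The deepest of the three pairwise least common ancestors works; [H] treats the case where it is
    [lca a b]. *)
Lemma median x y t : exists w, [/\ onpath w x y, onpath w x t & onpath w y t].
Proof.
have H a b c : idx (lca a c) <= idx (lca a b) -> idx (lca b c) <= idx (lca a b) ->
    [/\ onpath (lca a b) a b, onpath (lca a b) a c & onpath (lca a b) b c].
  have [wa wb wm] := lcaP a b; have [l1 l2 lm] := lcaP a c.
  have [k1 k2 km] := lcaP b c; move=> i1 i2.
  have la := idx_leq_anc l1 wa i1; have ka := idx_leq_anc k1 wb i2.
  split; apply/onpathP; split; try by left.
  - by move=> w ww ? ?; apply: anc_anti => //; apply: wm.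
  - move=> w ww ? ?; apply: anc_anti => //; apply: anc_trans la; exact: lm.
  - move=> w ww ? ?; apply: anc_anti => //; apply: anc_trans ka; exact: km.
have lC a b : lca a b = lca b a.
  have [wa wb wm] := lcaP a b; have [l1 l2 lm] := lcaP b a.
  by apply: anc_anti; [apply: lm | apply: wm].
have [h1 | h1] := leqP (idx (lca x t)) (idx (lca x y)).
  have [h2 | h2] := leqP (idx (lca y t)) (idx (lca x y)).
    by exists (lca x y); apply: H.
  have [] := H y t x; rewrite ?[lca y x]lC ?[lca t x]lC ?(ltnW h2) //.
    exact: leq_trans h1 (ltnW h2).
  by move=> a b c; exists (lca y t); rewrite onpathC b onpathC c a.
have [h2 | h2] := leqP (idx (lca y t)) (idx (lca x t)).
  have [] := H x t y; rewrite ?[lca t y]lC ?(ltnW h1) //.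
  by move=> a b c; exists (lca x t); rewrite b a onpathC c.
have [] := H y t x; rewrite ?[lca y x]lC ?[lca t x]lC ?(ltnW h2) //.
  exact: ltnW (ltn_trans h1 h2).
by move=> a b c; exists (lca y t); rewrite onpathC b onpathC c a.
Qed.

(* A pointer from each [m] in [M] to a target [(g m).1]; the boolean [(g m).2]
   tells which component of the witnessing pair the target is. *)
Definition crossing (M : {set X}) (g : X -> X * bool) z : {set X * bool} :=
  [set g m | m in M & onpath z m (g m).1].

Definition guidable k (M : {set X}) (P : X -> X * bool -> bool) :=
  exists2 g, {in M, forall m, P m (g m)} & forall z, #|crossing M g z| <= k.

Lemma guidable_cover (I : finType) k (M : {set X}) (N : I -> {set X}) P :
  (forall i, guidable k (N i) P) -> {in M, forall m, exists i, m \in N i} ->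
  guidable (#|I| * k) M P.
Proof.
move=> /fin_all_exists2[g gP gk] MN.
have [I0 | /card_gt0P[i0 _]] := posnP #|I|.
  exists (fun m => (m, true)) => [m /MN[i] | z]; first by move: (card0_eq I0 i).
  apply: leq_trans (_ : 0 <= _) => //; rewrite leqn0 cards_eq0.
  apply/eqP/setP => t; rewrite inE; apply/imsetP => -[m].
  by rewrite inE => /andP[/MN[i]]; move: (card0_eq I0 i).
pose ch m := odflt i0 [pick i | m \in N i].
have chP m : m \in M -> m \in N (ch m).
  by move/MN => [i mi]; rewrite /ch; case: pickP => [//|/(_ i)]; rewrite mi.
exists (fun m => g (ch m) m) => [m /chP/gP // | z].
apply: leq_trans (_ : #|\bigcup_(i in I) crossing (N i) (g i) z| <= _).
  apply/subset_leq_card/subsetP => t /imsetP[m]; rewrite inE => /andP[mM zm] ->.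
  apply/bigcupP; exists (ch m) => //.
  by apply/imsetP; exists m => //; rewrite inE chP.
exact: card_bigcup_leq.
Qed.

Lemma guidable_sub k k' (M : {set X}) (P Q : X -> X * bool -> bool) :
  k <= k' -> {in M, forall m t, P m t -> Q m t} -> guidable k M P -> guidable k' M Q.
Proof.
move=> kk PQ [g gP gk]; exists g => [m mM | z]; first by apply: PQ => //; apply: gP.
exact: leq_trans kk.
Qed.

(* Each pair is sent down from its least common ancestor to one of its two
   components: top-down, a pair avoids the side that is already full. *)
Lemma choose_sides k (J : {set X * X}) :
  (forall a, #|[set I in J | lca I.1 I.2 == a]| <= k) ->
  exists side : X * X -> bool, forall z,
    #|[set I in J | [&& anc (lca I.1 I.2) z, lca I.1 I.2 != z
                      & anc z (if side I then I.1 else I.2)]]| <= k.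
Proof.
move=> Jk; pose lc (I : X * X) := lca I.1 I.2.
pose tgt (side : X * X -> bool) I := if side I then I.1 else I.2.
pose load side (D : {set X * X}) z :=
  [set I in J :&: D | [&& anc (lc I) z, lc I != z & anc z (tgt side I)]].
suff [side h] : exists side, forall z, #|load side setT z| <= k.
  by exists side => z; move: (h z); rewrite /load setIT.
apply: (@key_ind _ (idx \o lc) (fun D => exists side, forall z, #|load side D z| <= k)).
  exists (fun=> true) => z; rewrite (_ : load _ _ _ = set0) ?cards0 //.
  by apply/setP => I; rewrite !inE andbF.
move=> D I nID below above [side sk].
have [IJ | nIJ] := boolP (I \in J); last first.
  exists side => z; rewrite (_ : load _ _ _ = load side D z) //.
  apply/setP => I'; rewrite !inE; have [-> | //] := eqVneq I' I.
  by rewrite (negbTE nIJ).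
pose upd b := fun I' => if I' == I then b else side I'.
have load_upd b z : load (upd b) (I |: D) z \subset
    if [&& anc (lc I) z, lc I != z & anc z (if b then I.1 else I.2)]
    then I |: load side D z else load side D z.
  apply/subsetP => I'; rewrite inE /tgt /upd !in_setI in_setU1 => /andP[].
  have [-> _ -> | ne] := eqVneq I' I; first exact: setU11.
  rewrite /= => h1 h2; have : I' \in load side D z by rewrite !inE h1.
  by case: ifP => // _; apply: setU1r.
(* A side is unusable only if some node strictly below the [lca] of [I], towards that component,
   already carries [k] pairs. *)
have full b : ~ (forall z, #|load (upd b) (I |: D) z| <= k) ->
   exists z, [&& anc (lc I) z, lc I != z & anc z (if b then I.1 else I.2)]
             && (#|load side D z| == k).
  move=> nk; apply/existsP; apply: contra_notT nk => /existsPn h z.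
  apply: leq_trans (subset_leq_card (load_upd b z)) _.
  move: (h z); case: [&& _, _ & _] => //=; rewrite eqn_leq sk /= -ltnNge => lt.
  by apply: leq_trans lt; rewrite cardsU1 -add1n leq_add2r leq_b1.
have [/forallP h | /forallPn/= n1] :=
  boolP [forall z, #|load (upd true) (I |: D) z| <= k].
  by exists (upd true).
have [/forallP h | /forallPn/= n2] :=
  boolP [forall z, #|load (upd false) (I |: D) z| <= k].
  by exists (upd false).
have /full[z1 /andP[/and3P[az1 nz1 z1t] /eqP k1]] :
    ~ (forall z, #|load (upd true) (I |: D) z| <= k).
  by case: n1 => z /negP nz h; apply/nz/h.
have /full[z2 /andP[/and3P[az2 nz2 z2t] /eqP k2]] :
    ~ (forall z, #|load (upd false) (I |: D) z| <= k).
  by case: n2 => z /negP nz h; apply/nz/h.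
have [la lb lm] := lcaP I.1 I.2.
have [a1 a2] : ~ anc z1 I.2 /\ ~ anc z2 I.1.
  split=> h.
    by case/eqP: nz1; apply: anc_anti az1 (lm _ z1t h).
  by case/eqP: nz2; apply: anc_anti az2 (lm _ h z2t).
have disj : [disjoint load side D z1 & load side D z2].
  apply/pred0P => I' /=; apply/negP; rewrite !inE.
  case/andP => /and4P[_ _ _ t1] /and4P[_ _ _ t2].
  case/orP: (anc_chain t1 t2) => h.
    by apply: a1; apply: anc_trans z2t.
  by apply: a2; apply: anc_trans z1t.
(* The [k] pairs at [z1] and the [k] pairs at [z2] are distinct. All were treated before [I], so
   each of them either crosses [lc I] from above or has the same least common ancestor as [I]: at
   most [k], respectively [k - 1], of them. *)
have sub : load side D z1 :|: load side D z2 \subset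
    load side D (lc I) :|: ([set I1 in J | lc I1 == lc I] :\ I).
  have key z I' : anc (lc I) z -> lc I != z -> I' \in load side D z ->
      I' \in load side D (lc I) :|: ([set I1 in J | lc I1 == lc I] :\ I).
    move=> az nz; rewrite !inE -!andbA => /and5P[I'J I'D a' n' t'].
    rewrite I'J I'D /=.
    have -> /= : I' != I by apply/eqP => e; rewrite -e I'D in nID.
    have [// | /= ne] := eqVneq (lc I') (lc I); rewrite ?orbT // orbF.
    rewrite (idx_leq_anc a' az) ?above //=.
    exact: anc_trans t'.
  by apply/subsetP => I'; rewrite in_setU => /orP[]; apply: key.
have := subset_leq_card sub; rewrite cardsU (disjoint_setI0 disj) cards0 subn0 k1 k2.
move=> le; have := leq_trans le (leq_card_setU _ _).
have := Jk (lc I); rewrite (cardsD1 I) !inE IJ eqxx add1n => lt1.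
move=> le2; have := leq_trans le2 (leq_add (sk (lc I)) (leqnn _)).
by rewrite leq_add2l leqNgt lt1.
Qed.

Variable out : X -> seq X.
Hypothesis mem_out : forall z v, (v \in out z) = ~~ anc z v.
Hypothesis prefix_out : forall z z', anc z z' -> prefix (out z) (out z').

(** * Columns and their ranks *)

Section Columns.
Variables (CT : finType) (c : X -> X -> CT).
Hypothesis c_merge : forall m m' v v',
  anc m m' -> ~~ anc m v -> ~~ anc m v' -> c m v = c m v' -> c m' v = c m' v'.

Definition position z t := index t (map (c z) (out z)).
(* The number of columns met in [out z] before the first [t].  As columns merge
   downwards, the rank of the column of a fixed node cannot grow downwards. *)
Definition rank z t := #|[set c z v | v in take (position z t) (out z)]|.

Lemma position_size z v : ~~ anc z v -> position z (c z v) < size (out z).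
Proof.
by move=> zv; rewrite -(size_map (c z)) index_mem map_f // mem_out.
Qed.

Lemma nth_position z v : ~~ anc z v ->
  c z (nth v (out z) (position z (c z v))) = c z v.
Proof.
move=> zv; rewrite -[LHS](nth_map v (c z v)) ?position_size // nth_index //.
by rewrite map_f // mem_out.
Qed.

Lemma nth_before z v i : i < position z (c z v) -> ~~ anc z v ->
  c z (nth v (out z) i) != c z v.
Proof.
move=> lti zv; have := before_find (c z v) lti; rewrite (nth_map v) => [/negbT //|].
exact: ltn_trans (position_size zv).
Qed.

Lemma position_leq z v i : i < size (out z) -> c z (nth v (out z) i) = c z v ->
  position z (c z v) <= i.
Proof.
move=> si e; rewrite leqNgt; apply/negP => /(before_find (c z v)).
by rewrite (nth_map v) // e /= eqxx.
Qed.

Lemma take_outside z v i : v \in take i (out z) -> ~~ anc z v.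
Proof. by move/mem_take; rewrite mem_out. Qed.

Lemma take_out z z' i : anc z z' -> i <= size (out z) ->
  take i (out z') = take i (out z).
Proof.
move/prefix_out/prefixP => [s ->] si.
by rewrite take_cat ltn_neqAle si andbT; case: eqP => //= ->; rewrite subnn take0 cats0 take_size.
Qed.

Lemma nth_out z z' v i : anc z z' -> i < size (out z) ->
  nth v (out z') i = nth v (out z) i.
Proof. by move/prefix_out/prefixP => [s ->] si; rewrite nth_cat si. Qed.

Lemma size_out z z' : anc z z' -> size (out z) <= size (out z').
Proof. by move/prefix_out/prefixP => [s ->]; rewrite size_cat leq_addr. Qed.

Lemma rank_ltn z v v' : ~~ anc z v ->
  position z (c z v) < position z (c z v') -> rank z (c z v) < rank z (c z v').
Proof.
move=> zv lt; apply: proper_card; apply/properP; split.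
  apply/subsetP => t /imsetP[u uP ->]; apply: imset_f.
  by move: uP; rewrite -[in take (position z (c z v)) _](minn_idPl (ltnW lt)) take_min => /mem_take.
exists (c z v).
  rewrite -[X in X \in _](nth_position zv); apply: imset_f.
  rewrite -(nth_take _ lt) mem_nth // size_take; case: ifP => // _.
  exact: position_size.
apply/imsetP => -[u /(nthP v)[i]]; rewrite size_take position_size // => lti.
rewrite nth_take // => <- e; have := nth_before lti zv.
by rewrite -e eqxx.
Qed.

Lemma rank_inj z v v' : ~~ anc z v -> ~~ anc z v' ->
  rank z (c z v) = rank z (c z v') -> c z v = c z v'.
Proof.
move=> zv zv' e; case: (ltngtP (position z (c z v)) (position z (c z v'))) => lt.
- by have := rank_ltn zv lt; rewrite e ltnn.
- by have := rank_ltn zv' lt; rewrite e ltnn.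
- rewrite -(nth_position zv) lt (set_nth_default v') ?position_size //.
  exact: nth_position.
Qed.

Lemma c_descend z z' : anc z z' ->
  exists f, forall v, ~~ anc z v -> f (c z v) = c z' v.
Proof.
move=> zz'.
exists (fun t => if [pick w | ~~ anc z w && (c z w == t)] is Some w then c z' w else t).
move=> v zv; case: pickP => [w /andP[zw /eqP e] | /(_ v)].
  exact: c_merge zz' _ _ e.
by rewrite zv eqxx.
Qed.

(** [out z'] extends [out z], and nodes that share a column at [z] still share one at [z'], so the
    old first occurrence remains an occurrence. *)
Lemma position_mono z z' v : anc z z' -> ~~ anc z v ->
  position z' (c z' v) <= position z (c z v).
Proof.
move=> zz' zv; have lt := position_size zv.
apply: position_leq; first exact: leq_trans lt (size_out zz').
rewrite (nth_out v zz' lt); apply: c_merge zz' _ zv (nth_position zv).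
by rewrite -mem_out mem_nth.
Qed.

Lemma descend_image z z' f i : (forall v, ~~ anc z v -> f (c z v) = c z' v) ->
  [set c z' v | v in take i (out z)] = f @: [set c z v | v in take i (out z)].
Proof.
move=> fE; rewrite -imset_comp; apply: eq_in_imset => v /take_outside vo /=.
by rewrite fE.
Qed.

Lemma rank_leq_image z z' v : anc z z' -> ~~ anc z v ->
  rank z' (c z' v) <= #|[set c z' u | u in take (position z (c z v)) (out z)]|.
Proof.
move=> zz' zv; have le := position_mono zz' zv.
rewrite /rank (take_out zz'); last exact: leq_trans le (ltnW (position_size zv)).
apply/subset_leq_card/subsetP => t /imsetP[u uP ->]; apply: imset_f.
by move: uP; rewrite -(minn_idPl le) take_min => /mem_take.
Qed.

Lemma rank_mono z z' v : anc z z' -> ~~ anc z v ->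
  rank z' (c z' v) <= rank z (c z v).
Proof.
move=> zz' zv; apply: leq_trans (rank_leq_image zz' zv) _.
by have [f fE] := c_descend zz'; rewrite (descend_image _ fE) leq_imset_card.
Qed.

(** If the rank of [v] does not drop, no two of the columns met before that of [v] merge between [z]
    and [z']. The columns up to it then keep their first position and their number of
    predecessors. *)
Lemma rank_persist z z' v v0 : anc z z' -> ~~ anc z v -> ~~ anc z v0 ->
  rank z' (c z' v) = rank z (c z v) -> rank z (c z v0) <= rank z (c z v) ->
  rank z' (c z' v0) = rank z (c z v0).
Proof.
move=> zz' zv zv0 er le0.
have [f fE] := c_descend zz'.
have : position z (c z v0) <= position z (c z v).
  by rewrite leqNgt; apply/negP => /(rank_ltn zv); rewrite ltnNge le0.
rewrite leq_eqVlt => /orP[/eqP ep | lt].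
  have e : c z v0 = c z v.
    rewrite -(nth_position zv0) ep (set_nth_default v) ?position_size //.
    exact: nth_position.
  by rewrite e -er -(c_merge zz' zv0 zv e).
have f_inj : {in [set c z u | u in take (position z (c z v)) (out z)] &, injective f}.
  apply/imset_injP; rewrite eqn_leq leq_imset_card /= -(descend_image _ fE).
  by rewrite -/(rank z (c z v)) -er rank_leq_image.
(* An earlier first occurrence at [z'] would come from two columns merged before that of [v]. *)
have same : position z' (c z' v0) = position z (c z v0).
  apply/eqP; rewrite eqn_leq position_mono //= leqNgt; apply/negP => lt0.
  have zv0' : ~~ anc z' v0.
    by apply: contra zv0 => a; apply: anc_trans a.
  have := nth_position zv0'; set j := position z' _ in lt0 *.
  have lt1 := ltn_trans lt0 lt; have sz := position_size zv.
  have mem i : i < position z (c z v) -> nth v0 (out z) i \in take (position z (c z v)) (out z).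
    by move=> li; rewrite -(nth_take _ li) mem_nth // size_take sz.
  rewrite (nth_out v0 zz' (ltn_trans lt1 sz)) -fE ?(take_outside (mem _ lt1)) //.
  rewrite -[RHS]fE // => /f_inj h.
  have /negP[] := nth_before lt0 zv0; apply/eqP/h; first exact/imset_f/mem.
  by rewrite -[X in X \in _](nth_position zv0); apply/imset_f/mem.
rewrite /rank same (take_out zz') ?(ltnW (position_size zv0)) //.
rewrite (descend_image _ fE) card_in_imset // => t t' tP t'P; apply: f_inj.
  move: tP => /imsetP[u uP ->]; apply: imset_f.
  by move: uP; rewrite -[in take (position z (c z v0)) _](minn_idPl (ltnW lt)) take_min => /mem_take.
move: t'P => /imsetP[u uP ->]; apply: imset_f.
by move: uP; rewrite -[in take (position z (c z v0)) _](minn_idPl (ltnW lt)) take_min => /mem_take.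
Qed.

End Columns.

(** * Pairs with one component below the node and the other not below it *)

Section Vertical.
Variables (RT CT : finType) (r : X -> X -> RT) (c : X -> X -> CT).
Hypothesis r_merge : forall m m' u u',
  anc m' m -> anc m u -> anc m u' -> r m u = r m u' -> r m' u = r m' u'.
Hypothesis c_merge : forall m m' v v',
  anc m m' -> ~~ anc m v -> ~~ anc m v' -> c m v = c m v' -> c m' v = c m' v'.
Variables (E : rel X) (p : RT) (tau : CT) (rho : nat) (M : {set X}).

Definition cand m (I : X * X) :=
  [&& E I.1 I.2, anc m I.1, ~~ anc m I.2, r m I.1 == p & c m I.2 == tau].

Hypothesis M_cand : {in M, forall m, exists I, cand m I}.
Hypothesis M_rank : {in M, forall m, rank c m tau = rho}.

(** Ranks take at most [#|CT|.+1] values, so [N] starters are one too many to have pairwise distinct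
    ranks. *)
Let N := #|CT|.+2.
Let start m : X * X := odflt (rt, rt) [pick I | cand m I].

Lemma startP m : m \in M -> cand m (start m).
Proof.
move/M_cand => [I mI]; rewrite /start.
by case: pickP => [// | /(_ I)]; rewrite mI.
Qed.

Definition through (SS : {set X}) z q :=
  [set s in SS | [&& anc s z, anc z (start s).1 & r z (start s).1 == q]].

(** The second clause records why [s'] became a starter below [s]: it could not share the witness of
    [s]. With [rank_persist] it forces the ranks in [blockedP] to drop. *)
Definition starters (D SS : {set X}) :=
  [/\ SS \subset M :&: D,
      {in SS &, forall s s', anc s s' -> s != s' -> anc s' (start s).1 ->
         r s' (start s).1 = p -> c s' (start s).2 != tau},
      {in M :&: D, forall m, (exists2 s, s \in SS & anc s m && cand m (start s))
                             \/ N <= #|through SS m p|}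
    & forall z q, #|through SS z q| <= N].

(* Top-down: [m] starts a pointer to its own witness unless it can share the one
   of a starter above it or too many pointers pass through it in row [p]. *)
Lemma starters_exist : exists SS, starters setT SS.
Proof.
apply: (@key_ind _ idx (fun D => exists SS, starters D SS)).
  exists set0; split=> [|s s'|m|z q]; rewrite ?sub0set ?inE ?andbF //.
  rewrite (_ : through _ _ _ = set0) ?cards0 //.
  by apply/setP => s; rewrite !inE.
move=> D m nD below above [SS [sub S3 S4 S5]].
have subM s : s \in SS -> s \in M by move/(subsetP sub); rewrite inE => /andP[].
have subD s : s \in SS -> s \in D by move/(subsetP sub); rewrite inE => /andP[].
have not_below s : s \in SS -> ~~ anc m s.
  move=> sS; apply/negP => ms; have sD := subD s sS.
  have ne : m != s by apply: contraNneq nD => ->.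
  by have := idx_anc ms ne; rewrite ltnNge above.
have sub' : SS \subset M :&: (m |: D).
  by apply/subsetP => s sS; rewrite !inE subM // subD ?orbT.
have keep : m \notin M \/ (exists2 s, s \in SS & anc s m && cand m (start s))
                       \/ N <= #|through SS m p| -> exists SS, starters (m |: D) SS.
  move=> h; exists SS; split=> // m'; rewrite !inE => /andP[m'M].
  case/orP => [/eqP e | m'D]; last by apply: S4; rewrite inE m'M.
  by rewrite e in m'M *; case: h => //; rewrite m'M.
have [mM | nM] := boolP (m \in M); last by apply: keep; left.
have [/exists_inP hs | nj] := boolP [exists s in SS, anc s m && cand m (start s)].
  by apply: keep; right; left.
have [full | nfull] := leqP N #|through SS m p|; first by apply: keep; right; right.
have cm := startP mM.
exists (m |: SS); split.
- by apply/subsetP => s; rewrite !inE => /orP[/eqP -> | sS];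
    rewrite ?eqxx ?mM // subM // subD ?orbT.
- move=> s s'; rewrite !inE => /orP[/eqP -> | sS] /orP[/eqP -> | s'S] //.
  + by rewrite eqxx.
  + by rewrite (negbTE (not_below _ s'S)).
  (* Otherwise [m] could have shared the witness of [s]. *)
  + move=> sm _ mu ru; apply: contraNneq nj => cv; apply/exists_inP; exists s => //.
    have /and5P[e _ nv _ _] := startP (subM _ sS).
    rewrite sm /cand e mu ru cv !eqxx /= andbT.
    by apply: contra nv; apply: anc_trans.
  + exact: S3.
- move=> m'; rewrite !inE => /andP[m'M /orP[/eqP -> | m'D]].
    by left; exists m; rewrite ?inE ?eqxx // anc_refl.
  have /S4[[s sS h] | h] : m' \in M :&: D by rewrite inE m'M.
    by left; exists s; rewrite ?inE ?sS ?orbT.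
  right; apply: leq_trans h _; apply/subset_leq_card/subsetP => s.
  by rewrite !inE => /andP[-> ->]; rewrite orbT.
(* If the new pointer passes [z] in row [q], every older one that does so also passes [m], and in
   row [p] because rows merge upwards; fewer than [N] were counted there. *)
- move=> z q; case hm : [&& anc m z, anc z (start m).1 & r z (start m).1 == q].
    case/and3P: hm => mz zu /eqP rz.
    apply: leq_trans (_ : #|m |: through SS m p| <= _).
      apply/subset_leq_card/subsetP => s; rewrite !inE.
      case/andP => /orP[-> // | sS] /and3P[sz zs /eqP rs].
      rewrite sS /= (anc_trans mz zs) (idx_leq_anc sz mz) /=; last first.
        exact: above (subD _ sS).
      have /and5P[_ _ _ /eqP <- _] := cm.
      by rewrite (r_merge mz zs zu) ?eqxx ?orbT // rs rz.
    by rewrite cardsU1; apply: leq_trans nfull; rewrite -add1n leq_add2r leq_b1.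
  apply: leq_trans (S5 z q); apply/subset_leq_card/subsetP => s; rewrite !inE.
  by case/andP => /orP[/eqP -> | -> //]; rewrite hm.
Qed.

Variable SS : {set X}.
Hypothesis SSP : starters setT SS.

Let SS_M s : s \in SS -> s \in M.
Proof. by case: SSP => /subsetP sub _ _ _ /sub; rewrite inE => /andP[]. Qed.

Definition blocked :=
  [set m in M | ~~ [exists s in SS, anc s m && cand m (start s)]].

Definition cand_via m s I := [&& cand m I, s \in through SS m p & anc s I.2].

(* The rank of the column of [I.2] drops strictly at every starter through [m]
   that is not an ancestor of [I.2], and ranks are at most [#|CT|]. *)
Lemma blockedP m I : m \in blocked -> cand m I -> exists s, cand_via m s I.
Proof.
rewrite inE => /andP[mM nj] mI.
case: SSP => _ S3 S4 _.
have full : N <= #|through SS m p|.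
  have /S4[[s sS h] | //] : m \in M :&: setT by rewrite inE mM in_setT.
  by case/negP: nj; apply/exists_inP; exists s.
apply/existsP; apply: contraLR full => /existsPn no; rewrite -ltnNge ltnS.
have nv s : s \in through SS m p -> ~~ anc s I.2.
  by move=> sT; have := no s; rewrite /cand_via mI sT.
have rank_lt s t : rank c s t < #|CT|.+1 by rewrite ltnS max_card.
pose h s : 'I_#|CT|.+1 := Ordinal (rank_lt s (c s I.2)).
rewrite -[X in _ <= X](card_ord #|CT|.+1) -(@card_in_imset _ _ h) ?max_card //.
have /and5P[_ mu nmv _ /eqP cmv] := mI.
(* Equal ranks of [I.2] at [s] and [s'] exclude merging before its column. The second component of
   the witness of [s] has rank [rho] at [s], at most that of [I.2]; so it still has rank [rho] at
   [s'], that is column [tau], against the second clause of [starters]. *)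
have step s s' : s \in through SS m p -> s' \in through SS m p ->
    anc s s' -> h s = h s' -> s = s'.
  move=> sT s'T ss' /(congr1 val)/= er; apply/eqP/negPn/negP => ne.
  have := sT; rewrite inE => /and4P[sS sm msu /eqP rs].
  have := s'T; rewrite inE => /and4P[s'S s'm ms'u /eqP rs'].
  have /and5P[_ su nsv0 /eqP rsu /eqP cs] := startP (SS_M sS).
  have /and5P[_ s'u ns'v0 /eqP rs'u /eqP cs'] := startP (SS_M s'S).
  have rk : rank c s (c s (start s).2) <= rank c s (c s I.2).
    rewrite cs (M_rank (SS_M sS)) -(M_rank mM) -cmv.
    exact: (rank_mono c_merge sm (nv _ sT)).
  have ns'v : ~~ anc s' (start s).2 by apply: contra nsv0; apply: anc_trans.
  have := rank_persist c_merge ss' (nv _ sT) nsv0 (esym er) rk.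
  rewrite cs (M_rank (SS_M sS)) -(M_rank (SS_M s'S)) -cs' => /(rank_inj ns'v ns'v0).
  rewrite cs'; apply/eqP/S3 => //; first exact: anc_trans msu.
  rewrite -rs'u; apply: r_merge s'm msu ms'u _.
  by rewrite rs rs'.
move=> s s' sT s'T e; have := sT; rewrite inE => /and4P[_ sm _ _].
have := s'T; rewrite inE => /and4P[_ s'm _ _].
by case/orP: (anc_chain sm s'm) => a; [| symmetry]; apply: step.
Qed.

(* Among the witnesses available through the starter [s], take the one that
   remains available deepest, so that nodes below [z] with the same starter and
   the same column at [z] share their witness. *)
Let W := #|{: X * X}|.
Let deep (via : X -> X) s I : nat :=
  \max_(m in [set m in blocked | (via m == s) && cand_via m s I]) idx m.
Let depth_key via s I := deep via s I * W + enum_rank I.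

Lemma choose_witnesses : exists (via : X -> X) (wit : X -> X * X),
  [/\ {in blocked, forall m, cand_via m (via m) (wit m)}
    & {in blocked &, forall m m' z, via m = via m' -> anc z m -> anc z m' ->
         ~~ anc z (wit m).2 -> ~~ anc z (wit m').2 ->
         c z (wit m).2 = c z (wit m').2 -> wit m = wit m'}].
Proof.
have : forall m, exists s, (m \in blocked) ==> [exists I, cand_via m s I].
  move=> m; have [mB | ] := boolP (m \in blocked); last by exists rt.
  have := mB; rewrite inE => /andP[/M_cand[I mI] _].
  by have [s sI] := blockedP mB mI; exists s; apply/existsP; exists I.
move=> /fin_all_exists[via viaP].
have : forall m, exists I, m \in blocked -> cand_via m (via m) I /\
    forall J, cand_via m (via m) J -> depth_key via (via m) J <= depth_key via (via m) I.
  move=> m; have [mB | ] := boolP (m \in blocked); last by exists (rt, rt).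
  have := viaP m; rewrite mB => /existsP[I1 mI1].
  by case: (arg_maxnP (depth_key via (via m)) mI1) => I mI Imax; exists I.
move=> /fin_all_exists[wit witP]; exists via, wit.
have witP1 m : m \in blocked -> cand_via m (via m) (wit m) by case/witP.
have witP2 m J : m \in blocked -> cand_via m (via m) J ->
    depth_key via (via m) J <= depth_key via (via m) (wit m).
  by case/witP => _ h; apply: h.
split=> // m m' mB m'B z ev zm zm' nv nv' ecz.
(* Let [b] be the deepest node where [wit m1] is available through the common starter. Then [m2] is
   above [b]: the row at [m2] follows upwards from [b] and the column downwards from [z], so
   [wit m1] is available at [m2] too. *)
have key m1 m2 : m1 \in blocked -> m2 \in blocked -> via m1 = via m2 ->
    anc z m1 -> anc z m2 -> ~~ anc z (wit m1).2 -> ~~ anc z (wit m2).2 ->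
    c z (wit m1).2 = c z (wit m2).2 ->
    deep via (via m1) (wit m2) <= deep via (via m1) (wit m1) ->
    cand_via m2 (via m1) (wit m1).
  move=> B1 B2 e12 z1 z2 nv1 nv2 ec le.
  have /and3P[c1 t1 sv1] := witP1 _ B1.
  have /and3P[c2 t2 sv2] := witP1 _ B2.
  have [|b] := @eq_bigmax_cond _
      (mem [set m in blocked | (via m == via m1) && cand_via m (via m1) (wit m1)]) idx.
    by apply/card_gt0P; exists m1; rewrite inE B1 eqxx witP1.
  rewrite inE => /andP[bB /andP[_ /and3P[cb tb _]]] bE.
  have idx2 : idx m2 <= idx b.
    rewrite -bE; apply: leq_trans le.
    apply: (@leq_bigmax_cond _ _ idx m2).
    by rewrite inE B2 e12 eqxx witP1.
  move: tb t2; rewrite -e12 !inE => /and4P[_ sb bs /eqP rb] /and4P[sS s2 u2 /eqP r2].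
  have m2b : anc m2 b by apply: idx_leq_anc idx2; first exact: u2.
  have /and5P[e1 mu1 nmv1 /eqP ru1 /eqP cv1] := cb.
  have /and5P[_ mu2 nmv2 /eqP ru2 /eqP cv2] := c2.
  have nm2v : ~~ anc m2 (wit m1).2 by apply: contra nv1; apply: anc_trans.
  rewrite /cand_via /cand e1 (anc_trans m2b mu1) nm2v sv1 !inE sS s2 u2 r2 eqxx !andbT /=.
  rewrite (c_merge z2 nv1 nv2 ec) cv2 eqxx andbT.
  by rewrite (r_merge m2b mu1 bs) ?r2 // ru1 rb.
(* [W] exceeds every enumeration rank, so [depth_key] compares depths first and breaks ties by
   enumeration; two maximal pairs of equal depth, each available at the node of the other,
   coincide. *)
have small (I : X * X) : enum_rank I < W by apply: ltn_ord.
have gap d d' (I I' : X * X) : d < d' ->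
    d * W + enum_rank I < d' * W + enum_rank I'.
  move=> lt; apply: leq_trans (_ : d.+1 * W <= _).
    by rewrite mulSn addnC ltn_add2r small.
  by apply: leq_trans (leq_addr _ _); rewrite leq_mul2r lt orbT.
have k1 := key m m' mB m'B ev zm zm' nv nv' ecz.
have k2 := key m' m m'B mB (esym ev) zm' zm nv' nv (esym ecz).
rewrite -ev in k2.
have m1 J : cand_via m (via m) J ->
    depth_key via (via m) J <= depth_key via (via m) (wit m) by apply: witP2.
have m2 J : cand_via m' (via m) J ->
    depth_key via (via m) J <= depth_key via (via m) (wit m').
  by rewrite ev; apply: witP2.
case: (ltngtP (deep via (via m) (wit m)) (deep via (via m) (wit m'))) => h.
- have := m1 _ (k2 (ltnW h)); rewrite leqNgt /depth_key.
  by rewrite (gap _ _ (wit m) (wit m') h).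
- have := m2 _ (k1 (ltnW h)); rewrite leqNgt /depth_key.
  by rewrite (gap _ _ (wit m') (wit m) h).
- have := conj (m1 _ (k2 (eq_leq h))) (m2 _ (k1 (eq_leq (esym h)))).
  rewrite /depth_key h !leq_add2l => -[l1 l2].
  by apply/enum_rank_inj/val_inj/eqP; rewrite eqn_leq l2 l1.
Qed.

Let users z := [set s in SS | anc s z && anc z (start s).1].

Let card_users z : #|users z| <= #|RT| * N.
Proof.
case: SSP => _ _ _ S5.
apply: leq_trans (_ : #|\bigcup_(q in RT) through SS z q| <= _).
  apply/subset_leq_card/subsetP => s; rewrite inE => /and3P[sS sz zs].
  by apply/bigcupP; exists (r z (start s).1); rewrite // inE sS sz zs eqxx.
by apply: card_bigcup_leq.
Qed.

Let K := #|RT| * N * #|CT|.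

(** Unblocked nodes borrow the first component of a starter, at the cost [#|RT| * N]. The witnesses
    of blocked nodes are sent to a side by [choose_sides]. At [z] the path to such a target leaves
    the subtree of [z], or belongs to a pair whose [lca] is [z], or descends through [z] from an
    [lca] strictly above: [K] in each case. *)
Lemma guidable_vertical_starters : guidable (K + K + K + #|RT| * N) M
  (fun m t => if t.2 then [exists v, cand m (t.1, v)] else [exists u, cand m (u, t.1)]).
Proof.
have [via [wit [witP wit_inj]]] := choose_witnesses.
have viaP m : m \in blocked ->
    [/\ via m \in SS, anc (via m) m, anc m (start (via m)).1 & anc (via m) (wit m).2].
  by move/witP => /and3P[_]; rewrite inE => /and4P[].
have candP m : m \in blocked -> [/\ anc m (wit m).1, ~~ anc m (wit m).2 & cand m (wit m)].
  by move/witP => /and3P[h _ _]; have /and5P[] := h.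
pose J := [set wit m | m in blocked].
have cardT z : #|setX (users z) [set: CT]| <= K.
  by rewrite cardsX cardsT leq_mul2r card_users orbT.
(* The starter of [m] is above the second component while [z] is not, so it is above [z]. This
   starter and the column at [z] determine the witness. *)
have up z : #|[set wit m | m in [set m in blocked | anc z m && ~~ anc z (wit m).2]]| <= K.
  apply: leq_trans (cardT z).
  apply: (@card_imset_factor _ _ _ _ _ _ (fun m => (via m, c z (wit m).2))).
    move=> m; rewrite inE => /and3P[mB zm nzv]; have [sS sm ms sv] := viaP _ mB.
    rewrite !inE sS (anc_trans zm ms) !andbT /=.
    by case/orP: (anc_chain sm zm) => // zs; rewrite (anc_trans zs sv) in nzv.
  move=> m m'; rewrite inE => /and3P[mB zm nzv].
  rewrite inE => /and3P[m'B zm' nzv'] [es ec].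
  exact: (wit_inj _ _ mB m'B z).
have lc_low m : m \in blocked -> let a := lca (wit m).1 (wit m).2 in
    [/\ anc a m, a != m & anc (via m) a].
  move=> mB a; have [sS sm ms sv] := viaP _ mB; have [mu nmv _] := candP _ mB.
  have [au av amax] := lcaP (wit m).1 (wit m).2.
  have am : anc a m.
    by case/orP: (anc_chain au mu) => // ma; rewrite (anc_trans ma av) in nmv.
  split=> //; first by apply: contraNneq nmv => {1}<-.
  by apply: amax => //; apply: anc_trans mu.
(* Here [a] lies between the starter and [m]. The column is read at [top s], the highest blocked
   node with this starter and this [lca]: the other such nodes lie below it, and their second
   components do not. *)
have at_lca a : #|[set I in J | lca I.1 I.2 == a]| <= K.
  have -> : [set I in J | lca I.1 I.2 == a] =
      [set wit m | m in [set m in blocked | lca (wit m).1 (wit m).2 == a]].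
    apply/setP => I; rewrite inE; apply/andP/imsetP => [[/imsetP[m mB ->] h] | [m]].
      by exists m; rewrite // inE mB.
    by rewrite inE => /andP[mB h] ->; rewrite imset_f.
  pose G s m := [&& m \in blocked, lca (wit m).1 (wit m).2 == a & via m == s].
  pose top s := if [pick m | G s m] is Some m then [arg min_(m' < m | G s m') idx m'] else s.
  have topP m : G (via m) m -> G (via m) (top (via m)) /\ idx (top (via m)) <= idx m.
    move=> Gm; rewrite /top; case: pickP => [m1 Gm1 | /(_ m)]; last by rewrite Gm.
    by case: arg_minnP => // t Gt tmin; split=> //; apply: tmin.
  apply: leq_trans (cardT a).
  apply: (@card_imset_factor _ _ _ _ _ _ (fun m => (via m, c (top (via m)) (wit m).2))).
    move=> m; rewrite inE => /andP[mB /eqP ea]; have [am _ sa] := lc_low _ mB.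
    have [sS sm ms sv] := viaP _ mB; rewrite !inE sS /= andbT.
    by rewrite -ea sa; apply: anc_trans ms.
  have low m : m \in blocked -> lca (wit m).1 (wit m).2 = a ->
      anc (top (via m)) m /\ ~~ anc (top (via m)) (wit m).2.
    move=> mB ea; have [| /and3P[tB /eqP ta /eqP tv] ti] := topP m.
      by rewrite /G mB ea !eqxx.
    have [_ _ ts _] := viaP _ tB; have [_ _ ms _] := viaP _ mB.
    rewrite tv in ts; have tm := idx_leq_anc ts ms ti; split=> //.
    have [mu nmv _] := candP _ mB; have [_ _ amax] := lcaP (wit m).1 (wit m).2.
    apply/negP => tvv; have := amax _ (anc_trans tm mu) tvv; rewrite ea -ta => ta'.
    have [at' /eqP[]] := lc_low _ tB; exact: anc_anti.
  move=> m m'; rewrite inE => /andP[mB /eqP ea].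
  rewrite inE => /andP[m'B /eqP ea'] [es ec].
  have [h1 h2] := low _ mB ea; have [h3 h4] := low _ m'B ea'.
  by rewrite -es in h3 h4 ec; apply: (wit_inj _ _ mB m'B _ es h1 h3).
have [side sideP] := choose_sides at_lca.
have joined m : exists s, m \in M -> m \notin blocked ->
    s \in SS /\ anc s m && cand m (start s).
  have [/exists_inP[s sS h] | h] := boolP [exists s in SS, anc s m && cand m (start s)].
    by exists s.
  by exists rt => mM; rewrite inE mM h.
have [st stP] := fin_all_exists joined.
pose tgt I : X * bool := if side I then (I.1, true) else (I.2, false).
pose g m := if m \in blocked then tgt (wit m) else ((start (st m)).1, true).
exists g => [m mM | z].
  rewrite /g; have [mB | nB] := boolP (m \in blocked).
    have [_ _ h] := candP _ mB.
    by rewrite /tgt; case: (side _) => /=; apply/existsP; [exists (wit m).2 | exists (wit m).1];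
      rewrite -surjective_pairing.
  have [_ /andP[_ h]] := stP m mM nB.
  by apply/existsP; exists (start (st m)).2; rewrite -surjective_pairing.
set A1 := [set wit m | m in [set m in blocked | anc z m && ~~ anc z (wit m).2]].
set A2 := [set I in J | lca I.1 I.2 == z].
set A3 := [set I in J | [&& anc (lca I.1 I.2) z, lca I.1 I.2 != z
                          & anc z (if side I then I.1 else I.2)]].
have le_img (B : {set X * X}) n : #|B| <= n -> #|tgt @: B| <= n.
  by apply: leq_trans; apply: leq_imset_card.
apply: leq_trans (_ : #|(tgt @: A1 :|: tgt @: A2 :|: tgt @: A3)
  :|: [set ((start s).1, true) | s in users z]| <= _); last first.
  apply: leq_trans (leq_card_setU _ _) _; apply: leq_add; last first.
    by apply: leq_trans (card_users z); apply: leq_imset_card.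
  apply: leq_trans (leq_card_setU _ _) _; apply: leq_add; last exact/le_img/sideP.
  apply: leq_trans (leq_card_setU _ _) _; apply: leq_add; first exact/le_img/up.
  exact/le_img/at_lca.
apply/subset_leq_card/subsetP => t /imsetP[m]; rewrite inE => /andP[mM].
rewrite /g; have [mB | nB] /= := boolP (m \in blocked); last first.
  have [sS /andP[sm /and5P[_ mu _ _ _]]] := stP m mM nB.
  move=> /(onpath_down mu)/andP[mz zu] ->; apply/setUP; right; apply/imsetP.
  by exists (st m); rewrite // inE sS zu (anc_trans sm mz).
set I := wit m; move=> zp ->.
have [mu nmv _] := candP _ mB; have [am nam _] := lc_low _ mB.
have [au av _] := lcaP I.1 I.2; have IJ : I \in J by apply: imset_f.
have ay : anc (lca I.1 I.2) (tgt I).1 by rewrite /tgt; case: (side I).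
have /onpathP[zmy zmax] := zp.
have az : anc (lca I.1 I.2) z.
  have : anc (lca I.1 I.2) z || anc z (lca I.1 I.2).
    by case: zmy => h; apply: anc_chain h.
  by case/orP => // za; rewrite (zmax _ za am ay).
apply/setUP; left; apply/setUP.
have [zy | nzy] := boolP (anc z (tgt I).1).
  have [e | ne] := eqVneq (lca I.1 I.2) z.
    by left; apply/setUP; right; apply: imset_f; rewrite inE IJ e eqxx.
  right; apply: imset_f; rewrite inE IJ az ne /=.
  by move: zy; rewrite /tgt; case: (side I).
left; apply/setUP; left; apply: imset_f.
have zm : anc z m by case: zmy => // h; rewrite h in nzy.
apply: imset_f; rewrite inE mB zm /=; move: nzy; rewrite /tgt; case: (side I) => //=.
by rewrite (anc_trans zm mu).
Qed.

End Vertical.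

Section DownUp.
Variables (RT CT : finType) (r : X -> X -> RT) (c : X -> X -> CT).
Hypothesis r_merge : forall m m' u u',
  anc m' m -> anc m u -> anc m u' -> r m u = r m u' -> r m' u = r m' u'.
Hypothesis c_merge : forall m m' v v',
  anc m m' -> ~~ anc m v -> ~~ anc m v' -> c m v = c m v' -> c m' v = c m' v'.
Variables (E al be : rel X).
Hypothesis al_anc : forall m u, al m u -> anc m u.
Hypothesis be_anc : forall m v, be m v -> ~~ anc m v.
Hypothesis al_row : forall m u u', al m u -> anc m u' -> r m u = r m u' -> al m u'.
Hypothesis be_column :
  forall m v v', be m v -> ~~ anc m v' -> c m v = c m v' -> be m v'.

Definition witnessed : {set X} :=
  [set m | [exists u, [exists v, [&& E u v, al m u & be m v]]]].

Definition target_ok m (t : X * bool) :=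
  if t.2 then al m t.1 && [exists v, E t.1 v && be m v]
  else be m t.1 && [exists u, E u t.1 && al m u].

(** One factor for the row and column of the pair, one for the rank; the rest is the bound of
    [guidable_vertical_starters]. *)
Definition vertical_bound (R C : finType) :=
  let n := #|R| * #|C|.+2 in
  #|{: R * C}| * (#|'I_#|C|.+1| * (n * #|C| + n * #|C| + n * #|C| + n)).

(** Nodes are sorted by the row and column of a witnessing pair, then by the rank of that column, as
    the argument on starters compares ranks with one fixed value. Rows and columns decide [al] and
    [be], so every candidate of the right types is a valid witness. *)
Lemma guidable_down_up : guidable (vertical_bound RT CT) witnessed target_ok.
Proof.
pose M (q : RT * CT) := [set m | [exists I, [&& cand r c E q.1 q.2 m I, al m I.1 & be m I.2]]].
apply: (guidable_cover (N := M)) => [[p tau] | m]; last first.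
  rewrite inE => /existsP[u /existsP[v /and3P[e a b]]]; exists (r m u, c m v).
  rewrite inE; apply/existsP; exists (u, v).
  by rewrite /cand /= e a b al_anc // be_anc // !eqxx.
pose Mr (rho : 'I_#|CT|.+1) := [set m in M (p, tau) | rank c m tau == rho].
apply: (guidable_cover (N := Mr)) => [rho | m mM]; last first.
  have lt : rank c m tau < #|CT|.+1 by rewrite ltnS max_card.
  by exists (inord (rank c m tau)); rewrite inE mM inordK /=.
have cands : {in Mr rho, forall m, exists I, cand r c E p tau m I}.
  by move=> m; rewrite !inE => /andP[/existsP[I /andP[h _]] _]; exists I.
have ranks : {in Mr rho, forall m, rank c m tau = rho}.
  by move=> m; rewrite inE => /andP[_ /eqP].
have [SS SSP] := starters_exist r_merge cands.
have := guidable_vertical_starters r_merge c_merge cands ranks SSP.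
apply: guidable_sub => // m; rewrite !inE => /andP[/existsP[I /and3P[h a b]] _] [y [|]] /existsP[x] /and5P[/= e yu xv].
all: have /and5P[_ mu mv /eqP ru /eqP cv] := h.
all: move=> /eqP ry /eqP cx; rewrite /target_ok /=; apply/andP; split.
- by apply: al_row a yu _; rewrite ru.
- by apply/existsP; exists x; rewrite e; apply: be_column b xv _; rewrite cv.
- by apply: be_column b xv _; rewrite cv.
- by apply/existsP; exists x; rewrite e; apply: al_row a yu _; rewrite ru.
Qed.

End DownUp.

(** * From pointers to finitely many labels *)

Section Pointers.
Variable dir : X -> X -> option (option bool).
Hypothesis dir_up : forall z x, (dir z x == None) = ~~ anc z x.
Hypothesis dir_here : forall z x, (dir z x == Some None) = (z == x).
Hypothesis dir_anc : forall z w x, anc z w -> w != z -> anc w x -> dir z x = dir z w.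
Hypothesis dir_common : forall z x y b,
  dir z x = Some (Some b) -> dir z y = Some (Some b) ->
  exists w, [/\ anc z w, w != z, anc w x & anc w y].

(** Two nodes seen from [z] in the same direction are not separated by [z], unless both are [z]
    itself. *)
Lemma onpath_dir z x y :
  onpath z x y = (dir z x != dir z y) || (dir z x == Some None).
Proof.
apply/onpathP/idP => [[h q] | ].
  case: eqP => //= e; case: eqP => //= ne.
  case ex : (dir z x) e ne => [[b|]|] e // _.
    have [w [zw wz wx wy]] := dir_common ex (esym e).
    by rewrite (q _ zw wx wy) eqxx in wz.
  have := dir_up z x; have := dir_up z y; rewrite -e ex eqxx.
  by move=> /esym/negP h1 /esym/negP h2; case: h.
move=> h; split.
  apply/orP/negPn/negP; rewrite negb_or -!dir_up => /andP[/eqP e1 /eqP e2].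
  by rewrite e1 e2 in h.
move=> w zw wx wy; apply/eqP/negPn/negP => wz.
move: h; rewrite (dir_anc zw wz wx) (dir_anc zw wz wy) eqxx /= dir_here.
by rewrite eq_sym (negbTE wz).
Qed.

(* The labels on the path from [m] to [y] all lead towards [y]; from [m], such
   labels lead to at most one node. *)
Definition points (lab : X -> option (option (option bool))) m y :=
  [forall z, onpath z m y ==> (lab z == Some (dir z y))].

Section Coloring.
Variables (k : nat) (M : {set X}) (g : X -> X * bool).
Hypothesis cross : forall z, #|crossing M g z| <= k.

Let V (y : X * bool) z := [exists m in M, (g m == y) && onpath z m y.1].

Let V_crossing y z : V y z -> y \in crossing M g z.
Proof.
case/exists_inP => m mM /andP[/eqP e zp]; apply/imsetP.
by exists m; rewrite // inE mM e.
Qed.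

(* The paths to the target [y] form a subtree, whose topmost node is [a]. *)
Let topE (y : X * bool) : exists a, forall z, V y z ->
  [/\ anc a z & forall w, anc a w -> anc w z -> V y w].
Proof.
have [[m0 m0M /eqP m0y] | none] :
    {m0 | m0 \in M & g m0 == y} + {forall m, m \in M -> g m != y}.
- case: (pickP [pred m in M | g m == y]) => [m /andP[mM my] | no].
    by left; exists m.
  by right=> m mM; have := no m; rewrite /= mM /= => ->.
- have [m /andP[mM /eqP my] mmin] := arg_minnP (fun m => idx (lca m y.1))
    (introT andP (conj m0M (introT eqP m0y)) : [pred m in M | g m == y] m0).
  exists (lca m y.1) => z /exists_inP[m' m'M /andP[/eqP m'y zp]].
  have [am ay amax] := lcaP m y.1; have [am' ay' amax'] := lcaP m' y.1.
  have aa : anc (lca m y.1) (lca m' y.1).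
    by apply: (idx_leq_anc ay ay'); apply: mmin; rewrite /= m'M m'y eqxx.
  have /onpathP[zmy zu] := zp.
  have az : anc (lca m' y.1) z.
    have : anc (lca m' y.1) z || anc z (lca m' y.1).
      by case: zmy => h; [apply: anc_chain am' h | apply: anc_chain ay' h].
    by case/orP => // h; rewrite (zu _ h).
  split; first exact: anc_trans az.
  move=> w aw wz; apply/exists_inP.
  have [wy | nwy] := boolP (anc w y.1).
    exists m => //; rewrite my eqxx; apply/onpathP; split; first by right.
    move=> w' ww' w'm w'y; apply: anc_anti => //.
    exact: anc_trans (amax _ w'm w'y) aw.
  exists m' => //; rewrite m'y eqxx; apply/onpathP; split.
    by left; case: zmy => h; [apply: anc_trans h | case/negP: nwy; apply: anc_trans h].
  by move=> w' ww' _ w'y; case/negP: nwy; apply: anc_trans w'y.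
- exists rt => z /exists_inP[m mM /andP[e _]].
  by have := none m mM; rewrite e.
Qed.

(** Greedy colouring of subtrees by the depth of their tops, as for chordal graphs: an earlier
    subtree that meets the one of [y] contains [top y], where at most [k] targets cross, so one of
    [k.+1] colours is free. *)
Lemma coloring : exists col : X * bool -> 'I_k.+1,
  forall y y' z, y != y' -> V y z -> V y' z -> col y != col y'.
Proof.
have [top topP] := fin_all_exists topE.
suff [col h] : exists col : X * bool -> 'I_k.+1,
    forall y y' z, y \in setT -> y' \in setT -> y != y' -> V y z -> V y' z -> col y != col y'.
  by exists col => y y' z; apply: h.
apply: (@key_ind _ (idx \o top) (fun D => exists col : X * bool -> 'I_k.+1,
    forall y y' z, y \in D -> y' \in D -> y != y' -> V y z -> V y' z -> col y != col y')).
  by exists (fun=> ord0) => y y' z; rewrite inE.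
move=> D y nyD _ above [col colP].
pose used := col @: [set y' in D | V y' (top y)].
have [a aP] : exists a, a \notin used.
  apply/existsP; rewrite -negb_forall; apply/negP => /forallP all_used.
  have : #|used| <= k.
    apply: leq_trans (leq_imset_card _ _) _; apply: leq_trans (cross (top y)).
    by apply/subset_leq_card/subsetP => y'; rewrite inE => /andP[_ /V_crossing].
  rewrite leqNgt => /negP[]; rewrite -[X in X <= _](card_ord k.+1).
  by apply: subset_leq_card; apply/subsetP => a _; apply: all_used.
exists (fun y' => if y' == y then a else col y').
have key y' z : y' \in D -> V y z -> V y' z -> a != col y'.
  move=> y'D yz y'z; apply: contraNneq aP => ->; apply: imset_f; rewrite inE y'D.
  have [t1 _] := topP _ _ yz; have [t2 conv] := topP _ _ y'z.
  by apply: conv => //; apply: (idx_leq_anc t2 t1); apply: above.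
move=> y1 y2 z; rewrite !inE.
case/orP => [/eqP -> | y1D] /orP[/eqP -> | y2D] ne v1 v2.
- by rewrite eqxx in ne.
- by rewrite eqxx [y2 == y]eq_sym (negbTE ne); apply: key v1 v2.
- by rewrite eqxx (negbTE ne) eq_sym; apply: key v2 v1.
- have n1 : y1 != y by apply: contraNneq nyD => <-.
  have n2 : y2 != y by apply: contraNneq nyD => <-.
  by rewrite (negbTE n1) (negbTE n2); apply: colP ne v1 v2.
Qed.

End Coloring.

Lemma guidable_points k (M : {set X}) (P : X -> X * bool -> bool) :
  guidable k M P ->
  exists (ptr : X -> option ('I_k.+1 * bool)) (lab : 'I_k.+1 -> X -> option (option (option bool))),
    {in M, forall m, ptr m != None} /\
    forall m a side, ptr m = Some (a, side) ->
      exists2 y, P m (y, side) & forall y', points (lab a) m y' = (y' == y).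
Proof.
case=> g gP cross; have [col colP] := coloring cross.
pose V (y : X * bool) z := [exists m in M, (g m == y) && onpath z m y.1].
exists (fun m => if m \in M then Some (col (g m), (g m).2) else None).
exists (fun a z => if [pick y | (col y == a) && V y z] is Some y then Some (dir z y.1) else None).
split=> [m -> // | m a side]; case: ifP => // mM [<- <-].
exists (g m).1; first by rewrite -surjective_pairing gP.
have labE z : onpath z m (g m).1 ->
    (if [pick y | (col y == col (g m)) && V y z] is Some y then Some (dir z y.1) else None)
    = Some (dir z (g m).1).
  move=> zp; have Vz : V (g m) z by apply/exists_inP; exists m; rewrite // eqxx.
  case: pickP => [y /andP[/eqP ey Vy] | /(_ (g m))]; last by rewrite eqxx Vz.
  have [-> // | ne] := eqVneq y (g m).
  by have := colP _ _ _ ne Vy Vz; rewrite ey eqxx.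
move=> y; apply/forallP/eqP => [h | -> z]; last first.
  by apply/implyP => zp; rewrite labE.
(* At the median [w] the label is the direction both of [y] and of the true target. As [w] lies
   between these two, the directions agree only if both nodes are [w]. *)
have [w [w1 w2 w3]] := median m y (g m).1.
have := h w; rewrite w1 labE //= => /eqP[] e.
move: w3; rewrite onpath_dir -e eqxx /= dir_here => /eqP wt.
by rewrite -wt in e *; apply/esym/eqP; rewrite -dir_here -e dir_here.
Qed.

End Pointers.

Section Cases.
Variable dir : X -> X -> option (option bool).
Hypothesis dir_up : forall z x, (dir z x == None) = ~~ anc z x.
Hypothesis dir_here : forall z x, (dir z x == Some None) = (z == x).
Hypothesis dir_anc : forall z w x, anc z w -> w != z -> anc w x -> dir z x = dir z w.
Hypothesis dir_common : forall z x y b,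
  dir z x = Some (Some b) -> dir z y = Some (Some b) ->
  exists w, [/\ anc z w, w != z, anc w x & anc w y].

Lemma guidable_swap k (E al be : rel X) :
  guidable k (witnessed (fun u v => E v u) be al) (target_ok (fun u v => E v u) be al) ->
  guidable k (witnessed E al be) (target_ok E al be).
Proof.
case=> g gP cross; pose flip (t : X * bool) := (t.1, ~~ t.2).
exists (flip \o g) => [m mW | z].
  have /gP : m \in witnessed (fun u v => E v u) be al.
    move: mW; rewrite !inE => /existsP[u /existsP[v /and3P[e a b]]].
    by apply/existsP; exists v; apply/existsP; exists u; rewrite e a b.
  by rewrite /target_ok /=; case: (g m) => y [|].
apply: leq_trans (cross z); rewrite -[X in _ <= X](card_imset _ (_ : injective flip)).
  apply/subset_leq_card/subsetP => t /imsetP[m]; rewrite inE => /andP[mW zp] ->.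
  apply: imset_f; apply: imset_f; rewrite inE zp andbT.
  move: mW; rewrite !inE => /existsP[u /existsP[v /and3P[e a b]]].
  by apply/existsP; exists v; apply/existsP; exists u; rewrite e a b.
by move=> [y s] [y' s'] [-> /negb_inj ->].
Qed.

Lemma guidable_here (E al be : rel X) : (forall m u, al m u -> u = m) ->
  guidable 1 (witnessed E al be) (target_ok E al be).
Proof.
move=> al_here; exists (fun m => (m, true)) => [m | z].
  rewrite inE => /existsP[u /existsP[v /and3P[e a b]]].
  have um := al_here _ _ a; rewrite um in e a.
  by rewrite /target_ok /= a; apply/existsP; exists v; rewrite e b.
rewrite -(cards1 (z, true)); apply/subset_leq_card/subsetP => t /imsetP[m].
by rewrite inE /= onpath_id => /andP[_ /eqP <-] ->; apply: set11.
Qed.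

(** [m] is the [lca] of its own pair, so each node is the [lca] of at most one pair; [choose_sides]
    then lets one more pair cross from above, which gives 2. *)
Lemma guidable_sides (E al be : rel X) (s : bool) :
  (forall m u, al m u -> dir m u = Some (Some s)) ->
  (forall m v, be m v -> dir m v = Some (Some (~~ s))) ->
  guidable 2 (witnessed E al be) (target_ok E al be).
Proof.
move=> al_dir be_dir.
have : forall m, exists I : X * X, m \in witnessed E al be -> [&& E I.1 I.2, al m I.1 & be m I.2].
  move=> m; have [] := boolP (m \in _); last by exists (rt, rt).
  by rewrite inE => /existsP[u /existsP[v h]]; exists (u, v).
move=> /fin_all_exists[wit witP].
pose J := [set wit m | m in witnessed E al be].
have wit_lca m : m \in witnessed E al be -> lca (wit m).1 (wit m).2 = m.
  move=> /witP/and3P[_ /al_dir d1 /be_dir d2].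
  have : onpath m (wit m).1 (wit m).2.
    by rewrite (onpath_dir dir_up dir_here dir_anc dir_common) d1 d2; case: s {al_dir be_dir d1 d2}.
  case/onpathP => _; apply; last by case: (lcaP (wit m).1 (wit m).2).
    have [_ _] := lcaP (wit m).1 (wit m).2; apply.
      by apply/negPn; rewrite -dir_up d1.
    by apply/negPn; rewrite -dir_up d2.
  by case: (lcaP (wit m).1 (wit m).2).
have J1 a : #|[set I in J | lca I.1 I.2 == a]| <= 1.
  rewrite -(cards1 (wit a)); apply/subset_leq_card/subsetP => I; rewrite !inE.
  by case/andP => /imsetP[m mW ->]; rewrite (wit_lca _ mW) => /eqP ->.
have [side sideP] := choose_sides J1.
pose tgt I : X * bool := if side I then (I.1, true) else (I.2, false).
exists (tgt \o wit) => [m mW | z].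
  have /and3P[e a b] := witP m mW; rewrite /target_ok /= /tgt.
  case: (side _) => /=; first by rewrite a; apply/existsP; exists (wit m).2; rewrite e b.
  by rewrite b; apply/existsP; exists (wit m).1; rewrite e a.
apply: leq_trans (leq_add (leqnn 1) (sideP z)).
rewrite -{1}(cards1 (tgt (wit z))).
apply: leq_trans (leq_add (leqnn _) (leq_imset_card tgt _)).
apply: leq_trans (leq_card_setU _ _); apply/subset_leq_card/subsetP => t /imsetP[m].
rewrite inE => /andP[mW zp] ->; have /and3P[_ /al_dir d1 /be_dir d2] := witP m mW.
have my : anc m ((tgt \o wit) m).1.
  by apply/negPn; rewrite -dir_up /= /tgt; case: (side _); rewrite ?d1 ?d2.
have /andP[mz zy] := onpath_down my zp.
have [<- | ne] := eqVneq m z; first by rewrite !inE eqxx.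
apply/setUP; right; apply: imset_f; rewrite inE imset_f //= wit_lca // mz ne.
by move: zy; rewrite /= /tgt; case: (side _).
Qed.

End Cases.

End TreeOrder.

(* [Some (Some false)] stands for left, [Some (Some true)] for right,
   [Some None] for here and [None] for up. *)
Definition direction := option (option bool).

(** * Directions and ancestors in a binary tree *)

Section Directions.
Variable X : eqType.
Implicit Types (b l r : btree X) (x y z : X).

Definition dir b z x : direction :=
  if z == x then Some None
  else if leftof b z x then Some (Some false)
  else if rightof b z x then Some (Some true) else None.

Definition below b z x := x \in bnodes (subtree b z).

(** Lists the nodes not below [z] in such an order that a step down only appends; columns can then
    be ordered by first occurrence along a whole branch. *)
Fixpoint outside b (acc : seq X) z : seq X :=
  if b is Node x l r then
    if x == z then acc
    else if z \in bnodes l then outside l (acc ++ x :: bnodes r) z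
    else outside r (acc ++ x :: bnodes l) z
  else acc.

Lemma below_mem b z x : below b z x -> z \in bnodes b /\ x \in bnodes b.
Proof.
move=> zx; split; last exact: subtree_sub zx.
move: zx; rewrite /below; elim: b => //= y l IHl r IHr.
by rewrite inE mem_cat eq_sym; case: eqP => //= _; case: ifP => //= _ /IHr.
Qed.

Lemma belowE b z x : uniq (bnodes b) -> z \in bnodes b ->
  below b z x = [|| z == x, leftof b z x | rightof b z x].
Proof.
move=> ub zb; rewrite leftofE // rightofE // /below (subtree_mem zb).
by rewrite mem_bnodes eq_sym.
Qed.

Lemma dir_up b z x : uniq (bnodes b) -> z \in bnodes b ->
  (dir b z x == None) = ~~ below b z x.
Proof.
by move=> ub zb; rewrite belowE // /dir; do 3?case: ifP.
Qed.

Lemma dir_here b z x : (dir b z x == Some None) = (z == x).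
Proof. by rewrite /dir; case: ifP => // _; do 2?case: ifP. Qed.

Lemma below_refl b x : x \in bnodes b -> below b x x.
Proof. by move=> xb; rewrite /below (subtree_mem xb) mem_bnodes eqxx. Qed.

Lemma below_trans b y x z : uniq (bnodes b) -> below b x y -> below b y z ->
  below b x z.
Proof.
move=> ub xy yz; move: yz; rewrite /below (subtree_trans ub xy); exact: subtree_sub.
Qed.

Lemma below_chain b x y z : uniq (bnodes b) -> below b x z -> below b y z ->
  below b x y || below b y x.
Proof.
elim: b => // w l IHl r IHr ub xz yz.
have [xb zb] := below_mem xz; have [yb _] := below_mem yz.
move: (ub); rewrite uniq_bnodes => /and5P[wl wr ul ur lr].
move: xz yz; rewrite /below /=.
have [e _ | nx] := eqVneq w x; first by move: yb => /= ->.
have [e _ _ | ny] := eqVneq w y; first by move: xb => /= ->; rewrite orbT.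
case: ifP => xl; case: ifP => yl.
- exact: IHl.
- by move/subtree_sub => zl /subtree_sub; rewrite (disjoint_children ub zl).
- by move/subtree_sub => zr /subtree_sub/(disjoint_children ub); rewrite zr.
- exact: IHr.
Qed.

Lemma below_index b x y : uniq (bnodes b) -> below b x y -> x != y ->
  index x (bnodes b) < index y (bnodes b).
Proof.
elim: b => // w l IHl r IHr ub xy ne.
move: (ub); rewrite uniq_bnodes => /and5P[wl wr ul ur lr].
move: xy; rewrite /below /=; have [e _ | nx] := eqVneq w x.
  by rewrite -e in ne; rewrite (negbTE ne).
case: ifP => xl xy.
  have yl := subtree_sub xy.
  have -> : (w == y) = false by apply/eqP => e; rewrite -e (negbTE wl) in yl.
  by rewrite !index_cat xl yl ltnS; apply: IHl.
have yr := subtree_sub xy.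
have -> : (w == y) = false by apply/eqP => e; rewrite -e (negbTE wr) in yr.
rewrite !index_cat xl; case: ifP => yl; first by rewrite (disjoint_children ub yl) in yr.
by rewrite ltnS ltn_add2l; apply: IHr.
Qed.

Lemma subtree_children b z : uniq (bnodes b) -> z \in bnodes b ->
  {in bnodes (lchild (subtree b z)), forall w, subtree b w = subtree (lchild (subtree b z)) w} /\
  {in bnodes (rchild (subtree b z)), forall w, subtree b w = subtree (rchild (subtree b z)) w}.
Proof.
move=> ub zb; have us := subtree_uniq z ub.
have E := subtree_mem zb; rewrite E in us.
have := us; rewrite uniq_bnodes => /and5P[zl zr _ _ _].
split=> w wc.
  have ws : w \in bnodes (subtree b z) by rewrite E mem_bnodes wc orbT.
  have -> := subtree_trans ub ws; rewrite [X in subtree X w]E /= wc.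
  by case: eqP => // e; rewrite {1}e wc in zl.
have ws : w \in bnodes (subtree b z) by rewrite E mem_bnodes wc !orbT.
have -> := subtree_trans ub ws; rewrite [X in subtree X w]E /=; case: eqP => [e | _]; first by rewrite {1}e wc in zr.
by case: ifP => // /(disjoint_children us); rewrite wc.
Qed.

Lemma dir_left b z x : uniq (bnodes b) -> z \in bnodes b ->
  (dir b z x == Some (Some false)) = (x \in bnodes (lchild (subtree b z))).
Proof.
move=> ub zb; have us := subtree_uniq z ub; rewrite (subtree_mem zb) in us.
have := us; rewrite uniq_bnodes => /and5P[zl zr _ _ _].
rewrite /dir leftofE //; have [<- | _] := eqVneq z x; first by rewrite (negbTE zl).
by case: ifP => // _; case: ifP.
Qed.

Lemma dir_right b z x : uniq (bnodes b) -> z \in bnodes b ->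
  (dir b z x == Some (Some true)) = (x \in bnodes (rchild (subtree b z))).
Proof.
move=> ub zb; have us := subtree_uniq z ub; rewrite (subtree_mem zb) in us.
have := us; rewrite uniq_bnodes => /and5P[zl zr _ _ _].
rewrite /dir leftofE // rightofE //; have [<- | _] := eqVneq z x; first by rewrite (negbTE zr).
case: ifP => xl; last by case: ifP.
by rewrite (disjoint_children us xl).
Qed.

Lemma dir_anc b z w x : uniq (bnodes b) -> below b z w -> w != z -> below b w x ->
  dir b z x = dir b z w.
Proof.
move=> ub zw wz wx; have [zb wb] := below_mem zw.
have [sl sr] := subtree_children ub zb.
have [/eqP e | nl] := boolP (dir b z w == Some (Some false)).
  have wl : w \in bnodes (lchild (subtree b z)) by rewrite -dir_left // e.
  rewrite e; apply/eqP; rewrite dir_left //.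
  by move: wx; rewrite /below sl // => /subtree_sub.
have [/eqP e | nr] := boolP (dir b z w == Some (Some true)).
  have wr : w \in bnodes (rchild (subtree b z)) by rewrite -dir_right // e.
  rewrite e; apply/eqP; rewrite dir_right //.
  by move: wx; rewrite /below sr // => /subtree_sub.
have := dir_here b z w; rewrite [z == w]eq_sym (negbTE wz).
have := dir_up w ub zb; rewrite zw.
by case: (dir b z w) nl nr => [[[]|]|].
Qed.

(** The child of [z] on the side [s] lies above both nodes. *)
Lemma dir_common b z x y s : uniq (bnodes b) -> z \in bnodes b ->
  dir b z x = Some (Some s) -> dir b z y = Some (Some s) ->
  exists w, [/\ below b z w, w != z, below b w x & below b w y].
Proof.
move=> ub zb /eqP dx /eqP dy; have us := subtree_uniq z ub.
have E := subtree_mem zb; rewrite E in us.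
have := us; rewrite uniq_bnodes => /and5P[zl zr _ _ _].
have [sl sr] := subtree_children ub zb.
case: s dx dy; rewrite ?dir_left ?dir_right //.
  case: (rchild _) zr sr E => // w l r zr sr E xw yw.
  have ww : w \in bnodes (Node w l r) by rewrite mem_bnodes eqxx.
  have sw : subtree b w = Node w l r by rewrite (sr _ ww) /= eqxx.
  exists w; rewrite /below sw; split=> //; first by rewrite E mem_bnodes ww !orbT.
  by apply: contraNneq zr => <-.
case: (lchild _) zl sl E => // w l r zl sl E xw yw.
have ww : w \in bnodes (Node w l r) by rewrite mem_bnodes eqxx.
have sw : subtree b w = Node w l r by rewrite (sl _ ww) /= eqxx.
exists w; rewrite /below sw; split=> //; first by rewrite E mem_bnodes ww !orbT.
by apply: contraNneq zl => <-.
Qed.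

Lemma mem_outside b acc z v : uniq (bnodes b) -> z \in bnodes b ->
  (v \in outside b acc z) = (v \in acc) || (v \in bnodes b) && ~~ below b z v.
Proof.
elim: b acc => // x l IHl r IHr acc ub; have := ub; rewrite uniq_bnodes.
case/and5P => xl xr ul ur lr; rewrite mem_bnodes /below /= eq_sym.
have [-> _ | ne] := eqVneq x z; first by rewrite andbN orbF.
rewrite /=; case: ifP => zl /= zr.
  rewrite IHl // mem_cat inE -!orbA; congr (_ || _); rewrite /below mem_bnodes.
  case vs : (v \in bnodes (subtree l z)).
    have vl := subtree_sub vs; rewrite (disjoint_children ub vl) !andbF !orbF.
    by apply/eqP => e; rewrite -e vl in xl.
  by rewrite !andbT; case: (v == x); case: (v \in bnodes l); case: (v \in bnodes r).
rewrite IHr // mem_cat inE -!orbA; congr (_ || _); rewrite /below mem_bnodes.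
case vs : (v \in bnodes (subtree r z)).
  have vr := subtree_sub vs; rewrite !andbF !orbF.
  have -> : (v \in bnodes l) = false.
    by apply/negP => /(disjoint_children ub); rewrite vr.
  by rewrite orbF; apply/eqP => e; rewrite -e vr in xr.
by rewrite !andbT; case: (v == x); case: (v \in bnodes l); case: (v \in bnodes r).
Qed.

Lemma prefix_acc b acc z : prefix acc (outside b acc z).
Proof.
elim: b acc => [|x l IHl r IHr] acc /=; first exact: prefix_refl.
case: ifP => _; first exact: prefix_refl.
by case: ifP => _; [apply: prefix_trans (IHl _) | apply: prefix_trans (IHr _)];
  apply: prefix_prefix.
Qed.

Lemma prefix_outside b acc z z' : uniq (bnodes b) -> below b z z' ->
  prefix (outside b acc z) (outside b acc z').
Proof.
elim: b acc => // x l IHl r IHr acc ub; have := ub; rewrite uniq_bnodes.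
case/and5P => xl xr ul ur lr; rewrite /below /=.
have [-> _ | ne] := eqVneq x z.
  exact: (prefix_acc (Node z l r) acc z').
case: ifP => zl zz'.
  have zl' := subtree_sub zz'; rewrite zl'.
  have -> : (x == z') = false by apply/eqP => e; rewrite e zl' in xl.
  exact: IHl.
have zr' := subtree_sub zz'.
have -> : (x == z') = false by apply/eqP => e; rewrite e zr' in xr.
have -> : (z' \in bnodes l) = false.
  by apply/negP => /(disjoint_children ub); rewrite zr'.
exact: IHr.
Qed.

End Directions.

(** * Decomposition at the median *)

Section Contexts.
Variables (A : Type) (M : automaton A) (X : eqType).
Implicit Types (f g : X -> A) (b l r : btree X) (z : X).

(** The tree with a hole at [z]; [q] stands for the state of what fills it. *)
Fixpoint context f b z (q : state M) : state M :=
  if b is Node x l r then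
    if x == z then q
    else if z \in bnodes l then step (f x) (context f l z q) (run M f r)
    else step (f x) (run M f l) (context f r z q)
  else leaf_state M.

Lemma run_context f b z : z \in bnodes b ->
  run M f b = context f b z (run M f (subtree b z)).
Proof.
elim: b => //= x l IHl r IHr; rewrite inE mem_cat eq_sym.
case: eqP => //= _; case: ifP => [zl _ | zl /= zr]; rewrite zl.
  by rewrite -IHl.
by rewrite -IHr.
Qed.

Lemma eq_context f g b z q : uniq (bnodes b) -> z \in bnodes b ->
  {in bnodes b, forall x, ~~ below b z x -> f x = g x} ->
  context f b z q = context g b z q.
Proof.
elim: b => // x l IHl r IHr ub; have := ub; rewrite uniq_bnodes.
case/and5P => xl xr ul ur lr; rewrite mem_bnodes /below /= eq_sym.
case: eqP => //= _; case: ifP => [zl _ | zl /= zr] fg.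
  rewrite fg ?inE ?eqxx //; last by apply: contra xl => /subtree_sub.
  rewrite (IHl ul zl) => [|y yl ny]; last first.
    by apply: fg => //; rewrite inE mem_cat yl orbT.
  congr (step _ _ _); apply: eq_run => y yr; apply: fg.
    by rewrite inE mem_cat yr !orbT.
  by apply/negP => /subtree_sub /(disjoint_children ub); rewrite yr.
rewrite fg ?inE ?eqxx //; last by apply: contra xr => /subtree_sub.
rewrite (IHr ur zr) => [|y yr ny]; last first.
  by apply: fg => //; rewrite inE mem_cat yr !orbT.
congr (step _ _ _); apply: eq_run => y yl; apply: fg.
  by rewrite inE mem_cat yl !orbT.
by apply/negP => /subtree_sub; rewrite (disjoint_children ub yl).
Qed.

Lemma context_trans f b z z' q : uniq (bnodes b) -> below b z z' ->
  context f b z' q = context f b z (context f (subtree b z) z' q).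
Proof.
elim: b => // x l IHl r IHr ub; have := ub; rewrite uniq_bnodes.
case/and5P => xl xr ul ur lr; rewrite /below /=.
have [-> // | ne] := eqVneq x z.
case: ifP => zl zz'.
  have zl' := subtree_sub zz'; rewrite zl'.
  have -> : (x == z') = false by apply/eqP => e; rewrite e zl' in xl.
  by rewrite -IHl.
have zr' := subtree_sub zz'.
have -> : (x == z') = false by apply/eqP => e; rewrite e zr' in xr.
have -> : (z' \in bnodes l) = false.
  by apply/negP => /(disjoint_children ub); rewrite zr'.
by rewrite -IHr.
Qed.

End Contexts.
Arguments context {A} M {X} f b z q.

Section NodeOrder.
Variable T : shape.

Definition ndir (z x : node T) : direction := dir (enc T) z x.
Definition nanc : rel (node T) := below (enc T).
Definition nidx (x : node T) := index x (bnodes (enc T)).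
Definition nroot : node T := node_at T [::].
Definition nout (z : node T) := outside (enc T) [::] z.

Lemma nanc_refl : reflexive nanc.
Proof. by move=> x; apply/below_refl/mem_enc. Qed.

Lemma nanc_trans : transitive nanc.
Proof. by move=> y x z; apply: below_trans; apply: enc_uniq. Qed.

Lemma nanc_chain x y z : nanc x z -> nanc y z -> nanc x y || nanc y x.
Proof. by apply: below_chain; apply: enc_uniq. Qed.

Lemma nidx_anc x y : nanc x y -> x != y -> nidx x < nidx y.
Proof. by apply: below_index; apply: enc_uniq. Qed.

Lemma nanc_root x : nanc nroot x.
Proof.
have := mem_enc x; rewrite /nanc /below /enc encodeE /=.
by case: eqP.
Qed.

Lemma mem_nout z v : (v \in nout z) = ~~ nanc z v.
Proof. by rewrite mem_outside ?enc_uniq ?mem_enc. Qed.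

Lemma prefix_nout z z' : nanc z z' -> prefix (nout z) (nout z').
Proof. by apply: prefix_outside; apply: enc_uniq. Qed.

Lemma ndir_up z x : (ndir z x == None) = ~~ nanc z x.
Proof. by apply: dir_up; rewrite ?enc_uniq ?mem_enc. Qed.

Lemma ndir_here z x : (ndir z x == Some None) = (z == x).
Proof. exact: dir_here. Qed.

Lemma ndir_anc z w x : nanc z w -> w != z -> nanc w x -> ndir z x = ndir z w.
Proof. by apply: dir_anc; apply: enc_uniq. Qed.

Lemma ndir_common z x y b :
  ndir z x = Some (Some b) -> ndir z y = Some (Some b) ->
  exists w, [/\ nanc z w, w != z, nanc w x & nanc w y].
Proof. by apply: dir_common; rewrite ?enc_uniq ?mem_enc. Qed.

Lemma ndir_left z x :
  (ndir z x == Some (Some false)) = (x \in bnodes (lchild (subtree (enc T) z))).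
Proof. by apply: dir_left; rewrite ?enc_uniq ?mem_enc. Qed.

Lemma ndir_right z x :
  (ndir z x == Some (Some true)) = (x \in bnodes (rchild (subtree (enc T) z))).
Proof. by apply: dir_right; rewrite ?enc_uniq ?mem_enc. Qed.

Definition npoints := points nanc ndir.

End NodeOrder.
Arguments nroot {T}.

(** * Rows and columns of marked trees *)

Section Summaries.
Variables (B : Type) (M : automaton B) (T : shape).
Implicit Types (h : node T -> B) (m z : node T).

Definition left_run h m := run M h (lchild (subtree (enc T) m)).
Definition right_run h m := run M h (rchild (subtree (enc T) m)).
Definition above_run h m : {ffun state M -> state M} :=
  [ffun q => context M h (enc T) m q].

Lemma run_at h m :
  run M h (enc T) = above_run h m (step (h m) (left_run h m) (right_run h m)).
Proof.
by rewrite ffunE (run_context _ _ (mem_enc m)) {1}(subtree_mem (mem_enc m)).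
Qed.

Lemma eq_left_run h h' m :
  (forall z, ndir m z = Some (Some false) -> h z = h' z) ->
  left_run h m = left_run h' m.
Proof. by move=> e; apply: eq_run => z zl; apply/e/eqP; rewrite ndir_left. Qed.

Lemma eq_right_run h h' m :
  (forall z, ndir m z = Some (Some true) -> h z = h' z) ->
  right_run h m = right_run h' m.
Proof. by move=> e; apply: eq_run => z zl; apply/e/eqP; rewrite ndir_right. Qed.

Lemma eq_above_run h h' m :
  (forall z, ndir m z = None -> h z = h' z) ->
  above_run h m = above_run h' m.
Proof.
move=> e; apply/ffunP => q; rewrite !ffunE; apply: eq_context.
- exact: enc_uniq.
- exact: mem_enc.
- by move=> z _ nz; apply/e/eqP; rewrite ndir_up.
Qed.

Section Marks.
Variables (h : node T -> node T -> B) (h0 : node T -> B).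
Hypothesis h_off : forall u z, z != u -> h u z = h0 z.

(** The direction is included because it tells whether [z] itself carries the mark and, if not,
    which child run contains it. *)
Definition row z u := (ndir z u, (left_run (h u) z, right_run (h u) z)).
Definition column z v := above_run (h v) z.

Lemma sub_context m' m u :
  nanc m' m -> m != m' -> nanc m u ->
  exists2 b, uniq (bnodes b) /\ m \in bnodes b &
   [/\ subtree b m = subtree (enc T) m,
       b = lchild (subtree (enc T) m') /\ ndir m' u = Some (Some false)
       \/ b = rchild (subtree (enc T) m') /\ ndir m' u = Some (Some true)
     & ndir m' u = ndir m' m].
Proof.
move=> m'm ne mu; have [sl sr] := subtree_children (enc_uniq T) (mem_enc m').
have us := subtree_uniq m' (enc_uniq T); rewrite (subtree_mem (mem_enc m')) in us.
have := us; rewrite uniq_bnodes => /and5P[_ _ ul ur _].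
have e := ndir_anc m'm ne mu.
have [/eqP ml | nl] := boolP (ndir m' m == Some (Some false)).
  have mb : m \in bnodes (lchild (subtree (enc T) m')) by rewrite -ndir_left ml.
  exists (lchild (subtree (enc T) m')) => //; split=> //; first by rewrite (sl _ mb).
  by left; rewrite e.
have [/eqP mr | nr] := boolP (ndir m' m == Some (Some true)).
  have mb : m \in bnodes (rchild (subtree (enc T) m')) by rewrite -ndir_right mr.
  exists (rchild (subtree (enc T) m')) => //; split=> //; first by rewrite (sr _ mb).
  by right; rewrite e.
have := ndir_here m' m; rewrite [m' == m]eq_sym (negbTE ne).
have := ndir_up m' m; rewrite m'm.
by case: (ndir m' m) nl nr => [[[]|]|].
Qed.

(** Equal rows give equal runs on the subtree at [m], and the mark is nowhere else; so the child of
    [m'] that contains [m] runs alike, and the other child is unmarked. *)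
Lemma row_merge m m' u u' :
  nanc m' m -> nanc m u -> nanc m u' -> row m u = row m u' -> row m' u = row m' u'.
Proof.
have [-> // | ne m'm mu mu'] := eqVneq m m'.
move=> [ed el er].
have hm : h u m = h u' m.
  have : (m == u) = (m == u') by rewrite -!ndir_here ed.
  have [-> | nu] := eqVneq m u; first by move=> /esym/eqP ->.
  by move=> /esym nu'; rewrite !h_off // nu'.
have rsub : run M (h u) (subtree (enc T) m) = run M (h u') (subtree (enc T) m).
  rewrite (subtree_mem (mem_enc m)) /=.
  by move: el er; rewrite /left_run /right_run hm => -> ->.
have e : ndir m' u = ndir m' u' by rewrite !(ndir_anc m'm ne).
have [b [ub mb] [sb bE _]] := sub_context m'm ne mu.
have rb : run M (h u) b = run M (h u') b.
  rewrite !(run_context _ _ mb) sb rsub; apply: eq_context => // z _.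
  rewrite /below sb => nz; rewrite !h_off //; apply: contraNneq nz => ->.
    exact: mu'.
  exact: mu.
rewrite /row -e; congr (_, (_, _)).
  case: bE => -[bE d]; first by rewrite /left_run -bE.
  apply: eq_left_run => z dz; rewrite !h_off //; apply/eqP => zu.
    by rewrite zu -e d in dz.
  by rewrite zu d in dz.
case: bE => -[bE d]; last by rewrite /right_run -bE.
apply: eq_right_run => z dz; rewrite !h_off //; apply/eqP => zu.
  by rewrite zu -e d in dz.
by rewrite zu d in dz.
Qed.

(** The context at [m'] is the one at [m] composed with the part in between, which is unmarked since
    [v] and [v'] are not below [m]. *)
Lemma column_merge m m' v v' :
  nanc m m' -> ~~ nanc m v -> ~~ nanc m v' -> column m v = column m v' ->
  column m' v = column m' v'.
Proof.
move=> mm' nv nv' /ffunP e; apply/ffunP => q; rewrite !ffunE.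
have ct g q' := @context_trans _ M _ g _ _ _ q' (enc_uniq T) mm'.
rewrite !ct.
have -> : context M (h v) (subtree (enc T) m) m' q =
          context M (h v') (subtree (enc T) m) m' q.
  apply: eq_context => //; first exact/subtree_uniq/enc_uniq.
  move=> z zm _; rewrite !h_off //.
    by apply: contraNneq nv' => <-.
  by apply: contraNneq nv => <-.
by have := e (context M (h v') (subtree (enc T) m) m' q); rewrite !ffunE.
Qed.

Lemma row_above_run m u u' : nanc m u -> nanc m u' ->
  above_run (h u) m = above_run (h u') m.
Proof.
move=> mu mu'; apply: eq_above_run => z /eqP; rewrite ndir_up => nz.
by rewrite !h_off //; apply: contraNneq nz => ->.
Qed.

Lemma column_children_run m v v' : ~~ nanc m v -> ~~ nanc m v' ->
  left_run (h v) m = left_run (h v') m /\ right_run (h v) m = right_run (h v') m.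
Proof.
move=> nv nv'; have off b z : ndir m z = Some (Some b) -> h v z = h v' z.
  move=> dz; have mz : nanc m z by apply/negPn; rewrite -ndir_up dz.
  by rewrite !h_off //; [apply: contraNneq nv' => <- | apply: contraNneq nv => <-].
by split; [apply: eq_left_run | apply: eq_right_run] => z /off.
Qed.

End Marks.
End Summaries.

Section Decomposition.
Variables (A : finType) (M : automaton (A * (bool * bool * bool))).

Definition summary : finType := (state M * state M * {ffun state M -> state M})%type.

(* How [x], [y1] and [y2] (see [chi], [alpha], [beta]) look from their median
   [m]: the direction of each and the behaviour around [m] when only it is
   marked, then the behaviour without marks and the letter of [m].  As the three
   directions differ, each part around [m] contains at most one of the marks. *)
Definition decomposition : finType :=
  ((direction * summary) * (direction * summary) * (direction * summary)
   * (summary * A))%type.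

Implicit Type th : decomposition.
Definition dx th := th.1.1.1.1.
Definition d1 th := th.1.1.2.1.
Definition d2 th := th.1.2.1.
Definition sx th := th.1.1.1.2.
Definition s1 th := th.1.1.2.2.
Definition s2 th := th.1.2.2.
Definition s0 th := th.2.1.
Definition letter th := th.2.2.

(** This is [onpath] in terms of directions, by [onpath_dir]; required for all three pairs, it makes
    the node their median. *)
Definition compatible (d d' : direction) := (d != d') || (d == Some None).

Definition part th d : summary :=
  if dx th == d then sx th else if d1 th == d then s1 th
  else if d2 th == d then s2 th else s0 th.

Definition valid th : bool :=
  [&& compatible (dx th) (d1 th), compatible (dx th) (d2 th),
      compatible (d1 th) (d2 th)
    & final ((part th None).2
        (step (letter th, (dx th == Some None, d1 th == Some None, d2 th == Some None))
           (part th (Some (Some false))).1.1 (part th (Some (Some true))).1.2))].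

Section Marked.
Variables (T : shape) (f : node T -> A).
Implicit Types (m x y z : node T).

Definition mark3 x y1 y2 z := (f z, (x == z, y1 == z, y2 == z)).
Definition markx x z := (f z, (x == z, false, false)).
Definition mark1 y z := (f z, (false, y == z, false)).
Definition mark2 y z := (f z, (false, false, y == z)).
Definition mark0 z := (f z, (false, false, false)).

Definition summarize (h : node T -> A * (bool * bool * bool)) (m : node T) : summary :=
  (left_run M h m, right_run M h m, above_run M h m).

(** What concerns [m] alone, its letter and its unmarked summary, is charged to [chi]; each of the
    other two predicates speaks of its own marked node. *)
Definition chi th m x :=
  [&& valid th, ndir m x == dx th, summarize (markx x) m == sx th,
      summarize mark0 m == s0 th & f m == letter th].
Definition alpha th m y :=
  [&& valid th, ndir m y == d1 th & summarize (mark1 y) m == s1 th].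
Definition beta th m y :=
  [&& valid th, ndir m y == d2 th & summarize (mark2 y) m == s2 th].

Lemma run_parts th m (x y1 y2 : node T) :
  compatible (dx th) (d1 th) -> compatible (dx th) (d2 th) ->
  compatible (d1 th) (d2 th) ->
  ndir m x = dx th -> ndir m y1 = d1 th -> ndir m y2 = d2 th ->
  summarize (markx x) m = sx th -> summarize (mark1 y1) m = s1 th ->
  summarize (mark2 y2) m = s2 th -> summarize mark0 m = s0 th ->
  f m = letter th ->
  accepts M (mark3 x y1 y2) (enc T) =
  final ((part th None).2
        (step (letter th, (dx th == Some None, d1 th == Some None, d2 th == Some None))
           (part th (Some (Some false))).1.1 (part th (Some (Some true))).1.2)).
Proof.
move=> c01 c02 c12 ex e1 e2 rx r1 r2 r0 ea.
pose h d := if dx th == d then markx x else if d1 th == d then mark1 y1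
            else if d2 th == d then mark2 y2 else mark0.
(* Away from [m], each direction holds at most one of the three nodes, so the triple marking agrees
   there with a single mark or with none. *)
have hE d z : d != Some None -> ndir m z = d -> mark3 x y1 y2 z = h d z.
  move=> nd dz; rewrite /h /mark3.
  have neq w d' : ndir m w = d' -> (d' == d) = false -> (w == z) = false.
    by move=> wd nd'; apply/eqP => wz; rewrite -wd wz dz eqxx in nd'.
  have [exd | nxd] := eqVneq (dx th) d.
    move: c01 c02; rewrite /compatible exd (negbTE nd) !orbF ![d == _]eq_sym.
    by move=> /negbTE/(neq _ _ e1) -> /negbTE/(neq _ _ e2) ->.
  rewrite (neq _ _ ex (negbTE nxd)); have [e1d | n1d] := eqVneq (d1 th) d.
    move: c12; rewrite /compatible e1d (negbTE nd) orbF [d == _]eq_sym.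
    by move=> /negbTE/(neq _ _ e2) ->.
  rewrite (neq _ _ e1 (negbTE n1d)); have [e2d | n2d] := eqVneq (d2 th) d => //.
  by rewrite (neq _ _ e2 (negbTE n2d)).
have partE d : part th d = summarize (h d) m.
  by rewrite /part /h; do 3?case: ifP.
rewrite /accepts (run_at _ _ m) !partE /= -ea -ex -e1 -e2 !ndir_here.
rewrite /mark3 ![m == _]eq_sym.
rewrite (@eq_left_run _ _ _ _ (h (Some (Some false)))); last first.
  by move=> z dz; rewrite -hE.
rewrite (@eq_right_run _ _ _ _ (h (Some (Some true)))); last first.
  by move=> z dz; rewrite -hE.
rewrite (@eq_above_run _ _ _ _ (h None)) // => z dz.
by rewrite -hE.
Qed.

Lemma decomposeP (x y1 y2 : node T) :
  reflect (exists m th, [/\ chi th m x, alpha th m y1 & beta th m y2])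
          (accepts M (mark3 x y1 y2) (enc T)).
Proof.
apply: (iffP idP) => [acc | [m [th]]]; last first.
  case=> /and5P[v /eqP ex /eqP rx /eqP r0 /eqP ea] /and3P[_ /eqP e1 /eqP r1].
  case/and3P=> _ /eqP e2 /eqP r2; have /and4P[c01 c02 c12 acc] := v.
  by rewrite (@run_parts th m).
have [m [m1 m2 m3]] := median (@nanc_refl T) (@nanc_trans T) (@nanc_chain T)
  (@nidx_anc T) (@nanc_root T) x y1 y2.
have compat u v : onpath (@nanc T) m u v -> compatible (ndir m u) (ndir m v).
  by rewrite (onpath_dir (@ndir_up T) (@ndir_here T) (@ndir_anc T) (@ndir_common T)).
pose th : decomposition :=
  ((ndir m x, summarize (markx x) m), (ndir m y1, summarize (mark1 y1) m),
   (ndir m y2, summarize (mark2 y2) m), (summarize mark0 m, f m)).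
have v : valid th.
  by rewrite /valid -(@run_parts th m x y1 y2) ?acc ?compat.
by exists m, th; split; rewrite /chi /alpha /beta v /= !eqxx.
Qed.

End Marked.

Section Guidance.
Variables (T : shape) (E : rel (node T)).
Let B := (A * (bool * bool * bool))%type.

(** Common form of [alpha] and [beta], so that one statement also serves with their roles
    exchanged. *)
Definition located (h : node T -> node T -> B) v d s m y :=
  [&& v, ndir m y == d & summarize (h y) m == s].

Let row_type : finType := (direction * (state M * state M))%type.
Let column_type : finType := {ffun state M -> state M}.

Lemma guidable_located_vertical (h h' : node T -> node T -> B) (h0 h0' : node T -> B)
    v d s s' :
  (forall u z, z != u -> h u z = h0 z) -> (forall u z, z != u -> h' u z = h0' z) ->
  d != None ->
  guidable (@nanc T) (vertical_bound row_type column_type)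
    (witnessed E (located h v d s) (located h' v None s'))
    (target_ok E (located h v d s) (located h' v None s')).
Proof.
move=> off off' nd.
apply: (guidable_down_up (@nanc_refl T) (@nanc_trans T) (@nanc_chain T) (@nidx_anc T)
  (@nanc_root T) (@mem_nout T) (@prefix_nout T) (row_merge (M := M) off)
  (column_merge (M := M) off')).
- by move=> m u /and3P[_ /eqP e _]; apply/negPn; rewrite -ndir_up e.
- by move=> m u /and3P[_ /eqP e _]; rewrite -ndir_up e.
- move=> m u u' /and3P[v' /eqP e /eqP sm] mu' [ed el er].
  have mu : nanc m u by apply/negPn; rewrite -ndir_up e.
  rewrite /located v' -ed e eqxx -sm /summarize el er.
  by rewrite (row_above_run M off mu mu') eqxx.
- move=> m u u' /and3P[v' e /eqP sm] nu' ec.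
  have nu : ~~ nanc m u by rewrite -ndir_up.
  rewrite /located v' ndir_up nu' -sm /summarize.
  have [-> ->] := column_children_run M off' nu nu'.
  by rewrite /column in ec; rewrite ec eqxx.
Qed.

End Guidance.

Definition guidance_bound : nat :=
  vertical_bound (direction * (state M * state M))%type {ffun state M -> state M} + 2.

(** By the directions of [y1] and [y2] from [m]: one of them is [m], or exactly one is not below
    [m], or they lie on different sides. Equal directions away from [m] contradict [valid], so
    nothing is witnessed. The summand 2 in [guidance_bound] covers the cases outside the vertical
    one. *)
Lemma guidance (T : shape) (f : node T -> A) (E : rel (node T)) th :
  guidable (@nanc T) guidance_bound (witnessed E (alpha f th) (beta f th))
           (target_ok E (alpha f th) (beta f th)).
Proof.
have off1 u z : z != u -> mark1 f u z = mark0 f z.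
  by rewrite /mark1 eq_sym => /negbTE ->.
have off2 u z : z != u -> mark2 f u z = mark0 f z.
  by rewrite /mark2 eq_sym => /negbTE ->.
have sub k (al be : rel (node T)) : k <= guidance_bound ->
    guidable (@nanc T) k (witnessed E al be) (target_ok E al be) ->
    guidable (@nanc T) guidance_bound (witnessed E al be) (target_ok E al be).
  by move=> lek; apply: guidable_sub.
have here d al : (forall m y, al m y -> ndir m y == d) -> d = Some None ->
    forall m u : node T, al m u -> u = m.
  by move=> h e m u /h; rewrite e ndir_here => /eqP.
have al_dir m y : alpha f th m y -> ndir m y == d1 th by case/and3P.
have be_dir m y : beta f th m y -> ndir m y == d2 th by case/and3P.
have [e1 | n1] := eqVneq (d1 th) (Some None).
  apply: (@sub 1); first by rewrite /guidance_bound addn2.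
  by apply: guidable_here (@nanc_refl T) (@nidx_anc T) _ _ _ _; apply: here al_dir e1.
have [e2 | n2] := eqVneq (d2 th) (Some None).
  apply: (@sub 1); first by rewrite /guidance_bound addn2.
  apply: guidable_swap.
  by apply: guidable_here (@nanc_refl T) (@nidx_anc T) _ _ _ _; apply: here be_dir e2.
have [u1 | nu1] := eqVneq (d1 th) None; have [u2 | nu2] := eqVneq (d2 th) None.
- have -> : witnessed E (alpha f th) (beta f th) = set0.
    apply/setP => m; rewrite !inE; apply/existsP => -[u /existsP[v /and3P[_ a _]]].
    case/and3P: a => /and4P[_ _ + _] _ _.
    by rewrite /compatible u1 u2.
  exists (fun m => (m, true)) => [m | z]; first by rewrite inE.
  rewrite (_ : crossing _ _ _ _ = set0) ?cards0 //.
  by apply/setP => t; rewrite [RHS]inE; apply/imsetP => -[m]; rewrite !inE.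
- apply: sub (leq_addr _ _) _; apply: guidable_swap.
  have := @guidable_located_vertical T (fun u v => E v u) _ _ _ _ (valid th) (d2 th)
    (s2 th) (s1 th) off2 off1 nu2.
  have -> // : located (mark1 f) (valid th) None (s1 th)
       = located (mark1 f) (valid th) (d1 th) (s1 th) by rewrite u1.
- apply: sub (leq_addr _ _) _.
  have := @guidable_located_vertical T E _ _ _ _ (valid th) (d1 th)
    (s1 th) (s2 th) off1 off2 nu1.
  have -> // : located (mark2 f) (valid th) None (s2 th)
       = located (mark2 f) (valid th) (d2 th) (s2 th) by rewrite u2.
have [s e1] : exists s, d1 th = Some (Some s).
  by case: (d1 th) n1 nu1 => [[s|]|] // _ _; exists s.
have [s' e2] : exists s, d2 th = Some (Some s).
  by case: (d2 th) n2 nu2 => [[s'|]|] // _ _; exists s'.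
have [ss | nss] := eqVneq s s'.
  have -> : witnessed E (alpha f th) (beta f th) = set0.
    apply/setP => m; rewrite !inE; apply/existsP => -[u /existsP[v /and3P[_ a _]]].
    case/and3P: a => /and4P[_ _ + _] _ _.
    by rewrite /compatible e1 e2 ss eqxx.
  exists (fun m => (m, true)) => [m | z]; first by rewrite inE.
  rewrite (_ : crossing _ _ _ _ = set0) ?cards0 //.
  by apply/setP => t; rewrite [RHS]inE; apply/imsetP => -[m]; rewrite !inE.
apply: (@sub 2); first by rewrite /guidance_bound leq_addl.
apply: (guidable_sides (@nanc_refl T) (@nanc_trans T) (@nanc_chain T) (@nidx_anc T)
  (@nanc_root T) (@ndir_up T) (@ndir_here T) (@ndir_anc T) (@ndir_common T) E (s := s) _ _).
  by move=> m u /al_dir/eqP ->.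
move=> m u /be_dir/eqP ->; rewrite e2; congr (Some (Some _)).
by case: s s' nss {e1 e2} => -[].
Qed.

Lemma pointers (T : shape) (f : node T -> A) (E : rel (node T)) th :
  exists (ptr : node T -> option ('I_guidance_bound.+1 * bool))
         (lab : 'I_guidance_bound.+1 -> node T -> option direction),
    {in witnessed E (alpha f th) (beta f th), forall m, ptr m != None} /\
    forall m a side, ptr m = Some (a, side) ->
      exists2 y, target_ok E (alpha f th) (beta f th) m (y, side) &
        forall y', npoints (lab a) m y' = (y' == y).
Proof.
exact: (guidable_points (@nanc_refl T) (@nanc_trans T) (@nanc_chain T) (@nidx_anc T)
  (@nanc_root T) (@ndir_up T) (@ndir_here T) (@ndir_anc T) (@ndir_common T)
  (guidance f E th)).
Qed.

End Decomposition.

(** * Recognizable properties *)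

(* Properties of labelled shapes with node variables indexed by [nat], only
   finitely many of which matter when the property is recognizable. *)
Definition property (A : Type) :=
  forall T : shape, (node T -> A) -> (nat -> node T) -> Prop.

Definition scons (X : Type) (x : X) (v : nat -> X) (i : nat) : X :=
  if i is j.+1 then v j else x.

Definition mark (A : Type) (X : eqType) n (f : X -> A) (v : nat -> X) (z : X) :
    A * {ffun 'I_n -> bool} :=
  (f z, [ffun i : 'I_n => v i == z]).

Definition recognizes (A : Type) n (M : automaton (A * {ffun 'I_n -> bool}))
    (P : property A) :=
  forall T f v, P T f v <-> accepts M (mark n f v) (enc T).

Definition recn (A : Type) n (P : property A) := exists M, @recognizes A n M P.

Definition rec (A : Type) (P : property A) := exists n, recn n P.

Section Closure.
Variable A : Type.
Implicit Types P Q : property A.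

Lemma rec_ext P Q : (forall T f v, P T f v <-> Q T f v) -> rec P -> rec Q.
Proof.
by move=> PQ [n [M MP]]; exists n, M => T f v; rewrite -MP; apply: iff_sym.
Qed.

Lemma recn_rename n n' (s : nat -> nat) P : (forall i, i < n -> s i < n') ->
  recn n P -> recn n' (fun T f v => P T f (fun i => v (s i))).
Proof.
move=> sn [M MP].
pose g (a : A * {ffun 'I_n' -> bool}) :=
  (a.1, [ffun i : 'I_n => a.2 (Ordinal (sn i (ltn_ord i)))]).
exists (relabel g M) => T f v; rewrite MP accepts_relabel.
have e : g \o mark n' f v =1 mark n f (fun i => v (s i)).
  by move=> z; rewrite /g /mark /=; congr (_, _); apply/ffunP => i; rewrite !ffunE.
by rewrite (eq_accepts _ _ e).
Qed.

Lemma recn_widen n n' P : n <= n' -> recn n P -> recn n' P.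
Proof. by move=> nn; apply: (@recn_rename n n' id) => i lti; apply: leq_trans nn. Qed.

Lemma rec_rename (s : nat -> nat) P :
  rec P -> rec (fun T f v => P T f (fun i => v (s i))).
Proof.
case=> n Pn; exists (\max_(i < n) s i).+1; apply: recn_rename Pn => i lti.
by rewrite ltnS (leq_bigmax (Ordinal lti)).
Qed.

(** Decidability replaces excluded middle, as in [rec_forall]. *)
Lemma rec_bool P : rec P ->
  exists p : forall T, (node T -> A) -> (nat -> node T) -> bool,
    forall T f v, P T f v <-> p T f v.
Proof. by case=> n [M MP]; exists (fun T f v => accepts M (mark n f v) (enc T)). Qed.

Lemma rec_eq_label P T f g v : rec P -> f =1 g -> P T f v -> P T g v.
Proof.
case=> n [M MP] fg /MP h; apply/MP.
by rewrite -(@eq_accepts _ M _ (mark n f v)) // => z; rewrite /mark fg.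
Qed.

Lemma rec_op (op : bool -> bool -> bool) P Q : rec P -> rec Q ->
  exists p q : forall T, (node T -> A) -> (nat -> node T) -> bool,
  [/\ forall T f v, P T f v <-> p T f v, forall T f v, Q T f v <-> q T f v
    & rec (fun T f v => op (p T f v) (q T f v))].
Proof.
move=> [n Pn] [n' Qn'].
have [M MP] := recn_widen (leq_maxl n n') Pn.
have [N NQ] := recn_widen (leq_maxr n n') Qn'.
exists (fun T f v => accepts M (mark (maxn n n') f v) (enc T)).
exists (fun T f v => accepts N (mark (maxn n n') f v) (enc T)); split=> //.
by exists (maxn n n'), (product op M N) => T f v; rewrite accepts_product.
Qed.

Lemma rec_and P Q : rec P -> rec Q -> rec (fun T f v => P T f v /\ Q T f v).
Proof.
move=> rP rQ; have [p [q [Pp Qq r]]] := rec_op andb rP rQ.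
by apply: rec_ext r => T f v; rewrite Pp Qq; apply: iff_sym; apply: (rwP andP).
Qed.

Lemma rec_or P Q : rec P -> rec Q -> rec (fun T f v => P T f v \/ Q T f v).
Proof.
move=> rP rQ; have [p [q [Pp Qq r]]] := rec_op orb rP rQ.
by apply: rec_ext r => T f v; rewrite Pp Qq; apply: iff_sym; apply: (rwP orP).
Qed.

Lemma rec_imply P Q : rec P -> rec Q -> rec (fun T f v => P T f v -> Q T f v).
Proof.
move=> rP rQ; have [p [q [Pp Qq r]]] := rec_op implb rP rQ.
by apply: rec_ext r => T f v; rewrite Pp Qq; apply: iff_sym; apply: (rwP implyP).
Qed.

Lemma rec_const (c : bool) : @rec A (fun T f v => c).
Proof.
exists 0, (@Automaton _ bool c (fun _ _ _ => c) id) => T f v.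
by rewrite /accepts; case: (enc T).
Qed.

Lemma rec_not P : rec P -> rec (fun T f v => ~ P T f v).
Proof. by move/rec_imply/(_ (rec_const false)); apply: rec_ext => T f v; split=> h /h. Qed.

Lemma rec_iff P Q : rec P -> rec Q -> rec (fun T f v => P T f v <-> Q T f v).
Proof. by move=> rP rQ; apply: rec_and; apply: rec_imply. Qed.

Lemma recn_ex n P : recn n.+1 P -> recn n (fun T f v => exists x, P T f (scons x v)).
Proof.
move=> [M MP].
pose g (a : A * {ffun 'I_n -> bool} * bool) : A * {ffun 'I_n.+1 -> bool} :=
  (a.1.1, [ffun i => if unlift ord0 i is Some j then a.1.2 j else a.2]).
(* The guessed bit must mark exactly one node, which becomes the variable 0. *)
exists (subset_automaton (product andb (relabel g M) (relabel snd singleton_automaton))).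
move=> T f v; rewrite -(rwP (accepts_subset false _ _ (enc_uniq T))).
have gE x h : (forall y, h y = (x == y)) ->
    g \o (fun z => (mark n f v z, h z)) =1 mark n.+1 f (scons x v).
  move=> hx z; rewrite /g /mark /=; congr (_, _); apply/ffunP => i; rewrite !ffunE.
  by case: unliftP => [j -> | ->]; rewrite ?ffunE ?hx.
split=> [[x /MP Px] | [h]].
  exists (fun y => x == y); rewrite accepts_product !accepts_relabel.
  rewrite (eq_accepts _ _ (gE x _ (fun=> erefl))) Px.
  by apply/accepts_singleton; [apply: enc_uniq | exists x; rewrite ?mem_enc].
rewrite accepts_product !accepts_relabel => /andP[aM /accepts_singleton].
case/(_ (enc_uniq T)) => x _ hx; have {}hx y : h y = (x == y) by apply/hx/mem_enc.
by exists x; apply/MP; rewrite -(eq_accepts _ _ (gE x _ hx)).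
Qed.

Lemma rec_exists (P : forall T, (node T -> A) -> (nat -> node T) -> node T -> Prop) :
  rec (fun T f v => P T f (fun i => v i.+1) (v 0)) ->
  rec (fun T f v => exists x, P T f v x).
Proof.
by case=> n /(recn_widen (leqnSn n)) Pn; exists n; apply: recn_ex Pn.
Qed.

Lemma rec_forall (P : forall T, (node T -> A) -> (nat -> node T) -> node T -> Prop) :
  rec (fun T f v => P T f (fun i => v i.+1) (v 0)) ->
  rec (fun T f v => forall x, P T f v x).
Proof.
move=> rP; have [p Pp] := rec_bool rP.
have := rec_not (rec_exists (P := fun T f v x => ~ P T f v x) (rec_not rP)).
apply: rec_ext => T f v; split=> [h x | h [x]]; last exact.
have := Pp T f (scons x v) => /= Px.
have [] // : P T f v x \/ ~ P T f v x by rewrite Px; case: (p _ _ _); [left | right].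
by move=> nPx; case: h; exists x.
Qed.

Lemma rec_existsf (I : finType) (P : I -> property A) :
  (forall i, rec (P i)) -> rec (fun T f v => exists i, P i T f v).
Proof.
move=> rP; suff : rec (fun T f v => exists2 i, i \in enum I & P i T f v).
  by apply: rec_ext => T f v; split=> [[i _] | [i]]; exists i; rewrite ?mem_enum.
elim: (enum I) => [|i s IH].
  by apply: rec_ext (rec_const false) => T f v; split=> [|[]].
apply: rec_ext (rec_or (rP i) IH) => T f v; split.
  by case=> [Pi | [j js Pj]]; [exists i; rewrite ?mem_head | exists j; rewrite // inE js orbT].
by case=> j; rewrite inE => /orP[/eqP -> | js] Pj; [left | right; exists j].
Qed.

Lemma rec_forallf (I : finType) (P : I -> property A) :
  (forall i, rec (P i)) -> rec (fun T f v => forall i, P i T f v).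
Proof.
move=> rP; suff : rec (fun T f v => {in enum I, forall i, P i T f v}).
  by apply: rec_ext => T f v; split=> h i *; apply: h; rewrite mem_enum.
elim: (enum I) => [|i s IH]; first by apply: rec_ext (rec_const true) => T f v; split.
apply: rec_ext (rec_and (rP i) IH) => T f v; split.
  by case=> Pi Ps j; rewrite inE => /orP[/eqP -> | /Ps].
by move=> h; split=> [|j js]; apply: h; rewrite inE ?eqxx ?js ?orbT.
Qed.

Lemma rec_two (R : forall T, (node T -> A) -> node T -> node T -> Prop)
    (M : automaton (A * (bool * bool))) i j :
  (forall T f x y, R T f x y <->
     accepts M (fun z => (f z, (x == z, y == z))) (enc T)) ->
  rec (fun T f v => R T f (v i) (v j)).
Proof.
move=> MR; pose g (a : A * {ffun 'I_2 -> bool}) := (a.1, (a.2 ord0, a.2 ord_max)).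
suff : rec (fun T f v => R T f (v 0) (v 1)).
  by move/(rec_rename (fun k => if k is 0 then i else j)).
exists 2, (relabel g M) => T f v; rewrite MR accepts_relabel.
have e : g \o mark 2 f v =1 fun z => (f z, (v 0 == z, v 1 == z)).
  by move=> z; rewrite /g /= !ffunE.
by rewrite (eq_accepts _ _ e).
Qed.

Lemma rec_letter (p : A -> bool) i : rec (fun T f v => p (f (v i))).
Proof.
pose M := @Automaton (A * (bool * bool)) bool false
  (fun a l r => [|| a.2.1 && p a.1, l | r]) id.
apply: (@rec_two (fun T f x y => p (f x)) M i i) => T f x y.
have aE b : run M (fun z => (f z, (x == z, y == z))) b = (x \in bnodes b) && p (f x).
  elim: b => //= z l -> r ->; rewrite inE mem_cat.
  by case: eqVneq => [-> | _] /=; do 3?[case: (_ \in _) => //=]; case: (p _).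
by rewrite /accepts aE mem_enc.
Qed.

Lemma rec_leftof i j : rec (fun T (f : node T -> A) v => leftof (enc T) (v i) (v j)).
Proof.
pose M := @Automaton (A * (bool * bool)) (bool * bool)%type (false, false)
  (fun a l r => ([|| a.2.2, l.1 | r.1], [|| a.2.1 && l.1, l.2 | r.2])) snd.
apply: (@rec_two (fun T f x y => leftof (enc T) x y) M) => T f x y.
rewrite /accepts; have -> // : forall b, run M (fun z => (f z, (x == z, y == z))) b =
   (y \in bnodes b, leftof b x y).
by elim=> //= z l -> r ->; rewrite inE mem_cat.
Qed.

Lemma rec_rightof i j : rec (fun T (f : node T -> A) v => rightof (enc T) (v i) (v j)).
Proof.
pose M := @Automaton (A * (bool * bool)) (bool * bool)%type (false, false)
  (fun a l r => ([|| a.2.2, l.1 | r.1], [|| a.2.1 && r.1, l.2 | r.2])) snd.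
apply: (@rec_two (fun T f x y => rightof (enc T) x y) M) => T f x y.
rewrite /accepts; have -> // : forall b, run M (fun z => (f z, (x == z, y == z))) b =
   (y \in bnodes b, rightof b x y).
by elim=> //= z l -> r ->; rewrite inE mem_cat.
Qed.

Lemma rec_eq i j : rec (fun T (f : node T -> A) v => v i = v j).
Proof.
pose M := @Automaton (A * (bool * bool)) bool false
  (fun a l r => [|| a.2.1 && a.2.2, l | r]) id.
apply: (@rec_two (fun T f x y => x = y) M) => T f x y.
have aE b : run M (fun z => (f z, (x == z, y == z))) b = (x \in bnodes b) && (x == y).
  elim: b => //= z l -> r ->; rewrite inE mem_cat [y == z]eq_sym.
  by case: (eqVneq x z) => [-> | _] /=; do 2?[case: (_ \in _) => //=]; rewrite ?orbF; case: (_ == _).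
by rewrite /accepts aE mem_enc; apply: (rwP eqP).
Qed.

Lemma rec_dir d i j : rec (fun T (f : node T -> A) v => ndir (v i) (v j) = d).
Proof.
have lr T (x y : node T) : ndir x y = d <->
   match d with
   | Some None => x = y
   | Some (Some false) => leftof (enc T) x y
   | Some (Some true) => rightof (enc T) x y
   | None => [/\ ~ x = y, ~ leftof (enc T) x y & ~ rightof (enc T) x y]
   end.
  rewrite (rwP eqP); case: d => [[[]|]|].
  - by rewrite ndir_right rightofE ?enc_uniq.
  - by rewrite ndir_left leftofE ?enc_uniq.
  - by rewrite ndir_here; apply: iff_sym; apply: (rwP eqP).
  rewrite ndir_up /nanc belowE ?enc_uniq ?mem_enc // !negb_or.
  split=> [/and3P[h1 h2 h3] | [h1 h2 h3]].
    by split; [apply/eqP | apply/negP | apply/negP].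
  by apply/and3P; split; [apply/eqP | apply/negP | apply/negP].
suff : rec (fun T (f : node T -> A) v =>
   match d with
   | Some None => v i = v j
   | Some (Some false) => leftof (enc T) (v i) (v j)
   | Some (Some true) => rightof (enc T) (v i) (v j)
   | None => [/\ ~ v i = v j, ~ leftof (enc T) (v i) (v j) & ~ rightof (enc T) (v i) (v j)]
   end) by apply: rec_ext => T f v; apply: iff_sym.
case: d {lr} => [[[]|]|].
- exact: rec_rightof.
- exact: rec_leftof.
- exact: rec_eq.
have := rec_and (rec_not (rec_eq i j)) (rec_and (rec_not (rec_leftof i j)) (rec_not (rec_rightof i j))).
by apply: rec_ext => T f v; split=> [[h1 [h2 h3]] | [h1 h2 h3]].
Qed.

End Closure.

Lemma rec_relabel (A B : Type) (g : B -> A) (P : property A) :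
  rec P -> rec (fun T (f : node T -> B) v => P T (fun z => g (f z)) v).
Proof.
case=> n [M MP]; pose g' (a : B * {ffun 'I_n -> bool}) := (g a.1, a.2).
by exists n, (relabel g' M) => T f v; rewrite MP accepts_relabel.
Qed.

Lemma rec_exlabel (A : Type) (B : finType) (c0 : B) (P : property (A * B)) :
  rec P -> rec (fun T (f : node T -> A) v =>
                  exists h : node T -> B, P T (fun z => (f z, h z)) v).
Proof.
case=> n [M MP].
pose g (a : A * {ffun 'I_n -> bool} * B) := ((a.1.1, a.2), a.1.2).
exists n, (subset_automaton (relabel g M)) => T f v.
rewrite -(rwP (accepts_subset c0 _ _ (enc_uniq T))).
by split=> -[h ah]; exists h; move: ah; rewrite MP accepts_relabel.
Qed.

Section Runs.
Variables (A B : Type) (M : automaton B) (g : A -> bool -> B).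

Let lab T (f : node T -> A) y z := g (f z) (y == z).

Lemma rec_children (p : state M -> state M -> bool) i j :
  rec (fun T (f : node T -> A) v =>
    p (left_run M (lab f (v j)) (v i)) (right_run M (lab f (v j)) (v i))).
Proof.
pose N := @Automaton (A * (bool * bool)) (state M * bool)%type (leaf_state M, false)
  (fun a l r => (step (g a.1 a.2.2) l.1 r.1, [|| a.2.1 && p l.1 r.1, l.2 | r.2])) snd.
apply: (@rec_two _ (fun T f x y => p (left_run M (lab f y) x) (right_run M (lab f y) x)) N).
move=> T f x y; rewrite /left_run /right_run; have := mem_enc x; have := enc_uniq T.
rewrite /accepts; set h := fun z => _.
suff aE b : uniq (bnodes b) -> run N h b =
   (run M (lab f y) b, (x \in bnodes b) && p (run M (lab f y) (lchild (subtree b x)))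
                                    (run M (lab f y) (rchild (subtree b x)))).
  by move=> ub xb; rewrite aE //= xb.
elim: b => // z l IHl r IHr ub; have := ub; rewrite uniq_bnodes.
case/and5P => zl zr ul ur lr; rewrite /= IHl // IHr //= inE mem_cat [z == x]eq_sym.
congr (_, _); have [-> | _] /= := eqVneq x z.
  by rewrite (negbTE zl) (negbTE zr) !orbF.
have [xl | _] //= := boolP (x \in bnodes l).
by rewrite (disjoint_children ub xl) orbF.
Qed.

(** Equality of functions is a finite conjunction over [q]; for one [q], the automaton restarts in
    state [q] at the hole [v i]. *)
Lemma rec_above (s : {ffun state M -> state M}) i j :
  rec (fun T (f : node T -> A) v => above_run M (lab f (v j)) (v i) = s).
Proof.
suff h q : rec (fun T (f : node T -> A) v => context M (lab f (v j)) (enc T) (v i) q == s q).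
  apply: rec_ext (rec_forallf h) => T f v; split=> [e | <- q]; last by rewrite ffunE.
  by apply/ffunP => q; rewrite ffunE; apply/eqP.
pose N := @Automaton (A * (bool * bool)) (state M) (leaf_state M)
  (fun a l r => if a.2.1 then q else step (g a.1 a.2.2) l r) (pred1 (s q)).
apply: (@rec_two _ (fun T f x y => context M (lab f y) (enc T) x q == s q) N).
move=> T f x y; have := mem_enc x; have := enc_uniq T; rewrite /accepts /=.
set h := fun z => (f z, _).
have off b : x \notin bnodes b -> run N h b = run M (lab f y) b.
  elim: b => //= z l IHl r IHr; rewrite inE mem_cat !negb_or => /and3P[xz xl xr].
  by rewrite (negbTE xz) IHl ?IHr.
suff aE b : uniq (bnodes b) -> x \in bnodes b -> run N h b = context M (lab f y) b x q.
  by move=> ub xb; rewrite aE.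
elim: b => // z l IHl r IHr ub; have := ub; rewrite uniq_bnodes mem_bnodes.
case/and5P => zl zr ul ur lr /=; rewrite [z == x]eq_sym.
have [// | _ /=] := eqVneq x z; case: ifP => xl /= xr.
  by rewrite IHl // off // (disjoint_children ub xl).
by rewrite IHr // off // xl.
Qed.

End Runs.

Lemma rec_ternary_automaton (A : finType)
    (R : forall T, (node T -> A) -> node T -> node T -> node T -> Prop) :
  rec (fun T f v => R T f (v 0) (v 1) (v 2)) ->
  exists M : automaton (A * (bool * bool * bool)), forall T f x y1 y2,
    R T f x y1 y2 <-> accepts M (mark3 f x y1 y2) (enc T).
Proof.
case=> n [M MR].
pose g (a : A * (bool * bool * bool)) : A * {ffun 'I_n -> bool} :=
  (a.1, [ffun i => match val i with 0 => a.2.1.1 | 1 => a.2.1.2 | _ => a.2.2 end]).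
exists (relabel g M) => T f x y1 y2; rewrite accepts_relabel.
pose v i := match i with 0 => x | 1 => y1 | _ => y2 end.
rewrite (MR T f v).
have e : g \o mark3 f x y1 y2 =1 mark n f v.
  move=> z; rewrite /g /mark /=; congr (_, _); apply/ffunP => i; rewrite !ffunE /v.
  by case: (val i) => [|[|]].
by rewrite (eq_accepts _ _ e).
Qed.

Lemma rec_closed_automaton (A : Type) (P : forall T, (node T -> A) -> Prop) :
  rec (fun T f v => P T f) ->
  exists M : automaton A, forall T f, P T f <-> accepts M f (enc T).
Proof.
case=> n Pn.
(* All variables are identified with one, which is then quantified away; the root is always there to
   instantiate it. *)
have /recn_ex[M MP] : recn 1 (fun T (f : node T -> A) v => P T f).
  exact: (@recn_rename _ n 1 (fun=> 0) _ _ Pn).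
pose g (a : A) : A * {ffun 'I_0 -> bool} := (a, [ffun=> false]).
exists (relabel g M) => T f; rewrite accepts_relabel.
have e : g \o f =1 mark 0 f (fun=> nroot).
  by move=> z; rewrite /g /mark /=; congr (_, _); apply/ffunP => -[].
rewrite (eq_accepts _ _ e) -MP; split=> [h | [] //]; by exists nroot.
Qed.

(** * From binary automata to automata on unranked trees *)

Fixpoint spine (X : Type) (b : btree X) : seq X :=
  if b is Node x _ r then x :: spine r else [::].

Lemma spine_sub (X : eqType) (b : btree X) : {subset spine b <= bnodes b}.
Proof.
elim: b => //= x l _ r IH y; rewrite !inE mem_cat.
by case/orP => [-> // | /IH ->]; rewrite !orbT.
Qed.

Lemma run_spine (A : Type) (M : automaton A) (X : eqType) (f : X -> A) b :
  uniq (bnodes b) ->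
  run M f b = foldr (fun x q => step (f x) (run M f (lchild (subtree b x))) q)
                    (leaf_state M) (spine b).
Proof.
elim: b => // x l _ r IH ub; have := ub; rewrite uniq_bnodes.
case/and5P => xl xr ul ur lr; rewrite /= eqxx /= IH //; congr (step _ _ _).
have : {subset spine r <= bnodes r} by apply: spine_sub.
elim: (spine r) => //= z s IHs sub; rewrite IHs; last first.
  by move=> y ys; apply: sub; rewrite inE ys orbT.
have zr : z \in bnodes r by apply: sub; rewrite mem_head.
have -> : (x == z) = false by apply/eqP => e; rewrite e zr in xr.
have -> // : (z \in bnodes l) = false.
by apply/negP => /(disjoint_children ub); rewrite zr.
Qed.

Lemma spine_encode_forest (X : eqType) (h : seq nat -> X) i ts :
  spine (encode_forest h i ts) = [seq h [:: j] | j <- iota i (size ts)].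
Proof. by elim: ts i => //= t ts IH i; rewrite encodeE /= IH. Qed.

Lemma children_spine (T : shape) (x : node T) :
  children x = spine (lchild (subtree (enc T) x)).
Proof.
rewrite subtree_enc encodeE /= spine_encode_forest.
set n := size _; set k := fun j => node_at T (ssval x ++ [:: j]).
have xT : ssval x \in nodes T := ssvalP x.
have val_k j : j < n -> ssval (k j) = rcons (ssval x) j.
  by move=> jn; rewrite val_node_at ?cats1 // -cats1 mem_nodes_cat xT mem_nodes_cons jn mem_nodes.
have sib_k j : j < n -> sibling_index (k j) = j.
  by move=> jn; rewrite sibling_index_ssval val_k // last_rcons.
have memE y : (y \in enum (child x)) = (y \in [seq k j | j <- iota 0 n]).
  rewrite mem_enum -[LHS]/(child x y) child_ssval; apply/eqP/mapP => [e | [j]].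
    have yT : ssval y \in nodes T := ssvalP y.
    exists (sibling_index y); last by rewrite /k cats1 -e node_atK.
    move: yT; rewrite e -cats1 mem_nodes_cat xT mem_nodes_cons => /and3P[_ lt _].
    by rewrite mem_iota add0n leq0n.
  rewrite mem_iota add0n => /andP[_ jn] ->.
  by rewrite val_k // sib_k.
have uk : uniq [seq k j | j <- iota 0 n].
  rewrite map_inj_in_uniq ?iota_uniq // => i j; rewrite !mem_iota !add0n /=.
  by move=> iln jln e; rewrite -(sib_k i iln) e sib_k.
have pe : perm_eq (enum (child x)) [seq k j | j <- iota 0 n].
  by apply: uniq_perm; rewrite ?enum_uniq.
pose R (y z : node T) := sibling_index y <= sibling_index z.
have Rtrans : transitive R by move=> y z w; apply: leq_trans.
have Rtot : total R by move=> y z; apply: leq_total.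
have Rs : sorted R [seq k j | j <- iota 0 n].
  rewrite sorted_map; apply: (@sub_in_sorted _ (fun i => i < n) leq).
  - by move=> i j ni nj; rewrite /R /= !sib_k.
  - by apply/allP => i; rewrite mem_iota add0n.
  - exact: iota_sorted.
(* Distinct children have distinct sibling indices, so sorting has only one possible result. *)
rewrite -[RHS](sorted_sort Rtrans Rs) /children.
apply/(perm_sort_inP (leT := R)) => //.
- by move=> y z w _ _ _; apply: Rtrans.
move=> y z; rewrite !memE => /mapP[i + ->] /mapP[j + ->].
rewrite !mem_iota !add0n /R => /= ni nj; rewrite !sib_k // => le.
by congr (k _); apply/anti_leq.
Qed.

Section Regular.
Variables (A : Type) (M : automaton A).

Let fold_states (w : seq {ffun state M -> state M}) : state M :=
  foldr (fun (g : {ffun state M -> state M}) q => g q) (leaf_state M) w.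

(* The state of a node is the action of its label and children on the state of
   its right siblings. *)
Definition horizontal_nfa (g : {ffun state M -> state M}) (a : A) : nfa {ffun state M -> state M} :=
  Nfa [set q | [ffun r => step a q r] == g] (fun q (g' : {ffun state M -> state M}) => [set q' | g' q' == q])
      [set leaf_state M].

Definition to_tree_automaton : tree_automaton A :=
  TreeAutomaton horizontal_nfa [set g : {ffun state M -> state M} | final (g (leaf_state M))].

Lemma horizontal_accepts g a w :
  nfa_accepts (horizontal_nfa g a) w = ([ffun r => step a (fold_states w) r] == g).
Proof.
(* A state of the horizontal automaton is a guess of the fold of what remains to be read. *)
have from q : @nfa_accepts_from _ (horizontal_nfa g a) q w = (fold_states w == q).
  elim: w q => [|g' w IH] q; first by rewrite /= inE eq_sym.
  rewrite /=; apply/exists_inP/eqP => [[q'] | <-]; first by rewrite inE IH => /eqP <- /eqP ->.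
  by exists (fold_states w); rewrite ?inE ?IH.
apply/exists_inP/eqP => [[q] | e]; first by rewrite inE from => /eqP <- /eqP <-.
by exists (fold_states w); rewrite /= ?inE ?from ?e ?eqxx.
Qed.

Lemma to_tree_automatonP (t : tree A) :
  ta_accepts to_tree_automaton t <-> accepts M (label t) (enc t).
Proof.
case: t => T f.
pose G (x : node T) := [ffun r => step (f x) (run M f (lchild (subtree (enc T) x))) r].
have foldG x : fold_states [seq G y | y <- children x] = run M f (lchild (subtree (enc T) x)).
  have us := subtree_uniq x (enc_uniq T); rewrite (subtree_mem (mem_enc x)) in us.
  have := us; rewrite uniq_bnodes => /and5P[_ _ ul _ _].
  rewrite children_spine (run_spine _ _ ul) /fold_states foldr_map.
  have [sl _] := subtree_children (enc_uniq T) (mem_enc x).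
  have : {subset spine (lchild (subtree (enc T) x)) <= bnodes (lchild (subtree (enc T) x))}.
    exact: spine_sub.
  elim: (spine _) => //= z s IH sub; rewrite IH; last first.
    by move=> y ys; apply: sub; rewrite inE ys orbT.
  by rewrite ffunE (sl z) // sub // mem_head.
have rootE : root T = nroot.
  by apply: val_inj; symmetry; apply: val_node_at; rewrite mem_nodes.
have accG : (G (root T) \in ta_final to_tree_automaton) = accepts M f (enc T).
  rewrite inE /G ffunE rootE /accepts.
  have := mem_enc (@nroot T); rewrite /enc encodeE /= => _.
  by rewrite eqxx.
rewrite -accG; split=> [[r rr] | h].
  suff -> : r = [ffun x => G x] by rewrite ffunE.
  apply/ffunP => x; rewrite ffunE.
  (* Children come later in preorder, so this induction goes from the leaves up; it shows that the
     only possible run is [G]. *)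
  have [n] := ubnP (size (bnodes (enc T)) - nidx x).
  elim: n x => // n IH x; rewrite ltnS => le.
  have := rr x; rewrite horizontal_accepts => /eqP <-.
  apply/ffunP => q; rewrite !ffunE; congr (step _ _ _).
  rewrite -foldG; congr (fold_states _); apply/eq_in_map => y.
  rewrite children_spine => /spine_sub yx; apply: IH; apply: leq_trans le.
  have xy : ndir x y = Some (Some false) by apply/eqP; rewrite ndir_left.
  have lt : nidx x < nidx y.
    apply: nidx_anc; first by apply/negPn; rewrite -ndir_up xy.
    by rewrite -ndir_here xy.
  by rewrite ltn_sub2l // (leq_trans lt) // ltnW // index_mem mem_enc.
exists [ffun x => G x]; last by rewrite ffunE.
move=> x; rewrite horizontal_accepts ffunE (_ : map _ _ = [seq G y | y <- children x]); last first.
  by apply: eq_map => y; rewrite ffunE.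
by rewrite foldG.
Qed.

Lemma regular_accepts (L : tree A -> Prop) :
  (forall t, L t <-> accepts M (label t) (enc t)) -> regular L.
Proof. by move=> LM; exists to_tree_automaton => t; rewrite to_tree_automatonP. Qed.

End Regular.

(** * MSO formulas are recognizable *)

Section MSO.
Variables (A : eqType) (B : Type) (letter_of : B -> A) (k : nat).
Variable preds : 'I_k -> forall T, (node T -> B) -> node T -> bool.
Hypothesis preds_rec : forall i, rec (fun T f v => @preds i T f (v 0)).

(** A [property] has node variables only, so set variables become bits of the label. *)
Definition mso_property n m (f : mso A k n m) : property (B * {ffun 'I_m -> bool}) :=
  fun T l v =>
    @mso_holds A k (@Tree A T [ffun z => letter_of (l z).1])
      (fun i => [set x | @preds i T (fun z => (l z).1) x])
      n m f (mktuple (fun i : 'I_n => v i)) (mktuple (fun j : 'I_m => [set z | (l z).2 j])).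

Lemma cons_mktuple (X : Type) n (x : X) (g : 'I_n -> X) (g' : 'I_n.+1 -> X) :
  g' ord0 = x -> (forall i, g' (lift ord0 i) = g i) ->
  [tuple of x :: mktuple g] = mktuple g'.
Proof.
move=> g0 gl; apply: eq_from_tnth => i; rewrite tnth_mktuple.
case: (unliftP ord0 i) => [j -> | ->]; last by rewrite g0.
by rewrite gl tnthS tnth_mktuple.
Qed.

Lemma rec_mso n m (f : mso A k n m) : rec (mso_property f).
Proof.
elim: f => {n m}.
- move=> n m a x; have := rec_letter (fun b : B * {ffun 'I_m -> bool} => letter_of b.1 == a) x.
  by apply: rec_ext => T l v; rewrite /mso_property /= ffunE tnth_mktuple.
- move=> n m i x.
  have := rec_rename (fun=> nat_of_ord x)
    (rec_relabel (fun b : B * {ffun 'I_m -> bool} => b.1) (preds_rec i)).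
  by apply: rec_ext => T l v; rewrite /mso_property /= inE tnth_mktuple.
- move=> n m x y.
  have : rec (fun T (l : node T -> B * {ffun 'I_m -> bool}) v =>
      leftof (enc T) (v x) (v y) /\
      ~ exists z, leftof (enc T) (v x) z /\ leftof (enc T) z (v y)).
    apply: rec_and; first exact: rec_leftof.
    apply: rec_not; apply: rec_exists; apply: rec_and.
      exact: (rec_leftof _ x.+1 0).
    exact: (rec_leftof _ 0 y.+1).
  apply: rec_ext => T l v; rewrite /mso_property /= !tnth_mktuple childE.
  split=> [[-> nz] | /andP[-> /existsPn nz]].
    by apply/existsPn => z; apply/negP => /andP[h1 h2]; apply: nz; exists z.
  by split=> // -[z [h1 h2]]; have := nz z; rewrite h1 h2.
- move=> n m x y.
  have : rec (fun T (l : node T -> B * {ffun 'I_m -> bool}) v =>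
      rightof (enc T) (v x) (v y) /\
      ~ exists z, rightof (enc T) (v x) z /\
                  (leftof (enc T) z (v y) \/ rightof (enc T) z (v y))).
    apply: rec_and; first exact: rec_rightof.
    apply: rec_not; apply: rec_exists; apply: rec_and.
      exact: (rec_rightof _ x.+1 0).
    apply: rec_or; first exact: (rec_leftof _ 0 y.+1).
    exact: (rec_rightof _ 0 y.+1).
  apply: rec_ext => T l v; rewrite /mso_property /= !tnth_mktuple next_siblingE.
  split=> [[-> nz] | /andP[-> /existsPn nz]].
    by apply/existsPn => z; apply/negP => /andP[h1 /orP h2]; apply: nz; exists z.
  by split=> // -[z [h1 /orP h2]]; have := nz z; rewrite h1 h2.
- move=> n m x y; have := @rec_eq (B * {ffun 'I_m -> bool}) x y.
  apply: rec_ext => T l v; rewrite /mso_property /= !tnth_mktuple; exact: (rwP eqP).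
- move=> n m x X; have := rec_letter (fun b : B * {ffun 'I_m -> bool} => b.2 X) x.
  by apply: rec_ext => T l v; rewrite /mso_property /= !tnth_mktuple inE.
- move=> n m f /rec_not; apply: rec_ext => T l v; rewrite /mso_property /=.
  by split=> /negP.
- move=> n m f IHf g IHg; have := rec_and IHf IHg.
  by apply: rec_ext => T l v; rewrite /mso_property /=; apply: (rwP andP).
- move=> n m f IHf.
  have : rec (fun T l v => exists x, @mso_property n.+1 m f T l (scons x v)).
    apply: rec_exists; apply: rec_ext IHf => T l v; rewrite /mso_property.
    suff -> : mktuple (fun i : 'I_n.+1 => scons (v 0) (fun i => v i.+1) i) =
              mktuple (fun i : 'I_n.+1 => v i) by [].
    by apply: eq_from_tnth => -[[|i] lti]; rewrite !tnth_mktuple.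
  apply: rec_ext => T l v; rewrite /mso_property /=.
  have e x : [tuple of x :: mktuple (fun i : 'I_n => v i)]
      = mktuple (fun i : 'I_n.+1 => scons x v i) by apply: cons_mktuple.
  by split=> [[x h] | /existsP[x h]]; [apply/existsP | ]; exists x; rewrite ?e // -e.
- move=> n m f IHf.
  pose ext (b : B * {ffun 'I_m -> bool} * bool) : B * {ffun 'I_m.+1 -> bool} :=
    (b.1.1, [ffun j => if unlift ord0 j is Some i then b.1.2 i else b.2]).
  have := rec_exlabel false (rec_relabel ext IHf).
  apply: rec_ext => T l v; rewrite /mso_property /=.
  have e (h : node T -> bool) (X : {set node T}) : h =1 mem X ->
      [tuple of X :: mktuple (fun j : 'I_m => [set z | (l z).2 j])]
      = mktuple (fun j : 'I_m.+1 => [set z | (ext (l z, h z)).2 j]).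
    move=> hX; apply: cons_mktuple => [|j]; apply/setP => z.
      by rewrite inE ffunE unlift_none hX.
    by rewrite !inE ffunE liftK.
  split=> [[h hf] | /existsP[X hX]].
    by apply/existsP; exists [set z | h z]; rewrite (e h) // => z /=; rewrite inE.
  by exists (fun z => z \in X); rewrite -(e _ X).
Qed.

End MSO.

Section Pointing.
Variables (A : finType) (M : automaton (A * (bool * bool * bool))).
Variables (B : Type) (g : B -> A).
Implicit Type th : decomposition M.

Let located_rec (mk : A -> bool -> A * (bool * bool * bool)) (s : summary M) i j :
  rec (fun T (f : node T -> B) v =>
    summarize M (fun z => mk (g (f z)) (v j == z)) (v i) = s).
Proof.
case: s => [[sl sr] sa].
have := rec_and
  (rec_children (M := M) (fun b c => mk (g b) c) (fun l r => (l == sl) && (r == sr)) i j)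
  (rec_above (fun b c => mk (g b) c) sa i j).
apply: rec_ext => T f v; rewrite /summarize; split.
  by case=> /andP[/eqP -> /eqP ->] ->.
by case=> -> -> ->; rewrite !eqxx.
Qed.

Lemma rec_chi th i j :
  rec (fun T (f : node T -> B) v => chi (fun z => g (f z)) th (v i) (v j)).
Proof.
have := rec_and (rec_const B (valid th)) (rec_and (rec_dir B (dx th) i j)
  (rec_and (located_rec (fun a c => (a, (c, false, false))) (sx th) i j)
  (rec_and (located_rec (fun a c => (a, (false, false, false))) (s0 th) i j)
           (rec_letter (fun b => g b == letter th) i)))).
apply: rec_ext => T f v; split.
  by case=> h [h1 [h2 [h3 h4]]]; apply/and5P; split=> //; apply/eqP.
by case/and5P => h /eqP h1 /eqP h2 /eqP h3 h4.
Qed.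

Lemma rec_alpha th i j :
  rec (fun T (f : node T -> B) v => alpha (fun z => g (f z)) th (v i) (v j)).
Proof.
have := rec_and (rec_const B (valid th)) (rec_and (rec_dir B (d1 th) i j)
  (located_rec (fun a c => (a, (false, c, false))) (s1 th) i j)).
apply: rec_ext => T f v; split.
  by case=> h [h1 h2]; apply/and3P; split=> //; apply/eqP.
by case/and3P => h /eqP h1 /eqP h2.
Qed.

Lemma rec_beta th i j :
  rec (fun T (f : node T -> B) v => beta (fun z => g (f z)) th (v i) (v j)).
Proof.
have := rec_and (rec_const B (valid th)) (rec_and (rec_dir B (d2 th) i j)
  (located_rec (fun a c => (a, (false, false, c))) (s2 th) i j)).
apply: rec_ext => T f v; split.
  by case=> h [h1 h2]; apply/and3P; split=> //; apply/eqP.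
by case/and3P => h /eqP h1 /eqP h2.
Qed.

(** [onpath] is replaced by the compatibility of two directions, which leaves a finite conjunction
    of conditions on directions and letters. *)
Lemma rec_npoints (lab : B -> option direction) i j :
  rec (fun T (f : node T -> B) v => npoints (fun z => lab (f z)) (v i) (v j)).
Proof.
have : rec (fun T (f : node T -> B) v => forall z, forall d : direction * direction,
    ndir z (v i) = d.1 -> ndir z (v j) = d.2 ->
    compatible d.1 d.2 -> lab (f z) == Some d.2).
  apply: rec_forall; apply: rec_forallf => d; apply: rec_imply; first exact: (rec_dir _ _ 0 i.+1).
  apply: rec_imply; first exact: (rec_dir _ _ 0 j.+1).
  apply: rec_imply; first exact: rec_const.
  exact: (rec_letter (fun b => lab b == Some d.2) 0).
apply: rec_ext => T f v.
have pE z x y : onpath (@nanc T) z x y = compatible (ndir z x) (ndir z y).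
  by rewrite (onpath_dir (@ndir_up T) (@ndir_here T) (@ndir_anc T) (@ndir_common T)).
split=> [h | /forallP h z [d d'] /= e e' c].
  by apply/forallP => z; apply/implyP; rewrite pE => c; apply: (h z (_, _)).
by have := h z; rewrite pE e e' c.
Qed.

End Pointing.

(** * Class automata *)

(* Recognition by a class automaton: [G] is the work alphabet, [R] the
   transducer and [C] the class condition, read on the class of each node [x]. *)
Definition carec (A : finType)
    (Pi : forall T, (node T -> A) -> rel (node T) -> Prop) :=
  exists (G : finType) (R : forall T, (node T -> A * G) -> Prop)
    (C : forall T, (node T -> A * G * bool) -> Prop),
  [/\ rec (fun T f v => R T f), rec (fun T f v => C T f)
    & forall T f sim, equivalence_rel sim ->
      Pi T f sim <-> exists s : node T -> G,
        R T (fun z => (f z, s z)) /\ forall x, C T (fun z => (f z, s z, sim x z))].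

Lemma carec_rec (A : finType) (P : forall T, (node T -> A) -> Prop) :
  rec (fun T f v => P T f) -> carec (fun T f _ => P T f).
Proof.
move=> rP; exists unit, (fun T f => P T (fun z => (f z).1)), (fun T f => true).
split; [exact: rec_relabel fst _ rP | exact: rec_const |].
move=> T f sim _; split=> [h | [s []] //].
by exists (fun=> tt).
Qed.

Lemma carec_relabel (A B : finType) (g : B -> A) Pi :
  @carec A Pi -> @carec B (fun T f sim => Pi T (fun z => g (f z)) sim).
Proof.
case=> G [R [C [rR rC h]]].
exists G, (fun T f => R T (fun z => (g (f z).1, (f z).2))).
exists (fun T f => C T (fun z => (g (f z).1.1, (f z).1.2, (f z).2))); split.
- exact: (rec_relabel (fun b : B * G => (g b.1, b.2)) rR).
- exact: (rec_relabel (fun b : B * G * bool => (g b.1.1, b.1.2, b.2)) rC).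
- by move=> T f sim eqv; rewrite h.
Qed.

Lemma carec_and (A : finType) Pi Pi' : @carec A Pi -> @carec A Pi' ->
  @carec A (fun T f sim => Pi T f sim /\ Pi' T f sim).
Proof.
case=> G [R [C [rR rC h]]] [G' [R' [C' [rR' rC' h']]]].
exists (G * G')%type.
exists (fun T f => R T (fun z => ((f z).1, (f z).2.1)) /\ R' T (fun z => ((f z).1, (f z).2.2))).
exists (fun T f => C T (fun z => ((f z).1.1, (f z).1.2.1, (f z).2)) /\
                   C' T (fun z => ((f z).1.1, (f z).1.2.2, (f z).2))); split.
- apply: rec_and; first exact: (rec_relabel (fun b : A * (G * G') => (b.1, b.2.1)) rR).
  exact: (rec_relabel (fun b : A * (G * G') => (b.1, b.2.2)) rR').
- apply: rec_and.
    exact: (rec_relabel (fun b : A * (G * G') * bool => (b.1.1, b.1.2.1, b.2)) rC).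
  exact: (rec_relabel (fun b : A * (G * G') * bool => (b.1.1, b.1.2.2, b.2)) rC').
move=> T f sim eqv; rewrite h // h' //; split.
  case=> [[s [r c]] [s' [r' c']]]; exists (fun z => (s z, s' z)).
  split; first by split.
  by move=> x; split; [apply: c | apply: c'].
case=> s [[r r'] c]; split; [exists (fun z => (s z).1) | exists (fun z => (s z).2)];
  by split=> // x; case: (c x).
Qed.

Lemma carec_exlabel (A B : finType) (Pi : forall T, (node T -> A * B) -> rel (node T) -> Prop) :
  carec Pi -> carec (fun T f sim => exists h : node T -> B, Pi T (fun z => (f z, h z)) sim).
Proof.
case=> G [R [C [rR rC e]]]; exists (B * G)%type.
exists (fun T f => R T (fun z => ((f z).1, (f z).2.1, (f z).2.2))).
exists (fun T f => C T (fun z => ((f z).1.1, (f z).1.2.1, (f z).1.2.2, (f z).2))); split.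
- exact: (rec_relabel (fun b : A * (B * G) => (b.1, b.2.1, b.2.2)) rR).
- exact: (rec_relabel (fun b : A * (B * G) * bool => (b.1.1, b.1.2.1, b.1.2.2, b.2)) rC).
move=> T f sim eqv; split.
  by case=> h /e -/(_ eqv)[s [r c]]; exists (fun z => (h z, s z)).
by case=> s [r c]; exists (fun z => (s z).1); apply/e => //; exists (fun z => (s z).2).
Qed.

Section Step.
Variables (A : finType) (neg : bool).
Variable R : forall T, (node T -> A) -> node T -> node T -> node T -> Prop.
Hypothesis R_rec : rec (fun T f v => @R T f (v 0) (v 1) (v 2)).

Lemma carec_step :
  @carec (A * bool)%type (fun T f sim => forall x,
    (f x).2 <-> exists y1 y2, sim y1 y2 (+) neg /\ @R T (fun z => (f z).1) x y1 y2).
Proof.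
have [M MR] := rec_ternary_automaton R_rec.
pose K := guidance_bound M.
pose ptrs : finType := {ffun decomposition M -> option ('I_K.+1 * bool)}.
pose labs : finType := {ffun decomposition M * 'I_K.+1 -> option direction}.
pose G : finType := (ptrs * labs)%type.
pose letterT (b : A * bool * G) := b.1.1.
pose letterC (b : A * bool * G * bool) := b.1.1.1.
exists G.
(* The transducer checks what does not involve the data: each selected [x] is served by a node that
   owns a pointer, and each pointer leads somewhere. *)
exists (fun T (l : node T -> A * bool * G) =>
  (forall x, (l x).1.2 -> exists m, exists th, (l m).2.1 th != None /\
     chi (M := M) (fun z => (l z).1.1) th m x) /\
  (forall m, forall (th : decomposition M) (a : 'I_K.+1), forall side : bool,
     (l m).2.1 th == Some (a, side) ->
     exists y, npoints (fun z => (l z).2.2 (th, a)) m y)).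
(* On the class of the target [y] of a pointer, the other component is sought inside the class, or
   outside it if [neg]. The last clause refutes all pairs for an unselected [x]. *)
exists (fun T (l : node T -> A * bool * G * bool) =>
  (forall m y, forall (th : decomposition M) (a : 'I_K.+1),
     (l y).2 -> npoints (fun z => (l z).1.2.2 (th, a)) m y ->
     ((l m).1.2.1 th == Some (a, true) ->
        alpha (fun z => (l z).1.1.1) th m y /\
        exists y', (l y').2 (+) neg /\ beta (fun z => (l z).1.1.1) th m y') /\
     ((l m).1.2.1 th == Some (a, false) ->
        beta (fun z => (l z).1.1.1) th m y /\
        exists y', (l y').2 (+) neg /\ alpha (fun z => (l z).1.1.1) th m y')) /\
  (forall x y1 y2, ~~ (l x).1.1.2 -> (l y1).2 -> (l y2).2 (+) neg ->
     ~ @R T (fun z => (l z).1.1.1) x y1 y2)).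
split.
- apply: rec_and.
    apply: rec_forall; apply: rec_imply.
      exact: (rec_letter (fun b : A * bool * G => b.1.2) 0).
    apply: rec_exists; apply: rec_existsf => th; apply: rec_and.
      exact: (rec_letter (fun b : A * bool * G => b.2.1 th != None) 0).
    exact: (rec_chi letterT th 0 1).
  apply: rec_forall; apply: rec_forallf => th; apply: rec_forallf => a.
  apply: rec_forallf => side; apply: rec_imply.
    exact: (rec_letter (fun b : A * bool * G => b.2.1 th == Some (a, side)) 0).
  apply: rec_exists.
  exact: (rec_npoints (fun b : A * bool * G => b.2.2 (th, a)) 1 0).
- apply: rec_and.
    apply: rec_forall; apply: rec_forall; apply: rec_forallf => th; apply: rec_forallf => a.
    apply: rec_imply; first exact: (rec_letter (fun b : A * bool * G * bool => b.2) 0).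
    apply: rec_imply; first exact: (rec_npoints (fun b : A * bool * G * bool => b.1.2.2 (th, a)) 1 0).
    apply: rec_and; apply: rec_imply.
    + exact: (rec_letter (fun b : A * bool * G * bool => b.1.2.1 th == Some (a, true)) 1).
    + apply: rec_and; first exact: (rec_alpha letterC th 1 0).
      apply: rec_exists; apply: rec_and.
        exact: (rec_letter (fun b : A * bool * G * bool => b.2 (+) neg) 0).
      exact: (rec_beta letterC th 2 0).
    + exact: (rec_letter (fun b : A * bool * G * bool => b.1.2.1 th == Some (a, false)) 1).
    + apply: rec_and; first exact: (rec_beta letterC th 1 0).
      apply: rec_exists; apply: rec_and.
        exact: (rec_letter (fun b : A * bool * G * bool => b.2 (+) neg) 0).
      exact: (rec_alpha letterC th 2 0).
  apply: rec_forall; apply: rec_forall; apply: rec_forall.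
  apply: rec_imply; first exact: (rec_letter (fun b : A * bool * G * bool => ~~ b.1.1.2) 2).
  apply: rec_imply; first exact: (rec_letter (fun b : A * bool * G * bool => b.2) 1).
  apply: rec_imply; first exact: (rec_letter (fun b : A * bool * G * bool => b.2 (+) neg) 0).
  apply: rec_not.
  exact: (rec_rename (fun k => match k with 0 => 2 | 1 => 1 | _ => 0 end)
            (rec_relabel letterC R_rec)).
move=> T f sim eqv.
have sim_refl x : sim x x by case: (eqv x x x).
have simC x y : sim x y = sim y x.
  apply/idP/idP => h; first by have [_ <-] := eqv x y x.
  by have [_ <-] := eqv y x y.
have sim_class x y z : sim x y -> sim x z = sim y z.
  by move=> h; have [_ /(_ h)] := eqv x y z.
pose F z := (f z).1.
pose E : rel (node T) := fun y1 y2 => sim y1 y2 (+) neg.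
split=> [X | [s [[sX sP] sC]] x].
  have : forall th : decomposition M, exists p : (node T -> option ('I_K.+1 * bool)) *
      ('I_K.+1 -> node T -> option direction),
    {in witnessed E (alpha F th) (beta F th), forall m, p.1 m != None} /\
    forall m a side, p.1 m = Some (a, side) ->
      exists2 y, target_ok E (alpha F th) (beta F th) m (y, side) &
        forall y', npoints (p.2 a) m y' = (y' == y).
    by move=> th; have [ptr [lab h]] := pointers F E th; exists (ptr, lab).
  move=> /fin_all_exists[p pP].
  exists (fun z => ([ffun th => (p th).1 z], [ffun q => (p q.1).2 q.2 z])).
  have labE th a m y : npoints (fun z => [ffun q => (p q.1).2 q.2 z] (th, a)) m y
      = npoints ((p th).2 a) m y.
    by apply: eq_forallb => z; rewrite ffunE.
  split; first split.
  - move=> x /X[y1 [y2 [e /MR/decomposeP[m [th [c a b]]]]]].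
    exists m, th; split=> //; rewrite ffunE; apply: (pP th).1.
    by rewrite inE; apply/existsP; exists y1; apply/existsP; exists y2; rewrite /E e a b.
  - move=> m th a side; rewrite ffunE => /eqP/((pP th).2)[y _ yP].
    by exists y; rewrite labE yP.
  move=> x0; split.
    (* A pointer has only one target, so [y] is the one supplied by [pointers]. *)
    move=> m y th a /= x0y; rewrite labE ffunE => pt.
    split=> /eqP pe; have [y' ok yP] := (pP th).2 _ _ _ pe;
      have yy : y = y' by apply/eqP; rewrite -yP.
      move: ok; rewrite -yy => /andP[al /existsP[v /andP[e b]]]; split=> //.
      by exists v; split=> //; move: e; rewrite /E -(sim_class _ _ v x0y).
    move: ok; rewrite -yy => /andP[be /existsP[v /andP[e b]]]; split=> //.
    by exists v; split=> //; move: e; rewrite /E simC -(sim_class _ _ v x0y).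
  move=> x y1 y2 /= nx xy1 xy2 r; case/negP: nx; apply/X; exists y1, y2; split=> //.
  by rewrite -(sim_class _ _ y2 xy1).
split=> [/sX[m [th [pn c]]] | [y1 [y2 [e r]]]]; last first.
  have [_ neg_ok] := sC y1; apply/negPn/negP => nx.
  by apply: (neg_ok x y1 y2 nx) => //=.
case pe : ((s m).1 th) pn => [[a side]|] // _.
have [y yP] : exists y, npoints (fun z => (s z).2 (th, a)) m y.
  by apply: (sP m th a side); rewrite /= pe.
(* The class condition is used on the class of the target. *)
have [/(_ m y th a (sim_refl y) yP)[ht hf] _] := sC y.
case: side pe => pe; rewrite /= pe in ht hf.
  have [al [y' [e b]]] := ht (eqxx _); exists y, y'; split=> //.
  by apply/MR/decomposeP; exists m, th.
have [be [y' [e al]]] := hf (eqxx _); exists y', y; split; first by rewrite simC.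
by apply/MR/decomposeP; exists m, th.
Qed.

End Step.

Lemma rec_closed_eq_label (A : Type) (P : forall T, (node T -> A) -> Prop) T f g :
  rec (fun T f v => P T f) -> f =1 g -> P T f -> P T g.
Proof. exact: (@rec_eq_label _ (fun T f v => P T f) T f g (fun=> root T)). Qed.

Lemma carec_eq_label (A : finType) (Pi : forall T, (node T -> A) -> rel (node T) -> Prop) T f g sm :
  carec Pi -> equivalence_rel sm -> f =1 g -> Pi T f sm -> Pi T g sm.
Proof.
case=> G [R [C [rR rC h]]] eqv fg /h[]// s [r c]; apply/h => //; exists s; split.
  by apply: rec_closed_eq_label r => // z; rewrite fg.
by move=> x; apply: rec_closed_eq_label (c x) => // z; rewrite fg.
Qed.

Lemma carec_class_automaton (A : finType)
    (Pi : forall T, (node T -> A) -> rel (node T) -> Prop) :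
  carec Pi -> exists C : class_automaton A,
    forall d : data_tree A, ca_accepts C d <-> Pi d (label d) (sim d).
Proof.
case=> G [R [C [rR rC h]]].
(* A class condition does not see the input letter, so the work alphabet carries a copy that the
   transducer compares with the input. *)
pose W : finType := (A * G)%type.
have [N NP] : exists N : automaton (A * W), forall T (f : node T -> A * W),
    ((forall x, (f x).1 == (f x).2.1) /\ R T (fun z => (f z).2)) <->
    accepts N f (enc T).
  apply: (rec_closed_automaton (P := fun T (f : node T -> A * W) =>
    (forall x, (f x).1 == (f x).2.1) /\ R T (fun z => (f z).2))).
  apply: rec_and; last exact: (rec_relabel (fun b : A * W => b.2) rR).
  apply: rec_forall; exact: (rec_letter (fun b : A * W => b.1 == b.2.1) 0).
have [N' NP'] := rec_closed_automaton (P := C) rC.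
have regN := regular_accepts (L := fun t : tree (A * W) => accepts N (label t) (enc t))
  (fun t => iff_refl _).
have regN' := regular_accepts (L := fun t : tree (W * bool) => accepts N' (label t) (enc t))
  (fun t => iff_refl _).
exists (ClassAutomaton (RegularLanguage regN) (RegularLanguage regN')) => d.
case: d => [[T lab] sm eqv]; rewrite (h T lab sm eqv) /ca_accepts /=; split.
  case=> s [] /NP[e r] c; exists (fun z => (s z).2).
  have se z : (lab z, (s z).2) = s z.
    by move/eqP: (e z); rewrite ffunE /= => ->; case: (s z).
  split.
    by apply: rec_closed_eq_label r => // z; rewrite ffunE /= se.
  move=> x.
  have /c/NP' : [set z | sm x z] \in classes (@DataTree A (@Tree A T lab) sm eqv).
    apply/imsetP; exists x; rewrite ?inE //.
    by apply/setP => z; rewrite !inE.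
  by apply: rec_closed_eq_label => // z; rewrite /= !ffunE inE se.
case=> s [r c]; exists [ffun z => (lab z, s z)]; split.
  apply/NP; split; first by move=> x; rewrite !ffunE eqxx.
  by apply: rec_closed_eq_label r => // z; rewrite !ffunE.
move=> X /imsetP[x _ XE]; apply/NP'; apply: rec_closed_eq_label (c x) => // z.
by rewrite /= !ffunE XE !inE.
Qed.

(** * Reduction of queries to guessed labels *)

Lemma eq_mso_holds (A : eqType) k (t : tree A) (P P' : 'I_k -> {set node t}) n m
    (f : mso A k n m) v V : P =1 P' -> mso_holds P f v V = mso_holds P' f v V.
Proof.
move=> e; elim: f v V => //= {n m}.
- by move=> n m i x v V; rewrite e.
- by move=> n m f IH v V; rewrite IH.
- by move=> n m f IHf g IHg v V; rewrite IHf IHg.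
- by move=> n m f IH v V; apply: eq_existsb => x.
- by move=> n m f IH v V; apply: eq_existsb => x.
Qed.

(* [Pi] need not determine the auxiliary labels in [C], but all labels that
   satisfy it make the query recognizable by [R]. *)
Definition reducible (A : finType) n (q : query A n) :=
  exists (C : finType) (Pi : forall T, (node T -> A * C) -> rel (node T) -> Prop)
    (R : forall T, (node T -> A * C) -> n.-tuple (node T) -> Prop),
  [/\ carec Pi, rec (fun T f v => R T f (mktuple (fun i : 'I_n => v i))),
      forall d : data_tree A, exists g : node d -> C, Pi d (fun z => (label d z, g z)) (sim d)
    & forall (d : data_tree A) (g : node d -> C), Pi d (fun z => (label d z, g z)) (sim d) ->
      forall v, (v \in q d) <-> R d (fun z => (label d z, g z)) v].

Lemma reducible_family (A : finType) k (q : 'I_k -> query A 1) :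
  (forall i, reducible (q i)) ->
  exists (C : finType) (Pi : forall T, (node T -> A * C) -> rel (node T) -> Prop)
    (R : 'I_k -> forall T, (node T -> A * C) -> node T -> Prop),
  [/\ carec Pi, forall i, rec (fun T f v => R i T f (v 0)),
      forall d : data_tree A, exists g : node d -> C, Pi d (fun z => (label d z, g z)) (sim d)
    & forall (d : data_tree A) (g : node d -> C), Pi d (fun z => (label d z, g z)) (sim d) ->
      forall i x, (x \in query_set (q i) d) <-> R i d (fun z => (label d z, g z)) x].
Proof.
elim: k q => [|k IH] q qP.
  exists unit, (fun T f _ => true), (fun i T f x => true); split=> //.
  - exact: carec_rec (rec_const _ true).
  - by move=> i; apply: rec_const.
  - by move=> d g _ [].
have [C [Pi [R [cP rR tot ok]]]] := qP ord0.
have [C' [Pi' [R' [cP' rR' tot' ok']]]] := IH _ (fun i => qP (lift ord0 i)).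
exists (C * C')%type.
exists (fun T (f : node T -> A * (C * C')) sim => Pi T (fun z => ((f z).1, (f z).2.1)) sim /\
                       Pi' T (fun z => ((f z).1, (f z).2.2)) sim).
exists (fun i T f x => if unlift ord0 i is Some j
  then R' j T (fun z => ((f z).1, (f z).2.2)) x
  else R T (fun z => ((f z).1, (f z).2.1)) (mktuple (fun=> x))); split.
- apply: carec_and; first exact: (carec_relabel (fun b : A * (C * C') => (b.1, b.2.1)) cP).
  exact: (carec_relabel (fun b : A * (C * C') => (b.1, b.2.2)) cP').
- move=> i; case: (unlift ord0 i) => [j|].
    exact: (rec_relabel (fun b : A * (C * C') => (b.1, b.2.2)) (rR' j)).
  exact: (rec_rename (fun=> 0) (rec_relabel (fun b : A * (C * C') => (b.1, b.2.1)) rR)).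
- move=> d; have [g gP] := tot d; have [g' gP'] := tot' d.
  by exists (fun z => (g z, g' z)).
move=> d g [p p'] i x; case: unliftP => [j -> | ->].
  exact: (ok' d (fun z => (g z).2) p').
rewrite -(ok d (fun z => (g z).1) p) inE (_ : mktuple _ = [tuple x]) //.
by apply: eq_from_tnth => j; rewrite tnth_mktuple (ord1 j).
Qed.

Lemma reducible_mso (A : finType) k (q : 'I_k -> query A 1) n (f : mso A k n 0) :
  (forall i, reducible (q i)) ->
  reducible (fun d => [set v | mso_holds (fun i => query_set (q i) d) f v [tuple]]).
Proof.
move=> /reducible_family[C [Pi [R [cP rR tot ok]]]].
(* [mso_holds] takes sets, which require boolean versions of the predicates [R i]; recognizability
   provides them. *)
have /fin_all_exists[p pP] : forall i, exists p : forall T, (node T -> A * C) -> node T -> bool,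
    forall T f x, R i T f x <-> p T f x.
  move=> i; have [p pP] := rec_bool (rR i).
  by exists (fun T f x => p T f (fun=> x)) => T g x; rewrite -pP.
have rp i : rec (fun T f v => p i T f (v 0)) by apply: rec_ext (rR i) => T g v.
have rf := @rec_mso A (A * C)%type fst k p rp n 0 f.
exists C, Pi, (fun T l v => mso_holds (t := Tree [ffun z => (l z).1])
  (fun i => [set x | p i T l x]) f v [tuple]); split=> //.
  have := rec_relabel (fun b : A * C => (b, [ffun=> false] : {ffun 'I_0 -> bool})) rf.
  apply: rec_ext => T l v; rewrite /mso_property /=.
  by rewrite [X in mso_holds _ _ _ X]tuple0.
move=> d g gP v; rewrite inE.
have e i : query_set (q i) d = [set x | p i d (fun z => (label d z, g z)) x].
  apply/setP => x; rewrite [RHS]inE; apply/idP/idP.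
    by move/(ok d g gP)/pP.
  by move/pP/(ok d g gP).
case: d g gP v e => [[T lab] sm eqv] /= g gP v e.
have -> : [ffun z => lab z] = lab by apply/ffunP => z; rewrite ffunE.
by rewrite (@eq_mso_holds A k (Tree lab) _ _ n 0 f v [tuple] e).
Qed.

Lemma tuple3E (X : Type) (v : nat -> X) :
  mktuple (fun i : 'I_3 => v i) = [tuple v 0; v 1; v 2].
Proof. by apply: eq_from_tnth => -[[|[|[|i]]] lti] //; rewrite tnth_mktuple. Qed.

Lemma tuple1E (X : Type) (v : 1.-tuple X) : v = [tuple tnth v ord0].
Proof. by apply: eq_from_tnth => i; rewrite (ord1 i). Qed.

(** The answer is itself guessed as a further bit, which [carec_step] verifies in both directions;
    the query then only reads this bit. *)
Lemma reducible_exists (A : finType) (neg : bool) (q : query A 3) :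
  reducible q ->
  @reducible A 1 (fun d : data_tree A => [set v | [exists y1, [exists y2,
    (sim d y1 y2 (+) neg) && ([tuple tnth v ord0; y1; y2] \in q d)]]]).
Proof.
case=> C [Pi [R [cP rR tot ok]]].
pose R3 T (f : node T -> A * C) x y1 y2 := R T f [tuple x; y1; y2].
have rR3 : rec (fun T f v => R3 T f (v 0) (v 1) (v 2)).
  by apply: rec_ext rR => T f v; rewrite tuple3E.
exists (C * bool)%type.
exists (fun T (f : node T -> A * (C * bool)) sim => Pi T (fun z => ((f z).1, (f z).2.1)) sim /\
  forall x, (f x).2.2 <-> exists y1 y2, sim y1 y2 (+) neg /\
    R3 T (fun z => ((f z).1, (f z).2.1)) x y1 y2).
exists (fun T (f : node T -> A * (C * bool)) v => (f (tnth v ord0)).2.2); split.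
- apply: carec_and; first exact: (carec_relabel (fun b : A * (C * bool) => (b.1, b.2.1)) cP).
  exact: (carec_relabel (fun b : A * (C * bool) => ((b.1, b.2.1), b.2.2))
    (carec_step neg rR3)).
- have := rec_letter (fun b : A * (C * bool) => b.2.2) 0.
  by apply: rec_ext => T f v; rewrite tnth_mktuple.
- move=> d; have [g gP] := tot d.
  exists (fun x => (g x, [exists y1, [exists y2,
    (sim d y1 y2 (+) neg) && ([tuple x; y1; y2] \in q d)]])); split=> //= x; split.
    case/existsP => y1 /existsP[y2 /andP[e h]]; exists y1, y2; split=> //.
    exact/(ok d g gP).
  case=> y1 [y2 [e /(ok d g gP) h]].
  by apply/existsP; exists y1; apply/existsP; exists y2; rewrite e h.
move=> d g [p X] v; rewrite inE; split.
  case/existsP => y1 /existsP[y2 /andP[e h]]; apply/X; exists y1, y2; split=> //.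
  exact/(ok d (fun z => (g z).1) p).
case/X => y1 [y2 [e /(ok d (fun z => (g z).1) p) h]].
by apply/existsP; exists y1; apply/existsP; exists y2; rewrite e h.
Qed.

Lemma reducible_ext (A : finType) n (q q' : query A n) :
  (forall d, q d = q' d) -> reducible q -> reducible q'.
Proof.
move=> e [C [Pi [R [cP rR tot ok]]]]; exists C, Pi, R; split=> // d g gP v.
by rewrite -e; apply: ok.
Qed.

Lemma reducible_xpath (A : finType) n (phi : xpath A n) : reducible (xpath_query phi).
Proof.
elim: phi => {n} [k G IH n f | f IH | f IH].
- exact: reducible_mso IH.
- apply: reducible_ext (reducible_exists false IH) => d; apply/setP => v; rewrite !inE.
  by apply: eq_existsb => y1; apply: eq_existsb => y2; rewrite addbF.
- apply: reducible_ext (reducible_exists true IH) => d; apply/setP => v; rewrite !inE.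
  by apply: eq_existsb => y1; apply: eq_existsb => y2; rewrite addbT.
Qed.

Theorem theorem1 (Sigma : finType) (phi : xpath Sigma 1) :
  exists C : class_automaton (Sigma * bool)%type,
    forall d : data_tree (Sigma * bool),
      ca_accepts C d <-> query_language (xpath_query phi) d.
Proof.
have [C [Pi [R [cP rR tot ok]]]] := reducible_xpath phi.
pose Q T (f : node T -> Sigma * bool * C) (sm : rel (node T)) :=
  Pi T (fun z => ((f z).1.1, (f z).2)) sm /\
  forall x, (f x).1.2 <-> R T (fun z => ((f z).1.1, (f z).2)) [tuple x].
have cQ : carec Q.
  apply: carec_and; first exact: (carec_relabel (fun b : Sigma * bool * C => (b.1.1, b.2)) cP).
  apply: (carec_rec (P := fun T (f : node T -> Sigma * bool * C) => forall x, (f x).1.2 <->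
    R T (fun z => ((f z).1.1, (f z).2)) [tuple x])).
  apply: rec_forall; apply: rec_iff; first exact: (rec_letter (fun b : Sigma * bool * C => b.1.2) 0).
  have := rec_relabel (fun b : Sigma * bool * C => (b.1.1, b.2)) rR.
  by apply: rec_ext => T f v; rewrite (tuple1E (mktuple _)) tnth_mktuple.
(* The labels in [C] are guessed too: some admissible choice exists by [tot], and every admissible
   choice gives the right query by [ok]. *)
have [CA CAP] := carec_class_automaton (carec_exlabel cQ).
have R_eq T f f' x : f =1 f' -> R T f [tuple x] -> R T f' [tuple x].
  move=> ff'; have := @rec_eq_label _ _ T f f' (fun=> x) rR ff'.
  by rewrite (tuple1E (mktuple _)) tnth_mktuple.
exists CA => d; rewrite CAP; split.
  case: d => [[T lab] sm eqv] [g /= [p X]].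
  pose d := @DataTree Sigma (@Tree Sigma T [ffun z => (lab z).1]) sm eqv.
  have p' : Pi d (fun z => (label d z, g z)) (sim d).
    by apply: carec_eq_label p => // z; rewrite /= ffunE.
  exists d.
  have XE x : (lab x).2 = (x \in query_set (xpath_query phi) d).
    rewrite inE; apply/idP/idP => [/X h | /(ok d g p') h]; last apply/X.
      by apply/(ok d g p'); apply: R_eq h => z; rewrite /= ffunE.
    by apply: R_eq h => z; rewrite /= ffunE.
  (* Both data trees have the same shape and relation, so their equality is reduced to that of the
     labellings. *)
  have eq_lab (lab' : {ffun node T -> Sigma * bool}) : lab' = lab ->
      @DataTree _ (@Tree _ T lab) sm eqv = @DataTree _ (@Tree _ T lab') sm eqv by move=> ->.
  by apply: eq_lab; apply/ffunP => x; rewrite !ffunE -XE; case: (lab x).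
case=> d0 ->.
have [g p] := tot d0; exists g; split.
  by apply: carec_eq_label p => //; [exact: sim_equiv | move=> z; rewrite /= !ffunE].
move=> x; rewrite /= !ffunE inE /=; split=> [/(ok d0 g p) | h].
  by apply: R_eq => z; rewrite /= !ffunE.
by apply/(ok d0 g p); apply: R_eq h => z; rewrite /= !ffunE.
Qed.
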